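(* Let $\mathcal{C}$ be an $\infty$-category, and let $p:\mathcal{M}^{\otimes}\to\mathcal{C}\times N(\mathsf{Fin}_{\ast})$ be a categorical fibration satisfying the following two conditions: (a) For each object $M\in\mathcal{M}^{\otimes}$ with image $(C,\langle m\rangle)$ and each inert map $\alpha:\langle m\rangle\to\langle n\rangle$, the morphism $(\mathrm{id}_{C},\alpha)$ admits a $p$-cocartesian lift with source $M$. (b) Let $M\in\mathcal{M}^{\otimes}$ be an object with image $(C,\langle m\rangle)$, where $m\geq1$, and suppose given, for each $1\leq i\leq m$, a $p$-cocartesian lift $f_{i}:M\to M_{i}$ of $(\mathrm{id}_{C},\rho^{i}):(C,\langle m\rangle)\to(C,\langle1\rangle)$. Then the morphisms $f_{i}$ form a $p$-limit cone. Moreover, every object of $\mathcal{M}_{\langle0\rangle}^{\otimes}$ is $p$-terminal. Then the following conditions are equivalent: (c-i) Let $n\geq1$ and $C\in\mathcal{C}$. Given objects $M_{1},\dots,M_{n}\in\mathcal{M}_{C}$, there is an object $M\in\mathcal{M}^{\otimes}$ lying over $(C,\langle n\rangle)$ which admits $p$-cocartesian morphisms $\{M\to M_{i}\}_{1\leq i\leq n}$ over $\{(\mathrm{id}_{C},\rho^{i}):(C,\langle n\rangle)\to(C,\langle1\rangle)\}_{1\leq i\leq n}$. Moreover, for every $C\in\mathcal{C}$, the fiber $\mathcal{M}_{(C,\langle0\rangle)}^{\otimes}$ is non-empty. (c-ii) For each $n\geq1$, the functor $$(\rho_{!}^{i})_{1\leq i\leq n}:\mathcal{M}_{\langle n\rangle}^{\otimes}\to\mathcal{M}\times_{\mathcal{C}}\cdots\times_{\mathcal{C}}\mathcal{M}\quad(n\text{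 factors})$$ is an equivalence of $\infty$-categories, where $\rho_{!}^{i}:\mathcal{M}_{\langle n\rangle}^{\otimes}\to\mathcal{M}_{\langle1\rangle}^{\otimes}=\mathcal{M}$ is the functor over $\mathcal{C}$ induced by $\rho^{i}$. Moreover, the functor $\mathcal{M}_{\langle0\rangle}^{\otimes}\to\mathcal{C}$ is a trivial fibration.
   Context: $\infty$-categories are quasi-categories; a categorical fibration is a fibration in the Joyal model structure. $\mathsf{Fin}_{\ast}$ is the category of pointed sets $\langle n\rangle=\{\ast,1,\dots,n\}$ ($n\ge0$) and pointed maps. A map $\alpha:\langle m\rangle\to\langle n\rangle$ is inert if $\alpha^{-1}(i)$ is a singleton for every $1\le i\le n$. For $1\le i\le n$, $\rho^{i}:\langle n\rangle\to\langle1\rangle$ is the inert map with $(\rho^{i})^{-1}(1)=\{i\}$. Notation: $\mathcal{M}_{\langle n\rangle}^{\otimes}=\mathcal{M}^{\otimes}\times_{N(\mathsf{Fin}_{\ast})}\{\langle n\rangle\}$, $\mathcal{M}=\mathcal{M}_{\langle1\rangle}^{\otimes}$, $\mathcal{M}_{C}$ is the fiber of $\mathcal{M}\to\mathcal{C}$ over $C$, and $\mathcal{M}^{\otimes}_{(C,\langle n\rangle)}$ is the fiber of $p$ over $(C,\langle n\rangle)$. The functor $\rho_{!}^{i}$: by (a) one can choose a natural transformation $H:\mathcal{M}_{\langle n\rangle}^{\otimes}\times\Delta^{1}\to\mathcal{M}^{\otimes}$ whose restriction to $\mathcal{M}_{\langle n\rangle}^{\otimes}\times\{0\}$ is the inclusion,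 all of whose components are $p$-cocartesian, and which lies over the map $\mathcal{M}_{\langle n\rangle}^{\otimes}\times\Delta^{1}\to\mathcal{C}\times N(\mathsf{Fin}_{\ast})$ given by the projection $\mathcal{M}_{\langle n\rangle}^{\otimes}\to\mathcal{C}$ and by $\rho^{i}:\Delta^{1}\to N(\mathsf{Fin}_{\ast})$. Then $\rho_{!}^{i}$ is the restriction of $H$ to $\mathcal{M}_{\langle n\rangle}^{\otimes}\times\{1\}$; it is a functor over $\mathcal{C}$, well defined up to natural equivalence over $\mathcal{C}$. *)

(* Defs.v *)
From mathcomp Require Import all_boot.
From mathcomp Require Import boolp.

Set Implicit Arguments.
Unset Strict Implicit.
Unset Printing Implicit Defensive.

#[local] Obligation Tactic := idtac.

(* [dhom m n] is the set of monotone maps [m] -> [n], where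
   [n] = {0 < ... < n} is 'I_n.+1. *)
Record dhom (m n : nat) := DHom {
  dfun :> 'I_m.+1 -> 'I_n.+1;
  dmono : forall i j : 'I_m.+1, i <= j -> dfun i <= dfun j }.

Lemma dhom_eq m n (f g : dhom m n) : (forall i, f i = g i) -> f = g.
Proof.
case: f g => f hf [g hg] /= fg; have efg : f = g by apply/funext.
by subst g; rewrite (Prop_irrelevance hf hg).
Qed.

Definition did n : dhom n n :=
  @DHom n n (fun i => i) (fun _ _ ij => ij).

Definition dcomp l m n (f : dhom m n) (g : dhom l m) : dhom l n :=
  @DHom l n (fun i => f (g i)) (fun i j ij => dmono f (dmono g ij)).

Definition dconst m n (k : 'I_n.+1) : dhom m n :=
  @DHom m n (fun _ => k) (fun _ _ _ => leqnn k).

Lemma dface_mono n (k : 'I_n.+2) (i j : 'I_n.+1) :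
  i <= j -> lift k i <= lift k j.
Proof. by move=> ij; rewrite /= leq_bump2. Qed.

(* The k-th coface [n] -> [n+1], which omits k. *)
Definition dface n (k : 'I_n.+2) : dhom n n.+1 :=
  @DHom n n.+1 (lift k) (@dface_mono n k).

Lemma dedge_mono n (a b : 'I_n.+1) (ab : a <= b) (i j : 'I_2) :
  i <= j -> (if i == ord0 then a else b) <= (if j == ord0 then a else b).
Proof.
case: (eqVneq i ord0) => [_|i0]; case: (eqVneq j ord0) => [j0|_] //.
by rewrite j0 leqn0 => /eqP i0'; case/eqP: i0; apply: val_inj.
Qed.

Definition dedge n (a b : 'I_n.+1) (ab : a <= b) : dhom 1 n :=
  @DHom 1 n (fun i => if i == ord0 then a else b) (@dedge_mono n a b ab).

Record sset := SSet {
  sobj :> nat -> Type;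
  sact : forall m n, dhom m n -> sobj n -> sobj m;
  sact_id : forall n (x : sobj n), sact (did n) x = x;
  sact_comp : forall l m n (f : dhom m n) (g : dhom l m) (x : sobj n),
    sact (dcomp f g) x = sact g (sact f x) }.

Definition act (X : sset) m n (f : dhom m n) (x : X n) : X m := sact f x.

Record smor (X Y : sset) := SMor {
  sfun :> forall n, X n -> Y n;
  snat : forall m n (f : dhom m n) (x : X n),
    sfun (act f x) = act f (sfun x) }.

Lemma smor_eq (X Y : sset) (f g : smor X Y) :
  (forall n (x : X n), f n x = g n x) -> f = g.
Proof.
case: f g => f hf [g hg] /= fg.
have efg : f = g by apply: functional_extensionality_dep => n; apply/funext.
by subst g; rewrite (Prop_irrelevance hf hg).
Qed.

Definition sidm (X : sset) : smor X X :=
  @SMor X X (fun n x => x) (fun _ _ _ _ => erefl).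

Program Definition scomp (X Y Z : sset) (g : smor Y Z) (f : smor X Y) :
  smor X Z := @SMor X Z (fun n x => g n (f n x)) _.
Next Obligation. by move=> X Y Z g f m n a x; rewrite /= !snat. Qed.

Definition src (X : sset) (e : X 1) : X 0 := act (dconst 0 ord0) e.
Definition tgt (X : sset) (e : X 1) : X 0 := act (dconst 0 ord_max) e.

(* The totally degenerate n-simplex on a vertex; [degen 1 x] is id_x. *)
Definition degen (X : sset) n (x : X 0) : X n := act (dconst n ord0) x.

Program Definition Delta (n : nat) : sset :=
  @SSet (fun m => dhom m n) (fun k m f g => dcomp g f) _ _.
Next Obligation. by move=> n m x; apply: dhom_eq. Qed.
Next Obligation. by move=> n l m k f g x; apply: dhom_eq. Qed.

Program Definition Delta_map m n (f : dhom m n) : smor (Delta m) (Delta n) :=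
  @SMor (Delta m) (Delta n) (fun k (g : dhom k m) => dcomp f g) _.
Next Obligation. by move=> m n f k l a x; apply: dhom_eq. Qed.

Program Definition sprod (X Y : sset) : sset :=
  @SSet (fun n => (X n * Y n)%type)
        (fun m n f xy => (act f xy.1, act f xy.2)) _ _.
Next Obligation. by move=> X Y n [x y]; rewrite /act !sact_id. Qed.
Next Obligation. by move=> X Y l m n f g [x y]; rewrite /act !sact_comp. Qed.

Program Definition sfst (X Y : sset) : smor (sprod X Y) X :=
  @SMor (sprod X Y) X (fun n xy => xy.1) _.
Next Obligation. by []. Qed.

Program Definition ssnd (X Y : sset) : smor (sprod X Y) Y :=
  @SMor (sprod X Y) Y (fun n xy => xy.2) _.
Next Obligation. by []. Qed.

Program Definition sprod_map (X X' Y Y' : sset)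
    (f : smor X X') (g : smor Y Y') : smor (sprod X Y) (sprod X' Y') :=
  @SMor (sprod X Y) (sprod X' Y') (fun n xy => (f n xy.1, g n xy.2)) _.
Next Obligation. by move=> X X' Y Y' f g m n a [x y] /=; rewrite !snat. Qed.

Program Definition subsset (X : sset) (P : forall n, X n -> Prop)
    (hP : forall m n (f : dhom m n) (x : X n), P n x -> P m (act f x)) : sset :=
  @SSet (fun n => {x : X n | P n x})
        (fun m n f x => exist _ (act f (sval x)) (hP m n f _ (svalP x))) _ _.
Next Obligation.
by move=> X P hP n [x hx]; apply: eq_exist; rewrite /act sact_id.
Qed.
Next Obligation.
by move=> X P hP l m n f g [x hx]; apply: eq_exist; rewrite /act sact_comp.
Qed.

Program Definition subsset_incl (X : sset) (P : forall n, X n -> Prop)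
    (hP : forall m n (f : dhom m n) (x : X n), P n x -> P m (act f x)) :
  smor (subsset hP) X := @SMor (subsset hP) X (fun n x => sval x) _.
Next Obligation. by []. Qed.

Lemma pullback_closed (X Y S : sset) (f : smor X S) (g : smor Y S)
    m n (a : dhom m n) (xy : sprod X Y n) :
  f n xy.1 = g n xy.2 -> f m (act a xy).1 = g m (act a xy).2.
Proof. by move=> e; rewrite /= !snat e. Qed.

Definition pullback (X Y S : sset) (f : smor X S) (g : smor Y S) : sset :=
  subsset (pullback_closed (f := f) (g := g)).

Program Definition pullback_pair (W X Y S : sset) (f : smor X S) (g : smor Y S)
    (u : smor W X) (v : smor W Y) (uv : forall n w, f n (u n w) = g n (v n w)) :
  smor W (pullback f g) :=
  @SMor W (pullback f g) (fun n w => exist _ (u n w, v n w) (uv n w)) _.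
Next Obligation.
by move=> W X Y S f g u v uv m n a w; apply: eq_exist; rewrite !snat.
Qed.

Lemma fiber_closed (X S : sset) (q : smor X S) (s : S 0)
    m n (f : dhom m n) (x : X n) :
  q n x = degen n s -> q m (act f x) = degen m s.
Proof.
move=> e; rewrite snat e /degen /act -sact_comp.
by congr sact; apply: dhom_eq.
Qed.

(* The fiber product of q with the inclusion {s} -> S. *)
Definition fiber (X S : sset) (q : smor X S) (s : S 0) : sset :=
  subsset (fiber_closed (q := q) (s := s)).

Definition fiber_incl (X S : sset) (q : smor X S) (s : S 0) :
  smor (fiber q s) X := subsset_incl (fiber_closed (q := q) (s := s)).

(* The fiber product over C of a family of copies of q : X -> C, with an
   explicit base component, so that the empty family yields C. *)
Lemma fiber_power_closed (I : Type) (X C : sset) (q : smor X C)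
    m n (a : dhom m n) (cx : (C n * (I -> X n))%type) :
  (forall i, q n (cx.2 i) = cx.1) ->
  forall i, q m (act a (cx.2 i)) = act a cx.1.
Proof. by move=> e i; rewrite snat e. Qed.

Program Definition fiber_power (I : Type) (X C : sset) (q : smor X C) : sset :=
  @SSet (fun n => {cx : (C n * (I -> X n))%type |
                   forall i, q n (cx.2 i) = cx.1})
        (fun m n a cx =>
           exist _ (act a (sval cx).1, fun i => act a ((sval cx).2 i))
                 (fiber_power_closed a (svalP cx))) _ _.
Next Obligation.
move=> I X C q n [[c x] h]; apply: eq_exist; rewrite /act /= sact_id.
by congr pair; apply/funext => i; rewrite sact_id.
Qed.
Next Obligation.
move=> I X C q l m n f g [[c x] h]; apply: eq_exist; rewrite /act /= sact_comp.
by congr pair; apply/funext => i; rewrite sact_comp.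
Qed.

Program Definition fiber_power_pair (I : Type) (W X C : sset) (q : smor X C)
    (r : smor W C) (u : I -> smor W X)
    (h : forall i n w, q n (u i n w) = r n w) : smor W (fiber_power I q) :=
  @SMor W (fiber_power I q)
    (fun n w => exist _ (r n w, fun i => u i n w) (fun i => h i n w)) _.
Next Obligation.
move=> I W X C q r u h m n a w; apply: eq_exist; rewrite snat /=.
by congr pair; apply/funext => i; rewrite snat.
Qed.

Definition disc_sset (I : Type) : sset :=
  @SSet (fun _ => I) (fun _ _ _ i => i) (fun _ _ => erefl)
        (fun _ _ _ _ _ _ => erefl).

Definition lifts_against (A B X S : sset) (i : smor A B) (q : smor X S) :
  Prop :=
  forall (u : smor A X) (v : smor B S),
    (forall n a, q n (u n a) = v n (i n a)) ->
    exists w : smor B X,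
      (forall n a, w n (i n a) = u n a) /\ (forall n b, q n (w n b) = v n b).

Lemma boundary_closed N m n (f : dhom m n) (a : Delta N n) :
  [exists j, [forall i, a i != j]] ->
  [exists j, [forall i, (act f a : dhom m N) i != j]].
Proof.
case/existsP=> j /forallP hj; apply/existsP; exists j.
by apply/forallP=> i; apply: hj.
Qed.

Definition boundary (N : nat) : sset :=
  subsset (P := fun n (a : Delta N n) => [exists j, [forall i, a i != j]])
          (@boundary_closed N).

Definition boundary_incl (N : nat) : smor (boundary N) (Delta N) :=
  subsset_incl (@boundary_closed N).

Lemma horn_closed N (k : 'I_N.+1) m n (f : dhom m n) (a : Delta N n) :
  [exists j, (j != k) && [forall i, a i != j]] ->
  [exists j, (j != k) && [forall i, (act f a : dhom m N) i != j]].
Proof.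
case/existsP=> j /andP[jk /forallP hj]; apply/existsP; exists j; rewrite jk.
by apply/forallP=> i; apply: hj.
Qed.

Definition horn (N : nat) (k : 'I_N.+1) : sset :=
  subsset (P := fun n (a : Delta N n) =>
             [exists j, (j != k) && [forall i, a i != j]])
          (@horn_closed N k).

Definition horn_incl (N : nat) (k : 'I_N.+1) : smor (horn k) (Delta N) :=
  subsset_incl (@horn_closed N k).

Definition trivial_fibration (X S : sset) (q : smor X S) : Prop :=
  forall N, lifts_against (boundary_incl N) q.

Definition quasicategory (X : sset) : Prop :=
  forall N (k : 'I_N.+1), 0 < k -> k < N ->
  forall u : smor (horn k) X, exists w : smor (Delta N) X,
    forall n a, w n (horn_incl k n a) = u n a.

(* e becomes invertible in the homotopy category of X: there are an edge e'
   and two 2-simplices witnessing e' o e = id and e o e' = id. *)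
Definition is_equiv_edge (X : sset) (e : X 1) : Prop :=
  exists (e' : X 1) (s t : X 2),
    [/\ act (dface (inord 2)) s = e, act (dface (inord 0)) s = e'
      & act (dface (inord 1)) s = degen 1 (src e)] /\
    [/\ act (dface (inord 2)) t = e', act (dface (inord 0)) t = e
      & act (dface (inord 1)) t = degen 1 (tgt e)].

Program Definition Fun (X Y : sset) : sset :=
  @SSet (fun n => smor (sprod (Delta n) X) Y)
        (fun m n f g => scomp g (sprod_map (Delta_map f) (sidm X))) _ _.
Next Obligation.
move=> X Y n x; apply: smor_eq => k [a y] /=.
by congr (x _ (_, _)); apply: dhom_eq.
Qed.
Next Obligation.
move=> X Y l m n f g x; apply: smor_eq => k [a y] /=.
by congr (x _ (_, _)); apply: dhom_eq.
Qed.

Definition fun_vertex (X Y : sset) (f : smor X Y) : Fun X Y 0 :=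
  scomp f (ssnd (Delta 0) X).

(* Equivalence of f and g as objects of Fun X Y, for Y a quasi-category. *)
Definition naturally_equiv (X Y : sset) (f g : smor X Y) : Prop :=
  exists e : Fun X Y 1,
    [/\ src e = fun_vertex f, tgt e = fun_vertex g & is_equiv_edge e].

(* For X and Y quasi-categories. *)
Definition equivalence_of_qcats (X Y : sset) (F : smor X Y) : Prop :=
  exists G : smor Y X,
    naturally_equiv (scomp G F) (sidm X) /\
    naturally_equiv (scomp F G) (sidm Y).

Definition cofibration (A B : sset) (i : smor A B) : Prop :=
  forall n, injective (i n).

(* For every quasi-category Z, precomposition with i is a bijection between
   equivalence classes of objects of Fun B Z and of Fun A Z. *)
Definition categorical_equivalence (A B : sset) (i : smor A B) : Prop :=
  forall Z : sset, quasicategory Z ->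
    (forall f : smor A Z, exists g : smor B Z, naturally_equiv (scomp g i) f) /\
    (forall g g' : smor B Z, naturally_equiv (scomp g i) (scomp g' i) ->
       naturally_equiv g g').

Definition categorical_fibration (X S : sset) (q : smor X S) : Prop :=
  forall (A B : sset) (i : smor A B),
    cofibration i -> categorical_equivalence i -> lifts_against i q.

(* An n-simplex of X * Y (the join) is a decomposition of [n] into an initial
   segment (where jcut is false) and the complementary final segment, either
   of which may be empty, with a simplex of X on the former and a simplex of Y
   on the latter.  A simplex on a possibly empty segment I of [n] is encoded as
   a map to X from the subcomplex of Delta n spanned by I. *)
Record join_simplex (X Y : sset) (n : nat) := JoinSimplex {
  jcut : 'I_n.+1 -> bool;
  jcut_mono : forall i j : 'I_n.+1, i <= j -> jcut i -> jcut j;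
  jleft : forall k (a : dhom k n), (forall i, jcut (a i) = false) -> X k;
  jleft_nat : forall l k (a : dhom k n) (b : dhom l k)
    (ha : forall i, jcut (a i) = false)
    (hab : forall i, jcut (dcomp a b i) = false),
    jleft hab = act b (jleft ha);
  jright : forall k (a : dhom k n), (forall i, jcut (a i) = true) -> Y k;
  jright_nat : forall l k (a : dhom k n) (b : dhom l k)
    (ha : forall i, jcut (a i) = true)
    (hab : forall i, jcut (dcomp a b i) = true),
    jright hab = act b (jright ha) }.

Lemma join_simplex_eq (X Y : sset) n (s t : join_simplex X Y n) :
  (forall i, jcut s i = jcut t i) ->
  (forall k (a : dhom k n) hs ht, @jleft _ _ _ s k a hs = @jleft _ _ _ t k a ht) ->
  (forall k (a : dhom k n) hs ht,
     @jright _ _ _ s k a hs = @jright _ _ _ t k a ht) ->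
  s = t.
Proof.
case: s t => c1 m1 l1 ln1 r1 rn1 [c2 m2 l2 ln2 r2 rn2] /= ec el er.
have e : c1 = c2 by apply/funext.
subst c2.
have e : l1 = l2.
  do 3![apply: functional_extensionality_dep => ?]; exact: el.
subst l2.
have e : r1 = r2.
  do 3![apply: functional_extensionality_dep => ?]; exact: er.
subst r2.
by rewrite (Prop_irrelevance m1 m2) (Prop_irrelevance ln1 ln2)
  (Prop_irrelevance rn1 rn2).
Qed.

Lemma jleft_irr (X Y : sset) n (s : join_simplex X Y n) k (a b : dhom k n)
    (ha : forall i, jcut s (a i) = false) (hb : forall i, jcut s (b i) = false) :
  (forall i, a i = b i) -> jleft ha = jleft hb.
Proof.
by move/dhom_eq=> ab; subst b; rewrite (Prop_irrelevance ha hb).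
Qed.

Lemma jright_irr (X Y : sset) n (s : join_simplex X Y n) k (a b : dhom k n)
    (ha : forall i, jcut s (a i) = true) (hb : forall i, jcut s (b i) = true) :
  (forall i, a i = b i) -> jright ha = jright hb.
Proof.
by move/dhom_eq=> ab; subst b; rewrite (Prop_irrelevance ha hb).
Qed.

Program Definition join_act (X Y : sset) m n (f : dhom m n)
    (s : join_simplex X Y n) : join_simplex X Y m :=
  @JoinSimplex X Y m (fun i => jcut s (f i)) _
    (fun k a ha => @jleft _ _ _ s k (dcomp f a) ha) _
    (fun k a ha => @jright _ _ _ s k (dcomp f a) ha) _.
Next Obligation.
by move=> X Y m n f s i j ij /=; apply: jcut_mono; apply: dmono.
Qed.
Next Obligation.
move=> X Y m n f s l k a b ha hab /=.
have hab' : forall i, jcut s (dcomp (dcomp f a) b i) = false by [].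
by rewrite -(@jleft_nat _ _ _ s _ _ (dcomp f a) b ha hab'); apply: jleft_irr.
Qed.
Next Obligation.
move=> X Y m n f s l k a b ha hab /=.
have hab' : forall i, jcut s (dcomp (dcomp f a) b i) = true by [].
by rewrite -(@jright_nat _ _ _ s _ _ (dcomp f a) b ha hab'); apply: jright_irr.
Qed.

Program Definition join (X Y : sset) : sset :=
  @SSet (join_simplex X Y) (@join_act X Y) _ _.
Next Obligation.
move=> X Y n s; apply: join_simplex_eq => // k a hs ht /=.
- exact: jleft_irr.
- exact: jright_irr.
Qed.
Next Obligation.
move=> X Y l m n f g s; apply: join_simplex_eq => // k a hs ht /=.
- exact: jleft_irr.
- exact: jright_irr.
Qed.

Program Definition join_map (X X' Y Y' : sset) (f : smor X X') (g : smor Y Y') :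
  smor (join X Y) (join X' Y') :=
  @SMor (join X Y) (join X' Y')
    (fun n s => @JoinSimplex X' Y' n (jcut s) (@jcut_mono _ _ _ s)
       (fun k a ha => f k (@jleft _ _ _ s k a ha)) _
       (fun k a ha => g k (@jright _ _ _ s k a ha)) _) _.
Next Obligation.
by move=> X X' Y Y' f g n s l k a b ha hab /=; rewrite (jleft_nat ha) snat.
Qed.
Next Obligation.
by move=> X X' Y Y' f g n s l k a b ha hab /=; rewrite (jright_nat ha) snat.
Qed.
Next Obligation.
move=> X X' Y Y' f g m n a s; apply: join_simplex_eq => // k b hs ht /=.
- by congr (sfun _ _); apply: jleft_irr.
- by congr (sfun _ _); apply: jright_irr.
Qed.

Lemma trueNfalse : true = false -> False. Proof. by []. Qed.

Definition no_left (T : Type) k (h : forall _ : 'I_k.+1, true = false) : T :=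
  match trueNfalse (h ord0) with end.

Program Definition join_inr (X Y : sset) : smor Y (join X Y) :=
  @SMor Y (join X Y)
    (fun n y => @JoinSimplex X Y n (fun _ => true) (fun _ _ _ h => h)
       (fun k a h => no_left (X k) h) _ (fun k a _ => act a y) _) _.
Next Obligation.
by move=> X Y n y l k a b ha; case: (trueNfalse (ha ord0)).
Qed.
Next Obligation. by move=> X Y n y l k a b ? ?; rewrite /act sact_comp. Qed.
Next Obligation.
move=> X Y m n f y; apply: join_simplex_eq => // k a hs ht /=.
- by case: (trueNfalse (ht ord0)).
- by rewrite /act sact_comp.
Qed.

(* The left cone on K. *)
Definition cone (K : sset) : sset := join (Delta 0) K.

Lemma slice_closed (X K : sset) (q : smor K X) m n (f : dhom m n)
    (g : smor (join (Delta n) K) X) :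
  (forall k y, g k (join_inr (Delta n) K k y) = q k y) ->
  forall k y, scomp g (join_map (Delta_map f) (sidm K)) k
                (join_inr (Delta m) K k y) = q k y.
Proof.
move=> h k y; rewrite -h /=; congr (sfun _ _); apply: join_simplex_eq => //=.
- by move=> l a hs; case: (trueNfalse (hs ord0)).
Qed.

(* The slice X_{/q}: its n-simplices are the maps (Delta n) * K -> X which
   restrict to q on K. *)
Program Definition slice (X K : sset) (q : smor K X) : sset :=
  @SSet (fun n => {g : smor (join (Delta n) K) X |
                   forall k y, g k (join_inr (Delta n) K k y) = q k y})
        (fun m n f g =>
           exist _ (scomp (sval g) (join_map (Delta_map f) (sidm K)))
                 (slice_closed f (svalP g))) _ _.
Next Obligation.
move=> X K q n [g h]; apply: eq_exist; apply: smor_eq => k s /=.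
congr (sfun _ _); apply: join_simplex_eq => // l a hs ht /=.
- by rewrite (Prop_irrelevance hs ht); apply: dhom_eq.
- by rewrite (Prop_irrelevance hs ht).
Qed.
Next Obligation.
move=> X K q l m n f f' [g h]; apply: eq_exist; apply: smor_eq => k s /=.
congr (sfun _ _); apply: join_simplex_eq => // r a hs ht /=.
- by rewrite (Prop_irrelevance hs ht); apply: dhom_eq.
- by rewrite (Prop_irrelevance hs ht).
Qed.

Lemma slice_post_proof (X S K : sset) (p : smor X S) (q : smor K X) n
    (g : slice q n) k y :
  scomp p (sval g) k (join_inr (Delta n) K k y) = scomp p q k y.
Proof. by rewrite /= (svalP g). Qed.

(* X_{/q} -> S_{/pq} *)
Program Definition slice_post (X S K : sset) (p : smor X S) (q : smor K X) :
  smor (slice q) (slice (scomp p q)) :=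
  @SMor (slice q) (slice (scomp p q))
    (fun n g => exist _ (scomp p (sval g)) (slice_post_proof p g)) _.
Next Obligation.
by move=> X S K p q m n f g; apply: eq_exist; apply: smor_eq.
Qed.

Lemma slice_pre_proof (X K L : sset) (j : smor L K) (q : smor K X)
    (q' : smor L X) (hq : forall k y, q k (j k y) = q' k y) n
    (g : slice q n) k y :
  scomp (sval g) (join_map (sidm (Delta n)) j) k (join_inr (Delta n) L k y)
  = q' k y.
Proof.
rewrite -hq /= -(svalP g) /=; congr (sfun _ _); apply: join_simplex_eq => //=.
- by move=> l a hs; case: (trueNfalse (hs ord0)).
- by move=> l a _ _; rewrite snat.
Qed.

(* X_{/q} -> X_{/q'} for q' = qj *)
Program Definition slice_pre (X K L : sset) (j : smor L K) (q : smor K X)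
    (q' : smor L X) (hq : forall k y, q k (j k y) = q' k y) :
  smor (slice q) (slice q') :=
  @SMor (slice q) (slice q')
    (fun n g => exist _ (scomp (sval g) (join_map (sidm (Delta n)) j))
                      (slice_pre_proof hq g)) _.
Next Obligation.
move=> X K L j q q' hq m n f g; apply: eq_exist; apply: smor_eq => k s /=.
congr (sfun _ _); apply: join_simplex_eq => // l a hs ht /=.
- by rewrite (Prop_irrelevance hs ht); apply: dhom_eq.
- by rewrite (Prop_irrelevance hs ht).
Qed.

Lemma slice_square (X S K L : sset) (p : smor X S) (j : smor L K)
    (q : smor K X) n (g : slice q n) :
  slice_post p (scomp q j) n
    (slice_pre (j := j) (q := q) (q' := scomp q j) (fun _ _ => erefl) n g) =
  slice_pre (j := j) (q := scomp p q) (q' := scomp p (scomp q j))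
    (fun _ _ => erefl) n (slice_post p q n g).
Proof. by apply: eq_exist; apply: smor_eq. Qed.

(* X_{/q} -> X_{/qj} x_{S_{/pqj}} S_{/pq} *)
Definition slice_comparison (X S K L : sset) (p : smor X S) (j : smor L K)
    (q : smor K X) :=
  pullback_pair
    (u := slice_pre (j := j) (q := q) (q' := scomp q j) (fun _ _ => erefl))
    (v := slice_post p q) (slice_square p j (q := q)).

(* qbar : K^<| -> X is a p-limit diagram. *)
Definition is_relative_limit (X S K : sset) (p : smor X S)
    (qbar : smor (cone K) X) : Prop :=
  trivial_fibration (slice_comparison p (join_inr (Delta 0) K) qbar).

(* The label in I of a simplex of the cone on a discrete I which is not
   contained in the cone point. *)
Definition cone_label (I : Type) n (s : cone (disc_sset I) n)
    (h : jcut s ord_max = true) : I :=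
  @jright _ _ _ s 0 (dconst 0 ord_max) (fun _ => h).

Lemma cut_dhom_mono (X Y : sset) n (s : join_simplex X Y n) (i j : 'I_n.+1) :
  i <= j ->
  (if jcut s i then ord_max else ord0 : 'I_2) <=
  (if jcut s j then ord_max else ord0 : 'I_2).
Proof.
by move=> /(@jcut_mono _ _ _ s); case: (jcut s i) => // ->.
Qed.

(* The projection of the join X * Y to the join of two points, Delta 1. *)
Definition cut_dhom (X Y : sset) n (s : join_simplex X Y n) : dhom n 1 :=
  @DHom n 1 (fun i => if jcut s i then ord_max else ord0)
        (@cut_dhom_mono X Y n s).

(* The map (disc I)^<| -> X with cone point x which carries the edge from the
   cone point to i to f i : x -> tgt (f i). *)
Definition cone_of_fun (X : sset) (I : Type) (x : X 0) (f : I -> X 1) n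
    (s : cone (disc_sset I) n) : X n :=
  match decP (@idP (jcut s ord_max)) with
  | left h => act (cut_dhom s) (f (cone_label h))
  | right _ => degen n x
  end.

Lemma cone_of_nat (X : sset) (I : Type) (x : X 0) (f : I -> X 1)
    (hf : forall i, src (f i) = x) m n (a : dhom m n)
    (s : cone (disc_sset I) n) :
  cone_of_fun x f (act a s) = act a (cone_of_fun x f s).
Proof.
rewrite /cone_of_fun.
have le_max k (i : 'I_k.+1) : i <= (ord_max : 'I_k.+1) by rewrite -ltnS.
case: decP => [h1|h1]; case: decP => [h2|h2] /=.
- rewrite /act -sact_comp; congr (sact _ (f _)); first exact: dhom_eq.
  rewrite /cone_label /=.
  pose e := dedge (le_max n (a ord_max)).
  have he : forall i, jcut s (e i) = true.
    by move=> i /=; case: ifP.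
  have h0 : forall i, jcut s (dcomp e (dconst 0 ord0) i) = true.
    by move=> i; apply: he.
  have h3 : forall i, jcut s (dcomp e (dconst 0 ord_max) i) = true.
    by move=> i; apply: he.
  transitivity (jright h0).
    exact: (@jright_irr _ _ _ s 0 (dcomp a (dconst 0 ord_max)) _
              (fun _ => h1) h0).
  rewrite (jright_nat he h0).
  transitivity (jright h3); first by rewrite (jright_nat he h3).
  exact: (@jright_irr _ _ _ s 0 _ (dconst 0 ord_max) h3 (fun _ => h2)).
- by case: h2; apply: (jcut_mono (le_max n (a ord_max))).
- rewrite /act -sact_comp -(hf (cone_label h2)) /degen /src /act -sact_comp.
  congr sact; apply: dhom_eq => i /=.
  case: ifP => // hi; case: h1.
  by apply: (jcut_mono _ hi); apply: dmono; apply: le_max.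
- by rewrite /degen /act -sact_comp; congr sact; apply: dhom_eq.
Qed.

Definition cone_of (X : sset) (I : Type) (x : X 0) (f : I -> X 1)
    (hf : forall i, src (f i) = x) : smor (cone (disc_sset I)) X :=
  @SMor (cone (disc_sset I)) X (@cone_of_fun X I x f) (cone_of_nat hf).

Definition is_relative_terminal (X S : sset) (p : smor X S) (x : X 0) : Prop :=
  is_relative_limit p
    (@cone_of X void x (of_void (X 1)) (fun i => match i with end)).

Lemma horn_first_edge_proof N :
  [exists j : 'I_N.+3, (j != ord0) &&
     [forall i, @dedge N.+2 ord0 (inord 1) (leq0n _) i != j]].
Proof.
apply/existsP; exists ord_max; rewrite -val_eqE /=; apply/forallP => l.
by rewrite -val_eqE /=; case: ifP => _ //=; rewrite inordK.
Qed.

(* The edge 0 -> 1 of the horn of Delta (N+2) at the vertex 0. *)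
Definition horn_first_edge N : horn (ord0 : 'I_N.+3) 1 :=
  exist _ (@dedge N.+2 ord0 (inord 1) (leq0n _)) (horn_first_edge_proof N).

(* For p an inner fibration. *)
Definition is_cocartesian (X S : sset) (p : smor X S) (f : X 1) : Prop :=
  forall N (u : smor (horn (ord0 : 'I_N.+3)) X) (v : smor (Delta N.+2) S),
    (forall n a, p n (u n a) = v n (horn_incl (ord0 : 'I_N.+3) n a)) ->
    u 1 (horn_first_edge N) = f ->
    exists w : smor (Delta N.+2) X,
      (forall n a, w n (horn_incl (ord0 : 'I_N.+3) n a) = u n a) /\
      (forall n b, p n (w n b) = v n b).

Definition cocartesian_lift (X S : sset) (p : smor X S) (x : X 0) (e : S 1)
    (f : X 1) : Prop :=
  [/\ src f = x, p 1 f = e & is_cocartesian p f].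

Lemma cocartesian_lift_src (X S : sset) (p : smor X S) (x : X 0) (e : S 1)
    (f : X 1) : cocartesian_lift p x e f -> src f = x.
Proof. by case. Qed.

Record category := Category {
  ob : Type;
  hom : ob -> ob -> Type;
  idc : forall a, hom a a;
  compc : forall a b c, hom b c -> hom a b -> hom a c;
  comp_idl : forall a b (f : hom a b), compc (idc b) f = f;
  comp_idr : forall a b (f : hom a b), compc f (idc a) = f;
  comp_assoc : forall a b c d (h : hom c d) (g : hom b c) (f : hom a b),
    compc h (compc g f) = compc (compc h g) f }.

(* A functor [n] -> C. *)
Record nerve_simplex (C : category) (n : nat) := NerveSimplex {
  nob : 'I_n.+1 -> ob C;
  nhom : forall i j : 'I_n.+1, i <= j -> hom (nob i) (nob j);
  nhom_id : forall (i : 'I_n.+1) (h : i <= i), nhom h = idc (nob i);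
  nhom_comp : forall (i j k : 'I_n.+1) (ij : i <= j) (jk : j <= k) (ik : i <= k),
    nhom ik = compc (nhom jk) (nhom ij) }.

Lemma nerve_simplex_eq (C : category) n (x : 'I_n.+1 -> ob C)
    (h h' : forall i j : 'I_n.+1, i <= j -> hom (x i) (x j)) hi hc hi' hc' :
  (forall i j ij, h i j ij = h' i j ij) ->
  @NerveSimplex C n x h hi hc = @NerveSimplex C n x h' hi' hc'.
Proof.
move=> e; have e' : h = h'.
  do 3![apply: functional_extensionality_dep => ?]; exact: e.
by subst h'; rewrite (Prop_irrelevance hi hi') (Prop_irrelevance hc hc').
Qed.

Program Definition nerve_act (C : category) m n (f : dhom m n)
    (s : nerve_simplex C n) : nerve_simplex C m :=
  @NerveSimplex C m (fun i => nob s (f i))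
    (fun i j ij => nhom s (dmono f ij)) _ _.
Next Obligation. by move=> C m n f s i h; apply: nhom_id. Qed.
Next Obligation. by move=> C m n f s i j k ij jk ik; apply: nhom_comp. Qed.

Program Definition nerve (C : category) : sset :=
  @SSet (nerve_simplex C) (@nerve_act C) _ _.
Next Obligation.
move=> C n [x h hi hc]; apply: nerve_simplex_eq => i j ij /=.
by congr h; apply: Prop_irrelevance.
Qed.
Next Obligation.
move=> C l m n f g [x h hi hc]; apply: nerve_simplex_eq => i j ij /=.
by congr h; apply: Prop_irrelevance.
Qed.

Program Definition nerve_vertex (C : category) (a : ob C) : nerve C 0 :=
  @NerveSimplex C 0 (fun _ => a) (fun _ _ _ => idc a) _ _.
Next Obligation. by []. Qed.
Next Obligation. by move=> C a *; rewrite comp_idl. Qed.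

Section NerveEdge.
Context (C : category) (a b : ob C) (f : hom a b).

Definition nedge_ob (i : nat) : ob C := if i is 0 then a else b.

Definition nedge_hom (i j : nat) :
    i <= j -> hom (nedge_ob i) (nedge_ob j) :=
  match i, j return i <= j -> hom (nedge_ob i) (nedge_ob j) with
  | 0, 0 => fun _ => idc a
  | 0, _.+1 => fun _ => f
  | _.+1, 0 => fun h => match trueNfalse (esym h) with end
  | _.+1, _.+1 => fun _ => idc b
  end.

Program Definition nerve_edge : nerve C 1 :=
  @NerveSimplex C 1 (fun i => nedge_ob i) (fun i j ij => @nedge_hom i j ij) _ _.
Next Obligation. by case=> [[|i] ?] h. Qed.
Next Obligation.
case=> [[|i] ?] [[|j] ?] [[|k] ?] ij jk ik //=;
  by rewrite /= ?comp_idl ?comp_idr.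
Qed.
End NerveEdge.

(* <n> = {*, 1, ..., n} is option 'I_n, with base point None. *)
Record pointed_map (m n : nat) := PMap {
  pfun :> option 'I_m -> option 'I_n;
  pfun_base : pfun None = None }.

Lemma pmap_eq m n (f g : pointed_map m n) : (forall x, f x = g x) -> f = g.
Proof.
case: f g => f hf [g hg] /= fg; have efg : f = g by apply/funext.
by subst g; rewrite (Prop_irrelevance hf hg).
Qed.

Definition pmap_id n : pointed_map n n := @PMap n n id erefl.

Program Definition pmap_comp l m n (g : pointed_map m n) (f : pointed_map l m) :
  pointed_map l n :=
  @PMap l n (fun x => g (f x)) _.
Next Obligation. by move=> l m n g f; rewrite /= !pfun_base. Qed.

Program Definition FinStar : category :=
  @Category nat pointed_map pmap_id (fun l m n => @pmap_comp l m n) _ _ _.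
Next Obligation. by move=> m n f; apply: pmap_eq. Qed.
Next Obligation. by move=> m n f; apply: pmap_eq. Qed.
Next Obligation. by move=> k l m n h g f; apply: pmap_eq. Qed.

Definition inert m n (alpha : pointed_map m n) : Prop :=
  forall i : 'I_n, exists! j : option 'I_m, alpha j = Some i.

Definition rho_map n (i : 'I_n) : pointed_map n 1 :=
  @PMap n 1 (fun x => if x == Some i then Some ord0 else None) erefl.

Definition NFin : sset := nerve FinStar.
Definition vFin (n : nat) : NFin 0 := @nerve_vertex FinStar n.
Definition eFin m n (alpha : pointed_map m n) : NFin 1 :=
  @nerve_edge FinStar m n alpha.

(* The morphism (id_c, alpha) of C x N(Fin_* ). *)
Definition id_edge (C : sset) (c : C 0) m n (alpha : pointed_map m n) :
  sprod C NFin 1 := (degen 1 c, eFin alpha).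

Lemma eFin_target m n (alpha : pointed_map m n) k :
  act (dconst k ord_max) (eFin alpha) = degen k (vFin n).
Proof. by apply: nerve_simplex_eq. Qed.

(* Here and below M stands for the total simplicial set M^otimes; [fib p n] is
   M^otimes_<n>, so that [fib p 1] is what is usually written M. *)
Definition fib (C M : sset) (p : smor M (sprod C NFin)) (n : nat) : sset :=
  fiber (scomp (ssnd C NFin) p) (vFin n).

Definition fib_proj (C M : sset) (p : smor M (sprod C NFin)) (n : nat) :
  smor (fib p n) C :=
  scomp (sfst C NFin) (scomp p (fiber_incl (scomp (ssnd C NFin) p) (vFin n))).

(* M_c, the fiber of M^otimes_<1> -> C over c. *)
Definition fib1_over (C M : sset) (p : smor M (sprod C NFin)) (c : C 0) :
  sset :=
  fiber (fib_proj p 1) c.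

Definition fib1_over_incl (C M : sset) (p : smor M (sprod C NFin)) (c : C 0) :
  smor (fib1_over p c) M :=
  scomp (fiber_incl (scomp (ssnd C NFin) p) (vFin 1))
        (fiber_incl (fib_proj p 1) c).

(* A p-cocartesian natural transformation H : M^otimes_<n> x Delta 1 -> M^otimes
   from the inclusion, covering rho^i; rho^i_! is its value at 1. *)
Record rho_transport (C M : sset) (p : smor M (sprod C NFin)) n (i : 'I_n) :=
  RhoTransport {
    rho_htpy : smor (sprod (fib p n) (Delta 1)) M;
    rho_htpy_start : forall k (x : fib p n k),
      rho_htpy k (x, dconst k ord0) = sval x;
    rho_htpy_cocart : forall x : fib p n 0,
      is_cocartesian p (rho_htpy 1 (degen 1 x, did 1));
    rho_htpy_over : forall k (x : fib p n k) (t : Delta 1 k),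
      p k (rho_htpy k (x, t)) = (fib_proj p n k x, act t (eFin (rho_map i))) }.

Lemma rho_shriek_proof (C M : sset) (p : smor M (sprod C NFin)) n (i : 'I_n)
    (H : rho_transport p i) k (x : fib p n k) :
  scomp (ssnd C NFin) p k (rho_htpy H k (x, dconst k ord_max)) =
  degen k (vFin 1).
Proof. by rewrite /= rho_htpy_over; apply: eFin_target. Qed.

Program Definition rho_shriek (C M : sset) (p : smor M (sprod C NFin)) n
    (i : 'I_n) (H : rho_transport p i) : smor (fib p n) (fib p 1) :=
  @SMor (fib p n) (fib p 1)
    (fun k x => exist _ (rho_htpy H k (x, dconst k ord_max))
                        (rho_shriek_proof H x)) _.
Next Obligation.
move=> C M p n i H k l f x; apply: eq_exist.
by rewrite -snat; congr (rho_htpy H _ (_, _)); apply: dhom_eq.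
Qed.

Lemma rho_shriek_over (C M : sset) (p : smor M (sprod C NFin)) n (i : 'I_n)
    (H : rho_transport p i) k (x : fib p n k) :
  fib_proj p 1 k (rho_shriek H k x) = fib_proj p n k x.
Proof. by rewrite /= rho_htpy_over. Qed.

Definition rho_tuple (C M : sset) (p : smor M (sprod C NFin)) n
    (H : forall i : 'I_n, rho_transport p i) :
  smor (fib p n) (fiber_power 'I_n (fib_proj p 1)) :=
  fiber_power_pair (q := fib_proj p 1) (r := fib_proj p n)
    (fun i k w => rho_shriek_over (H i) w).

(* Main.v *)
(* Every extension problem is solved on the nerve of a finite poset: a partial lift
   is enlarged by attaching pairs of chains {T, T minus t}, each along a horn which is
   inner or has a cocartesian first edge.  In this way one gets that Fun(X, Z) is a
   quasi-category and that p is an inner fibration, the two-out-of-three property of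
   cocartesian edges, and that equivalences are cocartesian.

   Let Z be the simplicial set of families of n cocartesian legs, that is, of diagrams
   on the cone over n points lying over the rho^i whose edges are cocartesian.
   Restriction to the cone point is a trivial fibration Z -> M_<n>; the rho^i_! give
   a section s of it, and restriction to the base Z -> M x_C ... x_C M composed with s
   is the functor of (c-ii).  If (c-i) holds, the p-limit property makes the second
   restriction a trivial fibration too, whence (c-ii).

   Conversely, an inverse G of the functor of (c-ii) yields an object over G(y) whose
   legs are equivalent to the y_i by equivalences over C, not over a vertex; lifting
   the induced equivalence of C to M^otimes moves that object over c, and the two
   cocartesianness criteria above produce the legs. *)
Require Import Defs.
From mathcomp Require Import classical_sets.
From mathcomp Require Import all_boot.
From mathcomp Require Import boolp zify.

Set Implicit Arguments.
Unset Strict Implicit.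
Unset Printing Implicit Defensive.
#[local] Obligation Tactic := idtac.

(** * Partial lifts *)

(** Extension problems are not decomposed into pushouts and saturated classes. A partial lift is a
    functional relation closed under simplicial operators, and on the nerve of a poset the simplices
    it covers are described by their vertex sets; attaching cells becomes a matching on finite sets,
    in the manner of discrete Morse theory. For arbitrary simplicial sets, and for the
    infinite-dimensional [J], Zorn's lemma supplies a maximal partial lift instead.

    The obstacle is the definition of a categorical fibration: it lifts against monomorphisms that
    are categorical equivalences, and yields nothing until such maps are exhibited. Two kinds
    suffice. Inner horn inclusions qualify because restriction of function complexes along them is a
    trivial fibration. The inclusion of a point into the nerve [J] of the walking isomorphism
    qualifies because [J] contracts. The latter gives lifts of equivalences once every equivalence
    extends to [J], and that extension rests on equivalences being cocartesian over a point. *)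

Lemma act_did (X : sset) n (x : X n) : act (did n) x = x.
Proof. exact: sact_id. Qed.

Lemma act_act (X : sset) l m n (f : dhom m n) (g : dhom l m) (x : X n) :
  act g (act f x) = act (dcomp f g) x.
Proof. by rewrite /act sact_comp. Qed.

Lemma act_congr (X : sset) m n (f g : dhom m n) (x : X n) :
  (forall i, f i = g i) -> act f x = act g x.
Proof. by move/dhom_eq->. Qed.

Lemma act_degen (X : sset) m n (f : dhom m n) (x : X 0) :
  act f (degen n x) = degen m x.
Proof. by rewrite /degen act_act; apply: act_congr. Qed.

Lemma act_to0 (X : sset) n (f : dhom n 0) (x : X 0) : act f x = degen n x.
Proof. by apply: act_congr => i; rewrite !ord1. Qed.

Lemma degen0 (X : sset) (x : X 0) : degen 0 x = x.
Proof. by rewrite -[RHS]act_did; apply: act_congr => i; rewrite !ord1. Qed.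

Lemma smor_degen (X Y : sset) (f : smor X Y) n (x : X 0) :
  f n (degen n x) = degen n (f 0 x).
Proof. by rewrite /degen snat. Qed.

Lemma smor_src (X Y : sset) (f : smor X Y) (e : X 1) : f 0 (src e) = src (f 1 e).
Proof. by rewrite /src snat. Qed.

Lemma smor_tgt (X Y : sset) (f : smor X Y) (e : X 1) : f 0 (tgt e) = tgt (f 1 e).
Proof. by rewrite /tgt snat. Qed.

Definition ymap (X : sset) n (x : X n) : smor (Delta n) X :=
  @SMor (Delta n) X (fun m f => act f x)
        (fun l m a f => esym (act_act f a x)).

Lemma smor_Delta (X : sset) n (w : smor (Delta n) X) m (a : Delta n m) :
  w m a = act a (w n (did n)).
Proof. by rewrite -snat; congr (w _ _); apply: dhom_eq. Qed.

(* A partial lift of [v : B -> S] through [q : X -> S], encoded by its graph. *)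
Record plift (B X S : sset) (q : smor X S) (v : smor B S)
    (G : forall n, B n -> X n -> Prop) : Prop := PLift {
  pl_fun : forall n b x x', G n b x -> G n b x' -> x = x';
  pl_act : forall m n (f : dhom m n) b x, G n b x -> G m (act f b) (act f x);
  pl_over : forall n b x, G n b x -> q n x = v n b }.

Definition pdom (B X : sset) (G : forall n, B n -> X n -> Prop) n (b : B n) :=
  exists x, G n b x.

Lemma pdom_act (B X S : sset) (q : smor X S) (v : smor B S) G (hG : plift q v G)
    m n (f : dhom m n) (b : B n) : pdom G b -> pdom G (act f b).
Proof. by case=> x hx; exists (act f x); apply: (pl_act hG). Qed.

Lemma plift_pull (B B' X S : sset) (q : smor X S) (v : smor B S) G
    (phi : smor B' B) : plift q v G ->
  plift q (scomp v phi) (fun n b x => G n (phi n b) x).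
Proof.
case=> h1 h2 h3; split=> /=.
- by move=> n b; apply: h1.
- by move=> m n f b x /h2; rewrite snat; apply.
- by move=> n b x; apply: h3.
Qed.

(** Values are picked by choice; [pl_fun] makes the pick unique, which turns it into a simplicial
    map. *)
Lemma plift_smor (A B X S : sset) (q : smor X S) (v : smor B S) G
    (phi : smor A B) : plift q v G -> (forall n a, pdom G (phi n a)) ->
  exists u : smor A X, forall n a, G n (phi n a) (u n a).
Proof.
move=> hG hd; pose u n a := sval (cid (hd n a)).
have hu n a : G n (phi n a) (u n a) := svalP (cid (hd n a)).
unshelve eexists (@SMor A X u _); last exact: hu.
move=> m n f x; apply: (pl_fun hG (hu _ _)).
by rewrite snat; apply: (pl_act hG).
Qed.

(** The hypotheses say that [phi] meets the domain of [G] exactly in [A] and is injective off it.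
    The enlarged domain is thus a pushout of [D] along [A], and the filler [w] glues with [G]. *)
Lemma attach_lift (A D B X S : sset) (i : smor A D) (q : smor X S)
    (v : smor B S) G (phi : smor D B) :
  plift q v G ->
  (forall n a, pdom G (phi n (i n a))) ->
  (forall n d, pdom G (phi n d) -> exists a, i n a = d) ->
  (forall n d d', phi n d = phi n d' -> pdom G (phi n d) \/ d = d') ->
  (forall u : smor A X, (forall n a, G n (phi n (i n a)) (u n a)) ->
     exists w : smor D X, (forall n a, w n (i n a) = u n a) /\
       (forall n d, q n (w n d) = v n (phi n d))) ->
  exists G', [/\ plift q v G', forall n b x, G n b x -> G' n b x &
    forall n b, pdom G' b <-> pdom G b \/ exists d, b = phi n d].
Proof.
move=> hG hA hD hinj hfill.
have [u hu] := @plift_smor _ _ _ _ _ _ _ (scomp phi i) hG hA.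
have [w [wu wv]] := hfill u hu.
have Gw n d x : G n (phi n d) x -> w n d = x.
  move=> hx; have [a ea] : exists a, i n a = d by apply: hD; exists x.
  by apply: (pl_fun hG _ hx); rewrite -ea wu; apply: hu.
exists (fun n b x => G n b x \/ exists d, b = phi n d /\ x = w n d); split.
- split.
  + move=> n b x x' [hx|[d [eb ->]]] [hx'|[d' [eb' ->]]].
    * exact: (pl_fun hG hx hx').
    * by subst b; rewrite (Gw _ _ _ hx).
    * by subst b; rewrite (Gw _ _ _ hx').
    * subst b; have [[y hy]|->//] := hinj _ _ _ eb'.
      by rewrite (Gw _ _ _ hy); rewrite eb' in hy; rewrite (Gw _ _ _ hy).
  + move=> m n f b x [hx|[d [-> ->]]]; first by left; apply: (pl_act hG).
    by right; exists (act f d); rewrite !snat.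
  + by move=> n b x [/(pl_over hG)//|[d [-> ->]]]; rewrite wv.
- by move=> n b x hx; left.
- move=> n b; split.
  + by case=> x [hx|[d [-> _]]]; [left; exists x|right; exists d].
  + by case=> [[x hx]|[d ->]]; [exists x; left|exists (w n d); right; exists d].
Qed.

Definition inner_fibration (X S : sset) (q : smor X S) : Prop :=
  forall N (k : 'I_N.+1), 0 < k -> k < N -> lifts_against (horn_incl k) q.

Definition pt : sset := disc_sset unit.
Definition to_pt (X : sset) : smor X pt :=
  @SMor X pt (fun _ _ => tt) (fun _ _ _ _ => erefl).

Lemma quasicategory_inner (X : sset) :
  quasicategory X -> inner_fibration (to_pt X).
Proof.
move=> hX N k k0 kN u v _; have [w hw] := hX N k k0 kN u.
by exists w; split=> // n b; case: (v n b).
Qed.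

Lemma inner_quasicategory (X S : sset) (q : smor X S) :
  quasicategory S -> inner_fibration q -> quasicategory X.
Proof.
move=> hS hq N k k0 kN u.
have [v hv] := hS N k k0 kN (scomp q u).
have [w [hw _]] := hq N k k0 kN u v (fun n a => esym (hv n a)).
by exists w.
Qed.

(** * Nerves of finite posets and their chains *)

Record fposet := FPoset {
  fpc :> finType;
  fle : rel fpc;
  fle_refl : reflexive fle;
  fle_anti : antisymmetric fle;
  fle_trans : transitive fle }.

Record chain_simplex (V : fposet) (n : nat) := ChainSimplex {
  cvert :> 'I_n.+1 -> V;
  cmono : forall i j : 'I_n.+1, i <= j -> fle (cvert i) (cvert j) }.

Lemma chain_eq V n (x y : chain_simplex V n) : (forall i, x i = y i) -> x = y.
Proof.
case: x y => f hf [g hg] /= fg; have efg : f = g by apply/funext.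
by subst g; rewrite (Prop_irrelevance hf hg).
Qed.

Definition chain_act V m n (f : dhom m n) (x : chain_simplex V n) :
  chain_simplex V m :=
  @ChainSimplex V m (fun i => x (f i)) (fun i j ij => cmono x (dmono f ij)).

Definition PN (V : fposet) : sset :=
  @SSet (chain_simplex V) (@chain_act V)
    (fun n x => @chain_eq V n (chain_act (did n) x) x (fun i => erefl))
    (fun l m n f g x => @chain_eq V l (chain_act (dcomp f g) x)
       (chain_act g (chain_act f x)) (fun i => erefl)).

Definition supp V n (x : PN V n) : {set V} := [set x i | i in 'I_n.+1].

Lemma supp_in V n (x : PN V n) i : x i \in supp x.
Proof. exact: imset_f. Qed.

Lemma suppP V n (x : PN V n) a :
  reflect (exists i, a = x i) (a \in supp x).
Proof.
apply: (iffP imsetP) => [[i _ ->]|[i ->]]; first by exists i.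
by exists i.
Qed.

Lemma supp_act V m n (f : dhom m n) (x : PN V n) : supp (act f x) \subset supp x.
Proof. by apply/subsetP=> a /suppP[i ->]; apply: supp_in. Qed.

Lemma supp_neq0 V n (x : PN V n) : supp x != set0.
Proof. by apply/set0Pn; exists (x ord0); apply: supp_in. Qed.

Definition fchain (V : fposet) (T : {set V}) : bool :=
  (T != set0) && [forall a in T, forall b in T, fle a b || fle b a].

Lemma fchainP (V : fposet) (T : {set V}) :
  reflect (T != set0 /\ forall a b, a \in T -> b \in T -> fle a b || fle b a)
          (fchain T).
Proof.
apply: (iffP andP) => -[T0 h]; split=> //.
- by move=> a b aT bT; move/forall_inP: h => /(_ _ aT)/forall_inP/(_ _ bT).
- by apply/forall_inP=> a aT; apply/forall_inP=> b bT; apply: h.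
Qed.

Lemma fchain_sub (V : fposet) (T T' : {set V}) :
  T' \subset T -> T' != set0 -> fchain T -> fchain T'.
Proof.
move=> /subsetP sT T'0 /fchainP[_ h]; apply/fchainP; split=> // a b aT bT.
by apply: h; apply: sT.
Qed.

Lemma fchain_supp V n (x : PN V n) : fchain (supp x).
Proof.
apply/fchainP; split; first exact: supp_neq0.
move=> _ _ /suppP[i ->] /suppP[j ->].
by case/orP: (leq_total i j) => /(cmono x) ->; rewrite ?orbT.
Qed.

Lemma chain_enum (V : fposet) (T : {set V}) N : fchain T -> #|T| = N.+1 ->
  exists b : PN V N, injective b /\ supp b = T.
Proof.
move=> /fchainP[_ hT] cT; pose s := sort (@fle V) (enum T).
have ss : size s = N.+1 by rewrite size_sort -cardE.
have us : uniq s by rewrite sort_uniq enum_uniq.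
have srt : sorted (@fle V) s.
  apply: (sort_sorted_in (P := [in T])) => [a b|]; first exact: hT.
  by apply/allP=> a; rewrite mem_enum.
have [x0 _] : exists x0, x0 \in T by apply/set0Pn; rewrite -card_gt0 cT.
have hm (i j : 'I_N.+1) : i <= j -> fle (nth x0 s i) (nth x0 s j).
  move=> ij.
  apply: (sorted_leq_nth (@fle_trans V) (@fle_refl V) x0 srt) => //;
    by rewrite inE ss.
exists (@ChainSimplex V N (fun i => nth x0 s i) hm); split.
- move=> i j /= /eqP; rewrite nth_uniq ?ss // => /eqP; exact: val_inj.
- apply/setP=> a; have -> : (a \in T) = (a \in s) by rewrite mem_sort mem_enum.
  apply/suppP/idP => [[i ->]|].
    by apply: mem_nth; rewrite ss.
  case/(nthP x0) => i; rewrite ss => iN <-.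
  by exists (Ordinal iN).
Qed.

Lemma chain_le (V : fposet) N (b : PN V N) (i j : 'I_N.+1) :
  injective b -> fle (b i) (b j) = (i <= j).
Proof.
move=> bi; apply/idP/idP; last exact: cmono.
move=> h; rewrite leqNgt; apply/negP => ji.
have /eqP : b i = b j by apply: fle_anti; rewrite h (cmono b (ltnW ji)).
by rewrite (inj_eq bi) -val_eqE /= => /eqP e; rewrite e ltnn in ji.
Qed.

(** * Extending partial lifts along chains *)

Definition inner_pivot (V : fposet) (T : {set V}) (k : V) : Prop :=
  exists a c, [/\ a \in T, c \in T, a != k, c != k & fle a k && fle k c].

(** [k] is below the rest of [T] and [e] runs from it to the second least element, so the horn of
    [T] at [k] is a left horn whose first edge has a cocartesian value. [2 < #|T|] keeps its
    dimension at least 2. *)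
Definition cocart_pivot (V : fposet) (X S : sset) (q : smor X S)
    (G : forall n, PN V n -> X n -> Prop) (T : {set V}) (k : V) : Prop :=
  exists (e : PN V 1) (f : X 1),
    [/\ e ord0 = k, e ord_max \in T, e ord_max != k, 2 < #|T| &
     (forall z, z \in T -> z != k -> fle (e ord_max) z) /\
     (G 1 e f /\ is_cocartesian q f)].

Definition fillable (V : fposet) (X S : sset) (q : smor X S)
    (G : forall n, PN V n -> X n -> Prop) (T : {set V}) (k : V) : Prop :=
  inner_fibration q /\ inner_pivot T k \/ cocart_pivot q G T k.

Lemma fillable_sub (V : fposet) (X S : sset) (q : smor X S)
    (G G' : forall n, PN V n -> X n -> Prop) T k :
  (forall n b x, G n b x -> G' n b x) -> fillable q G T k -> fillable q G' T k.
Proof.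
move=> GG' [h|[e [f [h1 h2 h3 h4 [h5 [h6 h7]]]]]]; [by left|right].
by exists e, f; split=> //; split=> //; split=> //; apply: GG'.
Qed.

(** A simplex of [PN V] and its nondegenerate core have the same support, and a chain is recovered
    from its vertex set. Families of finite sets can therefore stand for subcomplexes. *)
Definition has_dom (V : fposet) (X : sset) (G : forall n, PN V n -> X n -> Prop)
  (P : pred {set V}) := forall n (b : PN V n), pdom G b <-> P (supp b).
Arguments has_dom V X G P : clear implicits.

Definition extends_to (V : fposet) (X S : sset) (q : smor X S) (v : smor (PN V) S)
    (G : forall n, PN V n -> X n -> Prop) (Q : pred {set V}) : Prop :=
  exists G', [/\ plift q v G', forall n b x, G n b x -> G' n b x & has_dom V X G' Q].

Definition downward (V : fposet) (P : pred {set V}) :=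
  forall T T' : {set V}, T' \subset T -> T' != set0 -> P T -> P T'.
Arguments downward V P : clear implicits.

Lemma hornP N (k : 'I_N.+1) n (a : Delta N n) :
  reflect (exists2 j, j != k & forall i, a i != j)
    [exists j, (j != k) && [forall i, a i != j]].
Proof.
apply: (iffP existsP) => [[j /andP[jk /forallP h]]|[j jk h]]; exists j => //.
by rewrite jk; apply/forallP.
Qed.

(* [T] and [T :\ k] are attached together, along the horn of [T] at [k]. *)
Lemma attach_chain (V : fposet) (X S : sset) (q : smor X S) (v : smor (PN V) S)
    G (P : pred {set V}) (T : {set V}) (k : V) :
  plift q v G -> has_dom V X G P -> downward V P ->
  fchain T -> k \in T -> ~~ P T -> ~~ P (T :\ k) ->
  (forall j, j \in T -> j != k -> P (T :\ j)) ->
  fillable q G T k ->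
  extends_to q v G [pred U | [|| P U, U == T | U == T :\ k]].
Proof.
move=> hG hP dP cT kT PT PTk hface hfill.
have [N cTN] : exists N, #|T| = N.+1.
  by case/fchainP: (cT) => T0 _; exists #|T|.-1; rewrite prednK // card_gt0.
have [b [bi sb]] := chain_enum cT cTN.
have [k0 ek0] : exists k0, k = b k0 by apply/suppP; rewrite sb.
have bT i : b i \in T by rewrite -sb supp_in.
have suppb n (a : Delta N n) : supp (act a b) \subset T by rewrite -sb supp_act.
have hA n (a : horn k0 n) : pdom G (act (horn_incl k0 n a) b).
  apply/hP; case: a => a /= /hornP[j jk ha].
  have Pj : P (T :\ b j) by apply: hface => //; rewrite ek0 (inj_eq bi).
  apply: dP Pj; last exact: supp_neq0.
  rewrite subsetD1 suppb /=; apply/suppP => -[i /= /bi e].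
  by move: (ha i); rewrite -e eqxx.
(* A simplex of [T] outside the horn misses no vertex except possibly [k]. *)
have full n (a : Delta N n) :
    ~~ [exists j, (j != k0) && [forall i, a i != j]] ->
    supp (act a b) = T \/ supp (act a b) = T :\ k.
  move=> na.
  have sub z : z \in T -> z != k -> z \in supp (act a b).
    rewrite -sb => /suppP[j ->]; rewrite ek0 (inj_eq bi) => jk.
    apply/suppP; apply/not_existsP => h; case/negP: na; apply/hornP.
    by exists j => // i; apply/eqP => e; case: (h i); rewrite /= e.
  have [ka|ka] := boolP (k \in supp (act a b)); [left|right].
    apply/eqP; rewrite eqEsubset suppb; apply/subsetP => z zT.
    by have [->//|] := eqVneq z k; apply: sub.
  apply/eqP; rewrite eqEsubset subsetD1 suppb ka; apply/subsetP => z.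
  by rewrite !inE => /andP[zk zT]; apply: sub.
have hD n (a : Delta N n) :
    pdom G (act a b) -> exists a', horn_incl k0 n a' = a.
  move=> /hP h; have [ha|/full e] := boolP
    [exists j, (j != k0) && [forall i, a i != j]].
    by exists (exist _ a ha).
  by case: e h => ->; [rewrite (negPf PT)|rewrite (negPf PTk)].
have hfill' (u : smor (horn k0) X) :
    (forall n a, G n (act (horn_incl k0 n a) b) (u n a)) ->
    exists w : smor (Delta N) X, (forall n a, w n (horn_incl k0 n a) = u n a) /\
      forall n d, q n (w n d) = v n (act d b).
  move=> hu.
  have huv n a : q n (u n a) = scomp v (ymap b) n (horn_incl k0 n a).
    exact: (pl_over hG (hu n a)).
  case: hfill => [[hq [a [c [aT cT' ak ck /andP[hak hkc]]]]]|].
    move: aT cT' ak ck hak hkc; rewrite -sb => /suppP[i ->] /suppP[j ->].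
    rewrite ek0 !(inj_eq bi) !chain_le // => ik jk lik lkj.
    have ltk : i < k0 by rewrite ltn_neqAle lik -val_eqE in ik *; rewrite ik.
    have ltj : k0 < j.
      by rewrite ltn_neqAle lkj andbT eq_sym; move: jk; rewrite -val_eqE.
    apply: (hq N k0 _ _ u (scomp v (ymap b)) huv).
      exact: leq_ltn_trans ltk.
    by rewrite -ltnS; apply: leq_ltn_trans ltj _; apply: ltn_ord.
  case=> e [f [ek eT enk cT2 [emin [Gef fco]]]].
  move: cT2; rewrite cTN => cN.
  (* [2 < #|T|] rules out the first two values and leaves a horn of dimension [N.+2]. *)
  case: N => [|[|N]] // in b bi sb k0 ek0 bT suppb hA full hD u hu huv cTN cN *.
  have k00 : k0 = ord0.
    apply: val_inj => /=; apply/eqP; rewrite -leqn0 -[0]/(val (ord0 : 'I_N.+3)).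
    rewrite -(chain_le _ _ bi) -ek0.
    have [<-|n0] := eqVneq (b ord0) k; first exact: fle_refl.
    apply: fle_trans (emin _ (bT _) n0); rewrite -ek; exact: cmono.
  subst k0.
  have e1 : e ord_max = b (inord 1).
    have : e ord_max \in supp b by rewrite sb.
    case/suppP=> j ej; rewrite ej; congr (b _).
    have j1 : 0 < j.
      rewrite lt0n; apply/eqP=> j0; case/eqP: enk; rewrite ej ek0.
      by congr (b _); apply: val_inj.
    have := emin _ (bT (inord 1)); rewrite ej ek0 (inj_eq bi) (chain_le _ _ bi).
    rewrite -val_eqE /= inordK // => /(_ isT) j1'.
    by apply: val_inj; rewrite /= inordK //; apply/eqP; rewrite eqn_leq j1' j1.
  apply: (fco N u (scomp v (ymap b)) huv).
  apply: (pl_fun hG (hu _ _)).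
  suff -> : act (horn_incl ord0 1 (horn_first_edge N)) b = e by [].
  apply: chain_eq => i /=; case: ifP => [/eqP->|i0]; first by rewrite ek.
  rewrite -e1; congr (e _); apply: val_inj => /=.
  by case: i i0 => -[|[|]].
have hinj (n : nat) (d d' : Delta N n) :
    act d b = act d' b -> pdom G (act d b) \/ d = d'.
  move=> e; right; apply: dhom_eq => i; apply: bi.
  by have := congr1 (fun x : PN V n => x i) e.
have [G' [hG' GG' dG']] := attach_lift (i := horn_incl k0) (phi := ymap b)
  hG hA hD hinj hfill'.
exists G'; split=> // n c; rewrite dG' /=; split.
  case=> [/hP -> //|[d ->]].
  have [ha|/full] := boolP [exists j, (j != k0) && [forall i, d i != j]].
    by have /hP -> := hA n (exist _ d ha).
  by case=> ->; rewrite eqxx ?orbT.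
have subT : supp c \subset T -> exists d, c = act d b.
  move=> /subsetP sc; have hc i : exists j, c i = b j.
    by apply/suppP; rewrite sb; apply: sc; apply: supp_in.
  pose d i := sval (cid (hc i)); have ed i : c i = b (d i) := svalP (cid (hc i)).
  have dm (i j : 'I_n.+1) : i <= j -> d i <= d j.
    by move=> ij; rewrite -(chain_le _ _ bi) -!ed; apply: cmono.
  by exists (DHom dm); apply: chain_eq.
case/or3P => [hc|/eqP e|/eqP e]; [by left; apply/hP|right|right].
  by apply: subT; rewrite e.
by apply: subT; rewrite e subsetDl.
Qed.

(* The chains of [Q] outside [P] are matched by toggling the pivot [t T]; the pairs
   are attached in the order of [#|T|], then of [rk T]. *)
Lemma pairing (V : fposet) (X S : sset) (q : smor X S) (v : smor (PN V) S)
    (Q : pred {set V}) (t : {set V} -> V) (rk : {set V} -> nat) :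
  downward V Q -> (forall T, Q T -> fchain T) ->
  forall (P : pred {set V}) G,
  plift q v G -> has_dom V X G P -> downward V P ->
  (forall T, fchain T -> P T -> Q T) ->
  (forall T, Q T -> ~~ P T -> [/\ Q (t T |: T), ~~ P (T :\ t T),
     T :\ t T != set0, t (t T |: T) = t T & t (T :\ t T) = t T]) ->
  (forall T, Q T -> ~~ P T -> t T \in T -> forall j, j \in T -> j != t T ->
     [|| P (T :\ j), t (T :\ j) \in T :\ j | rk (T :\ j) < rk T]) ->
  (forall T, Q T -> ~~ P T -> rk (t T |: T) = rk T) ->
  (forall T, Q T -> ~~ P T -> t T \in T -> fillable q G T (t T)) ->
  extends_to q v G Q.
Proof.
move=> dQ cQ P; have [m] := ubnP #|[set T | Q T && ~~ P T]|.
elim: m P => // m IH P /ltnSE lem G hG hP dP PQ hpiv hface hrk hfill.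
(* If no missing chain contains its pivot, none is missing at all: adding the pivot to a missing
   chain gives a missing one that contains it. *)
have [/existsP[T0 hT0]|hne] := boolP [exists T, [&& Q T, ~~ P T & t T \in T]];
  last first.
  have QP T : fchain T -> Q T = P T.
    move=> cT; apply/idP/idP; last exact: PQ.
    move=> QT; apply/negP => /negP PT; case/negP: hne; apply/existsP.
    have [h1 h2 h3 h4 h5] := hpiv _ QT PT; exists (t T |: T).
    rewrite h1 h4 setU11 andbT /=; apply/negP => h; case/negP: PT.
    by apply: dP h; [apply: subsetUr|case/fchainP: (cQ _ QT)].
  by exists G; split=> // n b; rewrite QP; [apply: hP|apply: fchain_supp].
(* The lexicographic order on cardinality and rank, coded by one number: the factor exceeds every
   rank. *)
pose le2 (T : {set V}) := #|T| * (\max_(U : {set V}) rk U).+1 + rk T.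
have le2P (T T' : {set V}) : #|T| < #|T'| \/ (#|T| = #|T'| /\ rk T < rk T') -> le2 T < le2 T'.
  rewrite /le2; case=> [h|[-> h]]; last by rewrite ltn_add2l.
  apply: (@leq_trans (#|T| * (\max_U rk U).+1 + (\max_U rk U).+1)).
    by rewrite ltn_add2l ltnS (leq_bigmax_cond T).
  apply: (@leq_trans (#|T'| * (\max_U rk U).+1)); last exact: leq_addr.
  by rewrite addnC -mulSn leq_mul2r h orbT.
case: (arg_minnP le2 (P := fun T => [&& Q T, ~~ P T & t T \in T]) hT0).
move=> T /and3P[QT PT tT] hmin.
have [h1 h2 h3 h4 h5] := hpiv _ QT PT.
(* A face outside [P] that holds its pivot is a smaller candidate; otherwise adjoining the pivot
   gives a candidate of the size of [T] and of lower rank. Both contradict minimality. *)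
have hfaces j : j \in T -> j != t T -> P (T :\ j).
  move=> jT jt; apply/negP => /negP PTj.
  have QTj : Q (T :\ j).
    apply: dQ QT; first exact: subsetDl.
    by apply/set0Pn; exists (t T); rewrite !inE eq_sym jt.
  have [g1 g2 g3 g4 g5] := hpiv _ QTj PTj.
  have := hface _ QT PT tT _ jT jt; rewrite (negPf PTj) /=.
  have [tj _|tj /= rj] := boolP (t (T :\ j) \in T :\ j).
    have := hmin (T :\ j); rewrite QTj PTj tj => /(_ isT).
    rewrite leqNgt => /negP; apply; apply: le2P; left.
    by rewrite [X in _ < X](cardsD1 j) jT.
  have := hmin (t (T :\ j) |: T :\ j); rewrite g1 g4 setU11 /= andbT.
  have PU : ~~ P (t (T :\ j) |: T :\ j).
    apply/negP => h; case/negP: PTj; apply: dP h; first exact: subsetUr.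
    by case/fchainP: (cQ _ QTj).
  move=> /(_ PU); rewrite leqNgt => /negP; apply; apply: le2P; right.
  by rewrite hrk // cardsU1 tj [in RHS](cardsD1 j) jT.
have [G1 [hG1 GG1 dG1]] := attach_chain hG hP dP (cQ _ QT) tT PT h2 hfaces
  (hfill _ QT PT tT).
pose P1 := [pred U | [|| P U, U == T | U == T :\ t T]].
have QTt : Q (T :\ t T) by apply: dQ QT => //; apply: subsetDl.
have dP1 : downward V P1.
  move=> U U' sU U0 /or3P[PU|/eqP eU|/eqP eU].
  - by rewrite /P1 /= (dP _ _ sU U0 PU).
  - subst U; rewrite /P1 /=; have [->|nU] := eqVneq U' T; first by rewrite orbT.
    have [_|nU'] := eqVneq U' (T :\ t T); first by rewrite !orbT.
    have [j jT jU] : exists2 j, j \in T & j \notin U'.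
      have /properP[_ [j jT jU]] : U' \proper T by rewrite properEneq nU.
      by exists j.
    case: (eqVneq j (t T)) => [ej|jt]; last first.
      by rewrite (dP _ _ _ U0 (hfaces j jT jt)) // subsetD1 sU.
    subst j; have /properP[_ [j]] : U' \proper T :\ t T.
      by rewrite properEneq nU' subsetD1 sU.
    rewrite !inE => /andP[jt jT'] jU'.
    by rewrite (dP _ _ _ U0 (hfaces j jT' jt)) // subsetD1 sU.
  - subst U; rewrite /P1 /=; have [//|nU] := eqVneq U' (T :\ t T).
      by rewrite !orbT.
    have /properP[_ [j]] : U' \proper T :\ t T by rewrite properEneq nU.
    rewrite !inE => /andP[jt jT'] jU'.
    rewrite (dP _ _ _ U0 (hfaces j jT' jt)) // subsetD1 jU' andbT.
    by apply: subset_trans sU _; apply: subsetDl.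
have nP1 U : Q U -> ~~ P1 U -> Q U /\ ~~ P U.
  by move=> QU; rewrite /P1 /= !negb_or => /and3P[].
have [G2 [hG2 GG2 dG2]] : extends_to q v G1 Q.
  apply: (IH P1) => //.
  - apply: leq_trans lem; apply: proper_card; apply/properP; split.
      by apply/subsetP=> U; rewrite !inE => /andP[QU /(nP1 _ QU)[-> ->]].
    by exists T; rewrite !inE ?QT // eqxx orbT.
  - by move=> U cU /or3P[/(PQ _ cU)//|/eqP->|/eqP->].
  (* The pairing survives: [T] and [T] minus its pivot are matched with each other, so removing the
     pivot from another chain yields neither. *)
  - move=> U QU nU; have [_ PU] := nP1 _ QU nU.
    have [g1 g2 g3 g4 g5] := hpiv _ QU PU; split=> //.
    rewrite /P1 /= !negb_or g2 /=; apply/andP; split; apply/eqP => eU.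
      have eT : t T = t U by rewrite -eU g5.
      by move: tT; rewrite eT -eU !inE eqxx.
    have eT : t T = t U by rewrite -g5 eU h5.
    have [tU|tU] := boolP (t U \in U); case/negP: nU; rewrite /P1 /=.
      have -> : U = T by rewrite -(setD1K tU) eU -eT setD1K.
      by rewrite eqxx orbT.
    have eUU : U :\ t U = U.
      by apply/setP => z; rewrite !inE; case: eqP => // ->; rewrite (negPf tU).
    by rewrite -eU eUU eqxx !orbT.
  - move=> U QU nU tU j jU jt; have [_ PU] := nP1 _ QU nU.
    case/or3P: (hface _ QU PU tU j jU jt) => [h|->|->]; rewrite ?orbT //.
    by rewrite /P1 /= h.
  - by move=> U QU /(nP1 _ QU)[_ PU]; apply: hrk.
  - move=> U QU /(nP1 _ QU)[_ PU] tU; apply: (fillable_sub GG1); exact: hfill.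
by exists G2; split=> // n b x /GG1/GG2.
Qed.

(** With a constant pivot the condition on faces is automatic: a face of [T] opposite to another
    vertex still contains the pivot. *)
Lemma pairing_const (V : fposet) (X S : sset) (q : smor X S) (v : smor (PN V) S)
    (Q P : pred {set V}) (t : V) G :
  downward V Q -> (forall T, Q T -> fchain T) ->
  plift q v G -> has_dom V X G P -> downward V P ->
  (forall T, fchain T -> P T -> Q T) ->
  (forall T, Q T -> ~~ P T ->
     [/\ Q (t |: T), ~~ P (T :\ t) & T :\ t != set0]) ->
  (forall T, Q T -> ~~ P T -> t \in T -> fillable q G T t) ->
  extends_to q v G Q.
Proof.
move=> dQ cQ hG hP dP PQ hpiv hfill.
apply: (pairing (t := fun _ => t) (rk := fun _ => 0) dQ cQ hG hP dP PQ) => //.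
  by move=> T QT PT; have [] := hpiv _ QT PT.
by move=> T QT PT tT j jT jt; rewrite !inE eq_sym jt tT orbT.
Qed.

(** * Trivial fibrations lift against monomorphisms *)

Definition dom_closed (B X : sset) (R : forall n m, B n -> B m -> Prop)
    (G : forall n, B n -> X n -> Prop) :=
  forall n m (b : B n) (b' : B m), R n m b b' -> pdom G b -> pdom G b'.

(** Maximality is meant among lifts whose domain is closed under [R]. Such closure passes to unions
    of chains, since each of its instances has a single premise. *)
Lemma plift_zorn (B X S : sset) (q : smor X S) (v : smor B S)
    (R : forall n m, B n -> B m -> Prop) G0 :
  plift q v G0 -> dom_closed R G0 ->
  exists G, [/\ plift q v G, dom_closed R G, forall n b x, G0 n b x -> G n b x &
    forall G', plift q v G' -> dom_closed R G' ->
      (forall n b x, G n b x -> G' n b x) -> forall n b x, G' n b x -> G n b x].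
Proof.
move=> hG0 cG0; pose T := {n : nat & (B n * X n)%type}.
(* [G0] is adjoined by hand, so that the union of the empty chain qualifies as well. *)
pose rel (A : set T) n (b : B n) (x : X n) := A (existT _ n (b, x)) \/ G0 n b x.
pose P : set (set T) := fun A => plift q v (rel A) /\ dom_closed R (rel A).
have [|A [PA maxA]] := @Zorn_bigcup T P.
  move=> F FP tot.
  have tot2 n (b : B n) x n' (b' : B n') x' :
      rel (\bigcup_(X in F) X)%classic n b x -> rel (\bigcup_(X in F) X)%classic n' b' x' ->
      (G0 n b x /\ G0 n' b' x') \/
      exists A, [/\ F A, rel A n b x & rel A n' b' x'].
    case=> [[A1 F1 h1]|h1] [[A2 F2 h2]|h2].
    - have [s|s] := tot _ _ F1 F2.
        by right; exists A2; split=> //; left=> //; apply: s.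
      by right; exists A1; split=> //; left=> //; apply: s.
    - by right; exists A1; split=> //; [left|right].
    - by right; exists A2; split=> //; [right|left].
    - by left.
  have mono A n (b : B n) x : F A -> rel A n b x -> rel (\bigcup_(X in F) X)%classic n b x.
    by move=> FA [h|h]; [left; exists A|right].
  split; first split.
  - move=> n b x x' h h'; have [[g g']|[A [FA g g']]] := tot2 _ _ _ _ _ _ h h'.
      exact: (pl_fun hG0 g g').
    exact: (pl_fun (FP _ FA).1 g g').
  - move=> m n f b x h; have [[g _]|[A [FA g _]]] := tot2 _ _ _ _ _ _ h h.
      by right; apply: (pl_act hG0).
    by apply: (mono A) => //; apply: (pl_act (FP _ FA).1).
  - move=> n b x h; have [[g _]|[A [FA g _]]] := tot2 _ _ _ _ _ _ h h.
      exact: (pl_over hG0).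
    exact: (pl_over (FP _ FA).1 g).
  - move=> n m b b' hR [x h]; have [[g _]|[A [FA g _]]] := tot2 _ _ _ _ _ _ h h.
      by have [|y hy] := cG0 _ _ _ _ hR; [exists x|exists y; right].
    have [|y hy] := (FP _ FA).2 _ _ _ _ hR; first by exists x.
    by exists y; apply: (mono A).
exists (rel A); case: PA => PA1 PA2; split=> //.
  by move=> n b x; right.
move=> G' hG' cG' AG' n b x hx.
pose A' : set T := fun t => G' (projT1 t) (projT2 t).1 (projT2 t).2.
have relA' : rel A' = G'.
  apply: functional_extensionality_dep => k; apply/funext => c; apply/funext => y.
  apply/propext; split; last by left.
  by case=> // h; apply: AG'; right.
have sA : (A `<=` A')%classic.
  by case=> k [c y] h; apply: AG'; left.
have [sA'|nA'] := pselect (A' `<=` A)%classic; first by left; apply: sA'.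
exfalso; apply: (maxA A'); first by split.
by split; rewrite relA'.
Qed.

Definition hits_all m n (f : dhom m n) := forall j, exists i, f i = j.

Lemma dcomp_face (m n : nat) (f : dhom m n.+1) (j : 'I_n.+2) :
  (forall i, f i != j) -> exists g : dhom m n, f = dcomp (dface j) g.
Proof.
move=> hj.
have hu i : exists k, f i = lift j k.
  by case: (unliftP j (f i)) => [k ->|e]; [exists k|case/eqP: (hj i)].
pose g i := sval (cid (hu i)); have eg i : f i = lift j (g i) := svalP (cid (hu i)).
have gm (a b : 'I_m.+1) : a <= b -> g a <= g b.
  by move=> ab; move: (dmono f ab); rewrite !eg /= leq_bump2.
by exists (DHom gm); apply: dhom_eq.
Qed.

Lemma hits_all_id n (f : dhom n n) : hits_all f -> f = did n.
Proof.
move=> hf.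
have finj : injective f.
  apply/injectiveP; rewrite /injectiveb /dinjectiveb.
  rewrite (@uniq_size_uniq _ (enum 'I_n.+1)) ?enum_uniq ?size_map // => j.
  rewrite mem_enum; apply/esym/mapP; have [i <-] := hf j.
  by exists i; rewrite ?mem_enum.
have lt (i j : 'I_n.+1) : i < j -> f i < f j.
  move=> ij; rewrite ltn_neqAle (dmono f (ltnW ij)) andbT.
  by apply/eqP => /val_inj/finj e; rewrite e ltnn in ij.
have ge k : forall i : 'I_n.+1, i = k :> nat -> k <= f i.
  elim: k => // k IH i ik.
  have kn : k < n.+1 by rewrite -ik; apply: ltnW.
  by apply: leq_ltn_trans (IH (Ordinal kn) erefl) _; apply: lt; rewrite /= ik.
apply: dhom_eq => i; apply: val_inj => /=; apply/eqP; rewrite eqn_leq ge // andbT.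
have le k : forall i : 'I_n.+1, n - i = k -> f i <= i.
  elim: k => [|k IH] j jk.
    by rewrite -ltnS; apply: leq_trans (ltn_ord _) _; rewrite ltnS -subn_eq0 jk.
  have jn : j.+1 < n.+1 by rewrite ltnS -subn_gt0 jk.
  rewrite -ltnS; apply: leq_trans (lt j (Ordinal jn) _) (IH _ _) => //=.
  by rewrite subnS jk.
exact: (le (n - i)).
Qed.

Lemma section_mono m n (d : dhom m n) (s : 'I_n.+1 -> 'I_m.+1) :
  (forall j, d (s j) = j) -> forall j k : 'I_n.+1, j <= k -> s j <= s k.
Proof.
move=> hs j k jk; rewrite leqNgt; apply/negP => lt.
have := dmono d (ltnW lt); rewrite !hs => kj.
have /val_inj ejk : j = k :> nat by apply/eqP; rewrite eqn_leq jk.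
by rewrite ejk ltnn in lt.
Qed.

(* Eilenberg-Zilber: a section of a surjection turns [act a b = act a' b] into
   a degeneracy of [b] unless [a = a']. *)
Lemma act_inj (B : sset) (D : forall n, B n -> Prop) N (b : B N) :
  (forall (f : dhom N N) j, (forall i, f i != j) -> D N (act f b)) -> ~ D N b ->
  forall n (a a' : dhom n N), hits_all a -> act a b = act a' b -> a = a'.
Proof.
move=> hface nD n a a' ha e.
have id_of (f : dhom N N) : act f b = b -> f = did N.
  move=> ef; apply: hits_all_id => j; apply/not_existsP => hj.
  apply: nD; rewrite -ef; apply: (hface f j) => i; apply/eqP => e'.
  exact: (hj i).
apply: dhom_eq => i.
(* The section is chosen to pass through [i]: evaluating [dcomp a' s = did N] at [a i] then compares
   [a' i] with [a i]. *)
have hs j : exists k, a k = j /\ (j = a i -> k = i).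
  have [->|ji] := eqVneq j (a i); first by exists i.
  by have [k ek] := ha j; exists k; split=> // e'; case/eqP: ji.
have [s0 hs0] := boolp.choice hs.
have sm := section_mono (fun j => (hs0 j).1).
pose s : dhom N n := DHom sm.
have es : dcomp a s = did N by apply: dhom_eq => j /=; rewrite (hs0 j).1.
have es' : dcomp a' s = did N.
  by apply: id_of; rewrite -act_act -e act_act es act_did.
have := congr1 (fun f : dhom N N => f (a i)) es'.
by rewrite /= (hs0 (a i)).2.
Qed.

Lemma boundaryP N n (a : Delta N n) :
  reflect (exists j, forall i, a i != j) [exists j, [forall i, a i != j]].
Proof.
by apply: (iffP existsP) => -[j /forallP h]; exists j => //; apply/forallP.
Qed.

Lemma not_boundary N n (a : Delta N n) :
  ~~ [exists j, [forall i, a i != j]] -> hits_all a.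
Proof.
move=> na j; apply/not_existsP => h; case/negP: na; apply/boundaryP.
by exists j => i; apply/eqP; apply: h.
Qed.

(** A maximal partial lift is total: a simplex of least dimension outside its domain has its
    boundary inside and is attached by the lifting property. Such a simplex need not be embedded,
    but Eilenberg-Zilber makes it injective off the boundary. *)
Lemma trivial_ext (B X S : sset) (q : smor X S) (v : smor B S) G0 :
  trivial_fibration q -> plift q v G0 ->
  exists w : smor B X, (forall n b x, G0 n b x -> w n b = x) /\
    (forall n b, q n (w n b) = v n b).
Proof.
move=> hq hG0; have [//|G [hG _ G0G maxG]] := plift_zorn (R := fun _ _ _ _ => False) hG0.
have tot n b : pdom G (n := n) b.
  elim/ltn_ind: n b => n IH b; apply: contrapT => nb.
  have [||||G' [hG' GG' dG']] := attach_lift (i := boundary_incl n)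
      (phi := ymap b) hG.
  - move=> m [a /= /boundaryP[j ha]].
    case: n => [|n] in b IH j a ha nb *; first by case/eqP: (ha ord0); rewrite !ord1.
    have [g ->] := dcomp_face ha; rewrite -act_act.
    by apply: (pdom_act hG); apply: IH.
  - move=> m d /= hd; have [h|/not_boundary h] := boolP [exists j, [forall i, d i != j]].
      by exists (exist _ d h).
    exfalso; apply: nb.
    have [s hs] := boolp.choice h.
    have sm := section_mono hs.
    have -> : b = act (DHom sm) (act d b).
      by rewrite act_act -[LHS]act_did; apply: act_congr => j /=; rewrite hs.
    exact: (pdom_act hG).
  - move=> m d d' e.
    have [h|/not_boundary h] := boolP [exists j, [forall i, d i != j]].
      left; have /boundaryP[j ha] := h.
      case: n => [|n] in b IH j d d' h e ha nb *.
        by case/eqP: (ha ord0); rewrite !ord1.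
      have [g ->] := dcomp_face ha; rewrite /= -act_act.
      by apply: (pdom_act hG); apply: IH.
    right; apply: (act_inj (D := fun n x => pdom G (n := n) x)) h e => //.
    move=> f j fj.
    case: n => [|n] in b IH j d d' nb f fj *.
      by case/eqP: (fj ord0); rewrite !ord1.
    have [g ->] := dcomp_face fj; rewrite /= -act_act.
    by apply: (pdom_act hG); apply: IH.
  - move=> u hu; apply: (hq n u (scomp v (ymap b))) => m a; exact: (pl_over hG (hu m a)).
  apply: nb; have /dG' : pdom G (n := n) b \/ exists d, b = ymap b n d.
    by right; exists (did n); rewrite /= act_did.
  by case=> x hx; exists x; apply: (maxG _ hG' _ GG').
have [w hw] := plift_smor (phi := sidm B) hG tot.
exists w; split=> [n b x /G0G hx|n b]; first exact: (pl_fun hG (hw n b) hx).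
exact: (pl_over hG (hw n b)).
Qed.

(** * Function complexes *)

Definition ordP (n : nat) : fposet :=
  @FPoset 'I_n.+1 (fun i j => i <= j) (fun i => leqnn i)
    (fun i j h => val_inj (anti_leq h)) (fun j i k => @leq_trans j i k).

Program Definition prodP (V W : fposet) : fposet :=
  @FPoset (V * W)%type (fun x y => fle x.1 y.1 && fle x.2 y.2) _ _ _.
Next Obligation. by move=> V W [a b]; rewrite /= !fle_refl. Qed.
Next Obligation.
move=> V W [a b] [c d] /= /andP[/andP[h1 h2] /andP[h3 h4]].
by congr pair; apply: fle_anti; rewrite ?h1 ?h2 ?h3 ?h4.
Qed.
Next Obligation.
move=> V W [a b] [c d] [e f] /= /andP[h1 h2] /andP[h3 h4].
by rewrite (fle_trans h1 h3) (fle_trans h2 h4).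
Qed.

Lemma prodP_mono1 m W n (x : PN (prodP (ordP m) W) n) (i j : 'I_n.+1) :
  i <= j -> (x i).1 <= (x j).1.
Proof. by move/(cmono x)/andP => -[]. Qed.

Lemma prodP_mono2 V W n (x : PN (prodP V W) n) (i j : 'I_n.+1) :
  i <= j -> fle (x i).2 (x j).2.
Proof. by move/(cmono x)/andP => -[]. Qed.

Definition pn_fst m W n (x : PN (prodP (ordP m) W) n) : Delta m n :=
  DHom (prodP_mono1 x).

Definition pn_snd V W n (x : PN (prodP V W) n) : PN W n :=
  @ChainSimplex W n (fun i => (x i).2) (prodP_mono2 x).

Program Definition pn_split m W :
  smor (PN (prodP (ordP m) W)) (sprod (Delta m) (PN W)) :=
  @SMor (PN (prodP (ordP m) W)) (sprod (Delta m) (PN W))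
    (fun n x => (pn_fst x, pn_snd x)) _.
Next Obligation.
by move=> m W k n f x; congr pair; [apply: dhom_eq|apply: chain_eq].
Qed.

Program Definition pn_pair m W :
  smor (sprod (Delta m) (PN W)) (PN (prodP (ordP m) W)) :=
  @SMor (sprod (Delta m) (PN W)) (PN (prodP (ordP m) W))
    (fun n x => @ChainSimplex (prodP (ordP m) W) n (fun i => (x.1 i, x.2 i)) _) _.
Next Obligation.
by move=> m W n [a x] i j ij; rewrite /= (dmono a ij) (cmono x ij).
Qed.
Next Obligation. by move=> m W k n f [a x]; apply: chain_eq. Qed.

Lemma pn_pairK m W n (y : sprod (Delta m) (PN W) n) :
  pn_split m W n (pn_pair m W n y) = y.
Proof. by case: y => a x; congr pair; [apply: dhom_eq|apply: chain_eq]. Qed.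

Definition ord_pn n : smor (Delta n) (PN (ordP n)) :=
  @SMor (Delta n) (PN (ordP n))
    (fun k a => @ChainSimplex (ordP n) k a (dmono a))
    (fun l k f a => @chain_eq (ordP n) l _ _ (fun i => erefl)).

Definition pn_ord n : smor (PN (ordP n)) (Delta n) :=
  @SMor (PN (ordP n)) (Delta n)
    (fun k x => @DHom k n x (cmono x))
    (fun l k f a => @dhom_eq l n _ _ (fun i => erefl)).

Program Definition uncurry_smor (A L X : sset) (f : smor A (Fun L X)) :
  smor (sprod A L) X :=
  @SMor (sprod A L) X (fun n al => @sfun _ _ (f n al.1) n (did n, al.2)) _.
Next Obligation.
move=> A L X f m n g [a l] /=; rewrite -snat /= snat /=.
by congr (@sfun (sprod _ _) _ _ _ (_, _)); apply: dhom_eq.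
Qed.

Lemma uncurry_act (A L X : sset) (f : smor A (Fun L X)) n (a : A n) k
    (d : Delta n k) (l : L k) :
  @sfun _ _ (f n a) k (d, l) = uncurry_smor f k (act d a, l).
Proof. by rewrite /= snat /=; congr (@sfun (sprod _ _) _ _ _ (_, _)); apply: dhom_eq. Qed.

Program Definition curry_smor (A L X : sset) (f : smor (sprod A L) X) :
  smor A (Fun L X) :=
  @SMor A (Fun L X) (fun n a =>
    @SMor (sprod (Delta n) L) X (fun k dl => f k (act dl.1 a, dl.2)) _) _.
Next Obligation.
move=> A L X f n a k m g [d l]; rewrite /= -snat /=.
by congr (f _ (_, _)); rewrite -act_act.
Qed.
Next Obligation.
move=> A L X f m n g a; apply: smor_eq => k [d l] /=.
by rewrite act_act.
Qed.

Program Definition fun_restr (A B X : sset) (i : smor A B) :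
  smor (Fun B X) (Fun A X) :=
  @SMor (Fun B X) (Fun A X)
    (fun n g => scomp g (sprod_map (sidm (Delta n)) i)) _.
Next Obligation. by move=> A B X i m n f g; apply: smor_eq => k [d a]. Qed.

(** * Pushout products with a boundary inclusion *)

Section PushoutProduct.
Context (K L X S : sset) (i : smor L K) (q : smor X S) (m : nat).
Context (u : smor (boundary m) (Fun K X)) (v : smor (sprod (Delta m) L) X).
Context (h : smor (sprod (Delta m) K) S).

(** A partial map on the pushout product of the boundary inclusion with [i], glued as a union of two
    graphs so that no pushout has to be formed. *)
Definition pp_rel n (y : sprod (Delta m) K n) (x : X n) : Prop :=
  (exists a : boundary m n, sval a = y.1 /\ x = uncurry_smor u n (a, y.2)) \/
  (exists l, y.2 = i n l /\ x = v n (y.1, l)).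

Lemma pp_plift :
  cofibration i ->
  (forall n a o, q n (uncurry_smor u n (a, o)) = h n (sval a, o)) ->
  (forall n a l, q n (v n (a, l)) = h n (a, i n l)) ->
  (forall n a l, uncurry_smor u n (a, i n l) = v n (sval a, l)) ->
  plift q h pp_rel.
Proof.
move=> ii hu hv huv; split.
- move=> n [a o] x x' /= [[a1 [e1 ->]]|[l [e1 ->]]] [[a2 [e2 ->]]|[l' [e2 ->]]].
  + congr (uncurry_smor u _ (_, _)).
    by case: a1 a2 e1 e2 => [a1 h1] [a2 h2] /= e1 e2; apply: eq_exist; rewrite e1.
  + by rewrite e2 huv e1.
  + by rewrite e1 huv e2.
  + by congr (v _ (_, _)); apply: ii; rewrite -e1.
- move=> k n f [a o] x [[a1 [e1 ->]]|[l [e1 ->]]].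
  + left; exists (act f a1); split; last by rewrite -snat.
    by rewrite /= -[a]e1.
  + right; exists (act f l); split; last by rewrite -snat.
    by rewrite /= snat -e1.
- move=> n [a o] x [[a1 [e1 ->]]|[l [e1 ->]]].
  + by rewrite hu e1.
  + by rewrite hv -e1.
Qed.

Lemma pp_dom n (y : sprod (Delta m) K n) :
  pdom pp_rel y <-> [exists j, [forall k, y.1 k != j]] \/ exists l, y.2 = i n l.
Proof.
split.
- by case=> x [[a [<- _]]|[l [e _]]]; [left; exact: (svalP a)|right; exists l].
- case=> [hy|[l e]].
  + by exists (uncurry_smor u n (exist _ y.1 hy, y.2)); left; exists (exist _ y.1 hy).
  + by exists (v n (y.1, l)); right; exists l.
Qed.

Definition pp_solution (w : smor (sprod (Delta m) K) X) : Prop :=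
  [/\ forall n a o, w n (sval a, o) = uncurry_smor u n (a, o),
      forall n a l, w n (a, i n l) = v n (a, l) &
      forall n y, q n (w n y) = h n y].

(** [phi] and [psi] present the product as a retract of a poset nerve, where the matching takes
    place. *)
Lemma pp_from_poset (V : fposet) (phi : smor (PN V) (sprod (Delta m) K))
    (psi : smor (sprod (Delta m) K) (PN V)) G :
  (forall n y, phi n (psi n y) = y) ->
  plift q (scomp h phi) G -> has_dom V X G (@fchain V) ->
  (forall n b x, pp_rel (phi n b) x -> G n b x) ->
  exists w, pp_solution w.
Proof.
move=> K1 hG dG hsub.
have [|w hw] := plift_smor (phi := psi) hG.
  by move=> n a; apply/dG; apply: fchain_supp.
exists w; split.
- move=> n a o; apply: (pl_fun hG (hw _ _)); apply: hsub; rewrite K1.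
  by left; exists a.
- move=> n a l; apply: (pl_fun hG (hw _ _)); apply: hsub; rewrite K1.
  by right; exists l.
- by move=> n y; rewrite (pl_over hG (hw n y)) /= K1.
Qed.
End PushoutProduct.

Lemma arg_maxord n (p : pred 'I_n.+1) : (exists a, p a) ->
  exists a, p a && [forall b, p b ==> (b <= a)].
Proof.
case=> a0 p0; case: (arg_maxnP (fun a : 'I_n.+1 => a : nat) p0) => a pa ha.
by exists a; rewrite pa; apply/forallP => b; apply/implyP => /ha.
Qed.

Definition maxord n (p : pred 'I_n.+1) : 'I_n.+1 :=
  odflt ord0 [pick a | p a && [forall b, p b ==> (b <= a)]].

Lemma maxordP n (p : pred 'I_n.+1) : (exists a, p a) ->
  p (maxord p) /\ forall b, p b -> b <= maxord p.
Proof.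
move/arg_maxord => [a ha]; rewrite /maxord; case: pickP => [b|/(_ a)].
  by case/andP=> pb /forallP hb; split=> // c; apply/implyP/hb.
by rewrite ha.
Qed.

Lemma eq_maxord n (p p' : pred 'I_n.+1) : p =1 p' -> maxord p = maxord p'.
Proof. by move=> e; rewrite /maxord; congr odflt; apply: eq_pick => a; rewrite e;
  congr andb; apply: eq_forallb => b; rewrite e. Qed.

(* The pivot of a chain [T] is [(a, k)] with [a] maximal such that [(a, k - 1)] is
   in [T]. *)
Section HornProduct.
Context (m N : nat) (k : 'I_N.+1) (k0 : 0 < k) (kN : k < N).

Let V := prodP (ordP m) (ordP N).

Let P : pred {set V} := fun T => [exists i, [forall z in T, z.1 != i]] ||
  [exists j, (j != k) && [forall z in T, z.2 != j]].

Lemma horn_prodP (T : {set V}) :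
  reflect ((forall i, exists2 z, z \in T & z.1 = i) /\
           (forall j, j != k -> exists2 z, z \in T & z.2 = j)) (~~ P T).
Proof.
apply: (iffP norP) => -[h1 h2]; split.
- move=> i; have := existsPn h1 i; rewrite negb_forall_in => /exists_inP[z zT].
  by rewrite negbK => /eqP; exists z.
- move=> j jk; have := existsPn h2 j; rewrite jk negb_forall_in => /exists_inP[z zT].
  by rewrite negbK => /eqP; exists z.
- apply/existsPn => i; rewrite negb_forall_in; apply/exists_inP.
  by have [z zT <-] := (h1 : forall i, _) i; exists z; rewrite ?negbK.
- apply/existsPn => j; rewrite negb_and negb_forall_in negbK.
  have [//|jk] := eqVneq j k; apply/exists_inP.
  by have [z zT <-] := h2 j jk; exists z; rewrite ?negbK.
Qed.

Let km : 'I_N.+1 := Ordinal (leq_ltn_trans (leq_pred k) (ltn_ord k)).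
Let tm (T : {set V}) : 'I_m.+1 := maxord (fun a => (a, km) \in T).
Let t (T : {set V}) : V := (tm T, k).

Lemma km_lt : (km : nat) < k. Proof. by rewrite /= prednK. Qed.

Lemma km_neq : km != k. Proof. by rewrite -val_eqE neq_ltn km_lt. Qed.

Lemma tmP (T : {set V}) : ~~ P T ->
  (tm T, km) \in T /\ forall b, (b, km) \in T -> b <= tm T.
Proof.
move/horn_prodP => -[_ /(_ km km_neq) [[a j] zT /= e]]; subst j.
by apply: (maxordP (p := fun a => (a, km) \in T)); exists a.
Qed.

(** This makes the pivot comparable with every member of [T]: nothing at level [k - 1] lies beyond
    [(tm T, km)], so a member above that element and off its level has level at least [k]. *)
Lemma horn_pivot_below (T : {set V}) z : fchain T -> ~~ P T -> z \in T ->
  fle z (tm T, km) \/ fle (t T) z.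
Proof.
move=> /fchainP[_ cT] PT zT; have [h1 h2] := tmP PT.
have /orP[h|/andP[/= g1 g2]] := cT _ _ zT h1; [by left|].
have [e|ne] := eqVneq z.2 km.
  left; case: z zT e {g1 g2} => a b zT /= e; subst b.
  by rewrite /= (h2 _ zT) leqnn.
right; rewrite /= g1 /=; rewrite leq_eqVlt in g2; case/orP: g2 => [/eqP e|].
  by case/eqP: ne; apply: val_inj.
by rewrite /= prednK.
Qed.

(** The pivot lies strictly between [(tm T, km)] and a member of level [k + 1], so every horn is
    inner. Among the deletions that leave a missing chain, only that of [(tm T, km)] changes the
    pivot, and it lowers [tm], which is the rank. *)
Lemma horn_product_ext (X S : sset) (q : smor X S) (v : smor (PN V) S) G :
  inner_fibration q -> plift q v G -> has_dom V X G P ->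
  extends_to q v G (@fchain V).
Proof.
move=> hq hG hP.
have tU T : tm (t T |: T) = tm T.
  apply: eq_maxord => a; rewrite in_setU1 xpair_eqE (negPf km_neq) andbF.
  by [].
have tD T : tm (T :\ t T) = tm T.
  apply: eq_maxord => a; rewrite in_setD1 xpair_eqE (negPf km_neq) andbF.
  by [].
have tle T : fle ((tm T, km) : V) (t T) by rewrite /= leqnn (ltnW km_lt).
apply: (pairing (t := t) (rk := fun T => tm T) _ _ hG hP) => //.
- by move=> T T' s n0; apply: fchain_sub.
- move=> T T' /subsetP s n0; apply: contraLR => /horn_prodP[h1 h2].
  apply/horn_prodP; split=> [i|j /h2[z zT e]].
    by have [z zT e] := h1 i; exists z => //; apply: s.
  by exists z => //; apply: s.
- move=> T cT PT; have [h1 h2] := tmP PT.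
  have h1' : (tm T, km) \in T :\ t T.
    by rewrite !inE h1 andbT xpair_eqE (negPf km_neq) andbF.
  split.
  + apply/fchainP; split; first by apply/set0Pn; exists (t T); rewrite setU11.
    have hz z : z \in T -> fle z (t T) || fle (t T) z.
      move=> zT; have [h|->] := horn_pivot_below cT PT zT; last by rewrite orbT.
      by rewrite (fle_trans h (tle T)).
    move=> a b /setU1P[->|aT] /setU1P[->|bT]; first by rewrite fle_refl.
    * by rewrite orbC hz.
    * by rewrite hz.
    * by case/fchainP: cT => _ -> .
  + have /horn_prodP[g1 g2] := PT.
    apply/horn_prodP; split=> [i|j jk].
      have [z zT e] := g1 i; have [ez|nz] := eqVneq z (t T).
        by exists (tm T, km) => //; rewrite -e ez.
      by exists z => //; rewrite !inE nz.
    have [z zT e] := g2 j jk; exists z => //; rewrite !inE zT andbT.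
    by apply: contra jk => /eqP ez; rewrite -e ez.
  + by apply/set0Pn; exists (tm T, km).
  + by rewrite /t tU.
  + by rewrite /t tD.
- move=> T cT PT tT j jT jt; have [h1 h2] := tmP PT.
  have [//|PTj] := boolP (P (T :\ j)); rewrite /=.
  have [g1 g2] := tmP PTj.
  have le : tm (T :\ j) <= tm T by apply: h2; move: g1; rewrite in_setD1 => /andP[].
  have [e|ne] := eqVneq j (tm T, km).
    apply/orP; right; rewrite ltn_neqAle le andbT; apply/eqP => /val_inj e'.
    by move: g1; rewrite e' e !inE eqxx.
  have etm : tm (T :\ j) = tm T.
    apply: val_inj; apply/eqP; rewrite eqn_leq le /=; apply: g2.
    by rewrite in_setD1 h1 eq_sym ne.
  have -> : t (T :\ j) = t T by rewrite /t etm.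
  by rewrite in_setD1 eq_sym jt tT.
- by move=> T cT PT; rewrite /t tU.
- move=> T cT PT tT; left; split=> //; have [h1 h2] := tmP PT.
  have /horn_prodP[g1 g2] := PT.
  have [|z zT ez] := g2 (Ordinal (kN : k.+1 < N.+1)).
    by rewrite -val_eqE /= eqn_leq ltnn.
  exists (tm T, km), z; split=> //.
  + by rewrite xpair_eqE (negPf km_neq) andbF.
  + by apply/eqP => e; move: ez; rewrite e => /(congr1 val) /=; apply/eqP;
      rewrite neq_ltn ltnSn.
  + rewrite tle /=; have [/andP[_]|//] := horn_pivot_below cT PT zT.
    rewrite ez /= => le; have := leq_ltn_trans le km_lt.
    by rewrite ltnNge leqnSn.
Qed.
End HornProduct.

Lemma horn_pp (m N : nat) (k : 'I_N.+1) (X S : sset) (q : smor X S)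
    (u : smor (boundary m) (Fun (Delta N) X))
    (v : smor (sprod (Delta m) (horn k)) X)
    (h : smor (sprod (Delta m) (Delta N)) S) :
  0 < k -> k < N -> inner_fibration q ->
  (forall n a o, q n (uncurry_smor u n (a, o)) = h n (sval a, o)) ->
  (forall n a l, q n (v n (a, l)) = h n (a, horn_incl k n l)) ->
  (forall n a l, uncurry_smor u n (a, horn_incl k n l) = v n (sval a, l)) ->
  exists w, pp_solution (horn_incl k) q u v h w.
Proof.
move=> k0 kN hq hu hv huv.
pose phi : smor (PN (prodP (ordP m) (ordP N))) (sprod (Delta m) (Delta N)) :=
  scomp (sprod_map (sidm (Delta m)) (pn_ord N)) (pn_split m (ordP N)).
pose psi : smor (sprod (Delta m) (Delta N)) (PN (prodP (ordP m) (ordP N))) :=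
  scomp (pn_pair m (ordP N)) (sprod_map (sidm (Delta m)) (ord_pn N)).
have ci : cofibration (horn_incl k).
  by move=> n [a ha] [b hb] /= e; apply: eq_exist.
have hpl := plift_pull phi (pp_plift ci hu hv huv).
have [|G [hG sG dG]] := horn_product_ext k0 kN hq hpl.
  move=> n b; rewrite -[pdom _ _]/(pdom (pp_rel (horn_incl k) u v) (phi n b)).
  rewrite pp_dom; split.
  - case=> [/boundaryP[j hj]|[l el]]; apply/orP; [left|right].
      apply/existsP; exists j; apply/forall_inP => z /(suppP b)[i ->]; exact: hj.
    have := svalP l; rewrite -[sval l]/(horn_incl k n l) -el.
    case/hornP=> j jk hj; apply/existsP; exists j; rewrite jk /=.
    by apply/forall_inP => z /(suppP b)[i ->]; apply: hj.
  - case/orP=> /existsP[j hj]; [left|right; case/andP: hj => jk hj].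
      move/forall_inP: hj => hj; apply/existsP; exists j; apply/forallP => i.
      by apply: hj; apply: (supp_in b).
    unshelve eexists (exist _ (phi n b).2 _); last by [].
    apply/hornP; exists j => // i; apply: (forall_inP hj); exact: (supp_in b).
apply: (pp_from_poset (phi := phi) (psi := psi) _ hG dG sG).
move=> n [a o] /=; congr pair; exact: dhom_eq.
Qed.

Lemma pp_trivial (K L X : sset) (i : smor L K) (m : nat) u (v : smor (Delta m) (Fun L X)) w :
  pp_solution i (to_pt X) u (uncurry_smor v) (to_pt _) w ->
  exists w' : smor (Delta m) (Fun K X),
    (forall n a, w' n (boundary_incl m n a) = u n a) /\
    (forall n b, fun_restr X i n (w' n b) = v n b).
Proof.
move=> [hu hv _]; exists (ymap (X := Fun K X) (n := m) w); split=> n a.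
  by apply: smor_eq => k [d o]; rewrite /= (hu _ (act d a)) uncurry_act.
by apply: smor_eq => k [d o]; rewrite /= hv uncurry_act.
Qed.

(** By transposition this is extension along the pushout product of the boundary with the inner
    horn. *)
Lemma fun_horn_trivial (Z : sset) N (k : 'I_N.+1) :
  quasicategory Z -> 0 < k -> k < N ->
  trivial_fibration (fun_restr Z (horn_incl k)).
Proof.
move=> hZ k0 kN m u v huv.
have [|||w hw] := @horn_pp m N k Z pt (to_pt Z) u (uncurry_smor v) (to_pt _) k0 kN
  (quasicategory_inner hZ) => //.
  move=> n a l; have := huv n a => /(congr1 (fun f : smor (sprod (Delta n) (horn k)) Z =>
    f n (did n, l))) /=.
  by move=> ->.
exact: pp_trivial hw.
Qed.

Lemma trivial_lift (A X S : sset) (q : smor X S) (f : smor A S) :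
  trivial_fibration q -> exists w : smor A X, forall n a, q n (w n a) = f n a.
Proof.
move=> hq; have [|w [_ hw]] := @trivial_ext A X S q f (fun _ _ _ => False) hq.
  by split.
by exists w.
Qed.

(** After an exchange of factors, a horn in [Fun X Z] is a map from [X] to the function complex of
    the horn, and it lifts along the restriction from that of the simplex. *)
Lemma Fun_quasicategory (X Z : sset) : quasicategory Z -> quasicategory (Fun X Z).
Proof.
move=> hZ N k k0 kN u.
pose c0 : smor (sprod X (horn k)) Z := scomp (uncurry_smor u)
  (@SMor (sprod X (horn k)) (sprod (horn k) X) (fun n xy => (xy.2, xy.1))
    (fun _ _ _ _ => erefl)).
have [c hc] := trivial_lift (curry_smor c0) (fun_horn_trivial hZ k0 kN).
pose w0 : smor (sprod (Delta N) X) Z := scomp (uncurry_smor c)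
  (@SMor (sprod (Delta N) X) (sprod X (Delta N)) (fun n xy => (xy.2, xy.1))
    (fun _ _ _ _ => erefl)).
exists (curry_smor w0) => n a; apply: smor_eq => l [d x].
have := hc l x => /(congr1 (fun f : smor (sprod (Delta l) (horn k)) Z =>
  f l (did l, act d a))) /=.
rewrite !act_did => e; apply: (etrans _ (esym (uncurry_act u a d x))).
rewrite /= -e.
by congr (@sfun (sprod _ _) _ _ _ (_, _)); apply: dhom_eq.
Qed.

(** * Faces, edges and inner fibrations *)

(** Indices are natural numbers so that the simplicial identities become arithmetic; [inord] sends
    an index out of range to 0. *)
Definition face (X : sset) N (i : nat) (x : X N.+1) : X N :=
  act (dface (inord i)) x.

Lemma snat_face (X Y : sset) (f : smor X Y) N i (x : X N.+1) :
  f N (face i x) = face i (f N.+1 x).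
Proof. exact: snat. Qed.

Lemma face_face N i j (k : 'I_N.+1) : i < j -> j <= N.+2 ->
  lift (inord j : 'I_N.+3) (lift (inord i : 'I_N.+2) k) =
  lift (inord i : 'I_N.+3) (lift (inord j.-1 : 'I_N.+2) k).
Proof.
by move=> ij jN; apply: val_inj; rewrite /= !inordK /bump; lia.
Qed.

Lemma face_swap (X : sset) N i j (x : X N.+2) : i < j -> j <= N.+2 ->
  face i (face j x) = face j.-1 (face i x).
Proof.
by move=> ij jN; rewrite /face !act_act; apply: act_congr => k; apply: face_face.
Qed.

Lemma src_face (X : sset) (e : X 1) : src e = face 1 e.
Proof.
apply: act_congr => i; apply: val_inj.
by rewrite /= /bump inordK // ord1.
Qed.

Lemma tgt_face (X : sset) (e : X 1) : tgt e = face 0 e.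
Proof.
apply: act_congr => i; apply: val_inj.
by rewrite /= /bump inordK // ord1.
Qed.

Lemma face_degen (X : sset) N i (x : X 0) : face i (degen N.+1 x) = degen N x.
Proof. exact: act_degen. Qed.

Lemma src_degen (X : sset) (x : X 0) : src (degen 1 x) = x.
Proof. by rewrite src_face face_degen degen0. Qed.

Lemma tgt_degen (X : sset) (x : X 0) : tgt (degen 1 x) = x.
Proof. by rewrite tgt_face face_degen degen0. Qed.

Definition faces_rel (X : sset) N (J : pred nat) (y : nat -> X N)
    n (a : Delta N.+1 n) (x : X n) : Prop :=
  exists j, [/\ J j, j <= N.+1 & exists b : dhom n N,
    a = dcomp (dface (inord j)) b /\ x = act b (y j)].

(** Compatibility is tested on all simplices of the overlap instead of by simplicial identities, so
    that [N = 0] is covered: the two end points of an edge do not meet. *)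
Definition faces_compat (X : sset) N (J : pred nat) (y : nat -> X N) : Prop :=
  forall i j, J i -> J j -> i < j -> j <= N.+1 ->
  forall n (a b : dhom n N),
    dcomp (dface (inord i : 'I_N.+2)) a = dcomp (dface (inord j)) b ->
    act a (y i) = act b (y j).

Lemma faces_compatS (X : sset) N (J : pred nat) (y : nat -> X N.+1) :
  (forall i j, J i -> J j -> i < j -> j <= N.+2 -> face i (y j) = face j.-1 (y i)) ->
  faces_compat J y.
Proof.
move=> h i j Ji Jj ij jN n a b eab.
have hv k : lift (inord i : 'I_N.+3) (a k) = lift (inord j) (b k).
  by have := congr1 (fun f : dhom n N.+2 => f k) eab.
have [k|c ec] := @dcomp_face n N b (inord i).
  apply/eqP => e; have /(congr1 val) := hv k.
  by rewrite e /= /bump !inordK; lia.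
have ea : a = dcomp (dface (inord j.-1)) c.
  apply: dhom_eq => k; apply: (@lift_inj _ (inord i)); rewrite hv ec /=.
  exact: face_face.
by rewrite ec ea -!act_act; congr act; apply/esym; apply: h.
Qed.

Lemma faces_plift (X S : sset) (q : smor X S) N (J : pred nat) (y : nat -> X N)
    (s : S N.+1) :
  faces_compat J y -> (forall j, J j -> j <= N.+1 -> q N (y j) = face j s) ->
  plift q (ymap s) (faces_rel J y).
Proof.
move=> hc hq; split.
- move=> n a x x' [j [Jj jN [b [eb ->]]]] [j' [Jj' jN' [b' [eb' ->]]]].
  have [lt|lt|e] := ltngtP j j'.
  + by apply: (hc _ _ Jj Jj' lt jN'); rewrite -eb.
  + by apply/esym; apply: (hc _ _ Jj' Jj lt jN); rewrite -eb.
  + subst j'; congr act; apply: dhom_eq => k; apply: (@lift_inj _ (inord j)).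
    have := congr1 (fun f : dhom n N.+1 => f k) eb; rewrite eb' /=; exact: esym.
- move=> m n f a x [j [Jj jN [b [-> ->]]]]; exists j; split=> //.
  by exists (dcomp b f); rewrite act_act; split=> //; apply: dhom_eq.
- move=> n a x [j [Jj jN [b [-> ->]]]].
  by rewrite snat hq // /face act_act.
Qed.

Lemma faces_dom (X : sset) N (J : pred nat) (y : nat -> X N) n
    (a : Delta N.+1 n) j :
  J j -> j <= N.+1 -> (forall i, a i != inord j) -> pdom (faces_rel J y) a.
Proof.
move=> Jj jN /dcomp_face[g ->]; exists (act g (y j)), j; split=> //.
by exists g.
Qed.

Lemma faces_face (X : sset) N (J : pred nat) (y : nat -> X N) j :
  J j -> j <= N.+1 -> faces_rel J y (dface (inord j) : Delta N.+1 N) (y j).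
Proof.
move=> Jj jN; exists j; split=> //; exists (did N).
by rewrite act_did; split=> //; apply: dhom_eq.
Qed.

(** The filling property is left abstract so as to serve both inner horns and left horns with a
    cocartesian first edge; the relation between [u] and [y] lets the latter read off that edge. *)
Lemma faces_horn_gen (X S : sset) (q : smor X S) N (k : 'I_N.+2)
    (y : nat -> X N) (s : S N.+1) :
  (forall u : smor (horn k) X,
     (forall n a, q n (u n a) = act (horn_incl k n a) s) ->
     (forall n (a : horn k n), faces_rel (fun j : nat => j != k) y (sval a) (u n a)) ->
     exists w : smor (Delta N.+1) X,
      (forall n a, w n (horn_incl k n a) = u n a) /\
      (forall n b, q n (w n b) = act b s)) ->
  faces_compat (fun j : nat => j != k) y ->
  (forall j : nat, j != k -> j <= N.+1 -> q N (y j) = face j s) ->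
  exists z : X N.+1, (forall j : nat, j != k -> j <= N.+1 -> face j z = y j) /\ q N.+1 z = s.
Proof.
move=> hfill hc hq; have hG := faces_plift hc hq.
have [n [a /= /hornP[j jk aj]]|u hu] := plift_smor (phi := horn_incl k) hG.
  apply: (@faces_dom _ _ _ _ _ _ j) => //; first by rewrite -ltnS.
  by move=> i; rewrite inord_val.
have [|w [hw hqw]] := hfill u _ hu.
  by move=> n a; apply: (pl_over hG (hu n a)).
exists (w N.+1 (did N.+1)); split; last by rewrite hqw act_did.
move=> j jk jN; rewrite /face -smor_Delta.
have hj : [exists j', (j' != k) && [forall i, @dface N (inord j) i != j']].
  apply/hornP; exists (inord j); last by move=> i; rewrite eq_sym neq_lift.
  by rewrite -val_eqE /= inordK.
rewrite (hw N (exist _ (dface (inord j)) hj)).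
by apply: (pl_fun hG (hu _ _)); apply: faces_face.
Qed.

Lemma horn_fill (X S : sset) (q : smor X S) N (k : 'I_N.+3)
    (y : nat -> X N.+1) (s : S N.+2) :
  inner_fibration q -> 0 < k -> k < N.+2 ->
  (forall i j : nat, i != k -> j != k -> i < j -> j <= N.+2 ->
     face i (y j) = face j.-1 (y i)) ->
  (forall j : nat, j != k -> j <= N.+2 -> q N.+1 (y j) = face j s) ->
  exists z : X N.+2, (forall j : nat, j != k -> j <= N.+2 -> face j z = y j) /\ q N.+2 z = s.
Proof.
move=> hq k0 kN hc; apply: faces_horn_gen; last exact: faces_compatS.
by move=> u huv _; apply: (hq N.+2 k k0 kN u (ymap s)).
Qed.

Lemma boundary_fill (X S : sset) (q : smor X S) N (y : nat -> X N) (s : S N.+1) :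
  trivial_fibration q -> faces_compat xpredT y ->
  (forall j, j <= N.+1 -> q N (y j) = face j s) ->
  exists z : X N.+1, (forall j, j <= N.+1 -> face j z = y j) /\ q N.+1 z = s.
Proof.
move=> hq hc hqy; have hG := faces_plift hc (fun j _ => hqy j).
have [w [hw hqw]] := trivial_ext hq hG.
exists (w N.+1 (did N.+1)); split; last by rewrite hqw /= act_did.
move=> j jN; rewrite /face -smor_Delta; apply: hw; exact: faces_face.
Qed.

(** * Triangles [tri f g h], in which [h] composes [f] followed by [g], and equivalences *)

Definition tri (X : sset) (f g h : X 1) : Prop :=
  exists s : X 2, [/\ face 2 s = f, face 0 s = g & face 1 s = h].

Lemma tri_smor (X Y : sset) (F : smor X Y) f g h :
  tri f g h -> tri (F 1 f) (F 1 g) (F 1 h).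
Proof. by case=> s [<- <- <-]; exists (F 2 s); rewrite -!snat_face. Qed.

Lemma equiv_edgeE (X : sset) (e : X 1) : is_equiv_edge e <->
  exists e', tri e e' (degen 1 (src e)) /\ tri e' e (degen 1 (tgt e)).
Proof.
split; first by case=> e' [s [t [h1 h2]]]; exists e'; split; [exists s|exists t].
by case=> e' [[s h1] [t h2]]; exists e', s, t.
Qed.

Lemma equiv_edge_smor (X Y : sset) (F : smor X Y) e :
  is_equiv_edge e -> is_equiv_edge (F 1 e).
Proof.
move=> /equiv_edgeE[e' [h1 h2]]; apply/equiv_edgeE; exists (F 1 e').
by split; [have := tri_smor F h1|have := tri_smor F h2];
  rewrite smor_degen ?smor_src ?smor_tgt.
Qed.

Lemma tri_src (X : sset) (f g h : X 1) : tri f g h -> src f = src h.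
Proof. by case=> s [<- _ <-]; rewrite !src_face (@face_swap _ _ 1 2). Qed.
Lemma tri_tgt (X : sset) (f g h : X 1) : tri f g h -> tgt g = tgt h.
Proof. by case=> s [_ <- <-]; rewrite !tgt_face (@face_swap _ _ 0 1). Qed.
Lemma tri_mid (X : sset) (f g h : X 1) : tri f g h -> tgt f = src g.
Proof. by case=> s [<- <- _]; rewrite tgt_face src_face (@face_swap _ _ 0 2). Qed.

Lemma dstep_mono n k (i j : 'I_n.+1) : i <= j ->
  (if i < k then ord0 else ord_max : 'I_2) <= (if j < k then ord0 else ord_max : 'I_2).
Proof. by move=> ij; case: (ltnP i k) => // ki; case: ltnP => // /(leq_ltn_trans ij);
  rewrite ltnNge ki. Qed.

(** Pulls an edge back to the degenerate simplex whose first [k] vertices are its source; [k = 0]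
    and [k > n] give the constant simplices. *)
Definition dstep n k : dhom n 1 := DHom (@dstep_mono n k).

Lemma face_dstep (X : sset) n k j (e : X 1) : j <= n.+1 ->
  face j (act (dstep n.+1 k) e) = act (dstep n (if j < k then k.-1 else k)) e.
Proof.
move=> jn; rewrite /face act_act; apply: act_congr => i /=.
rewrite /bump inordK //; congr (if _ then _ else _).
by case: (ltnP j k) => jk; apply/idP/idP; lia.
Qed.

Lemma act_dstep1 (X : sset) (e : X 1) : act (dstep 1 1) e = e.
Proof.
rewrite -[RHS]act_did; apply: act_congr => i; apply: val_inj => /=.
by case: ltnP => //=; case: i => -[|[|]].
Qed.

Lemma act_dstep0 (X : sset) n (e : X 1) : act (dstep n 0) e = degen n (tgt e).
Proof. by rewrite /degen /tgt act_act; apply: act_congr. Qed.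

Lemma act_dstepn (X : sset) n k (e : X 1) : n < k ->
  act (dstep n k) e = degen n (src e).
Proof.
move=> nk; rewrite /degen /src act_act; apply: act_congr => i /=.
by rewrite (leq_trans (ltn_ord i)).
Qed.

Lemma tri_idl (X : sset) (f : X 1) : tri (degen 1 (src f)) f f.
Proof.
exists (act (dstep 2 2) f); rewrite !face_dstep //=.
by rewrite act_dstep1 act_dstepn.
Qed.

Lemma fill_triangle (X S : sset) (q : smor X S) (f g : X 1) (s : S 2) :
  inner_fibration q -> tgt f = src g -> face 2 s = q 1 f -> face 0 s = q 1 g ->
  exists z : X 2, [/\ face 2 z = f, face 0 z = g & q 2 z = s].
Proof.
move=> hq fg h2 h0; pose y j := if j == 0 then g else f.
have [||||z [hz hqz]] := @horn_fill X S q 0 (inord 1) y s hq.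
- by rewrite inordK.
- by rewrite inordK.
- rewrite inordK // => -[|[|[|i]]] [|[|[|j]]] // _ _ _ _.
  by rewrite /y /= -tgt_face -src_face.
- by rewrite inordK // => -[|[|[|j]]] // _ _; rewrite /y.
by exists z; rewrite !hz ?inordK.
Qed.

Section Triangles.
Context (X : sset) (hX : quasicategory X).

Lemma tri_comp (f g : X 1) : tgt f = src g -> exists h, tri f g h.
Proof.
move=> fg; have [z [h1 h2 _]] := fill_triangle (s := tt : pt 2) (quasicategory_inner hX) fg
  erefl erefl.
by exists (face 1 z), z.
Qed.

Lemma fill_tetrahedron (k : 'I_4) (y : nat -> X 2) : 0 < k -> k < 3 ->
  (forall i j : nat, i != k -> j != k -> i < j -> j <= 3 -> face i (y j) = face j.-1 (y i)) ->
  exists z : X 3, forall j : nat, j != k -> j <= 3 -> face j z = y j.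
Proof.
move=> k0 k3 hy; have [|z [hz _]] := @horn_fill X pt (to_pt X) 1 k y tt
  (quasicategory_inner hX) k0 k3 hy; first by [].
by exists z.
Qed.

(** In the 3-simplex with spine [f], [g], [h] the faces 3, 0 and 1 are given, and the inner horn at
    2 supplies the remaining one; [tri_assoc2] uses the horn at 1. *)
Lemma tri_assoc1 (f g h a b c : X 1) :
  tri f g a -> tri g h b -> tri a h c -> tri f b c.
Proof.
move=> [s3 [f1 g1 a1]] [s0 [g2 h2 b2]] [s1 [a3 h3 c3]].
pose y j := if j == 0 then s0 else if j == 1 then s1 else s3.
have [|||z hz] := @fill_tetrahedron (inord 2) y; rewrite ?inordK //.
  move=> [|[|[|[|i]]]] [|[|[|[|j]]]] // _ _ _ _; rewrite /y /=; congruence.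
exists (face 2 z); split.
- by rewrite -(@face_swap _ _ 2 3) // hz ?inordK.
- by rewrite (@face_swap _ _ 0 2) // hz ?inordK.
- by rewrite (@face_swap _ _ 1 2) // hz ?inordK.
Qed.

Lemma tri_assoc2 (f g h a b c : X 1) :
  tri f g a -> tri g h b -> tri f b c -> tri a h c.
Proof.
move=> [s3 [f1 g1 a1]] [s0 [g2 h2 b2]] [s2 [f3 b3 c3]].
pose y j := if j == 0 then s0 else if j == 2 then s2 else s3.
have [|||z hz] := @fill_tetrahedron (inord 1) y; rewrite ?inordK //.
  move=> [|[|[|[|i]]]] [|[|[|[|j]]]] // _ _ _ _; rewrite /y /=; congruence.
exists (face 1 z); split.
- by rewrite -(@face_swap _ _ 1 3) // hz ?inordK.
- by rewrite (@face_swap _ _ 0 1) // hz ?inordK.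
- by rewrite -(@face_swap _ _ 1 2) // hz ?inordK.
Qed.

(** The inverse is a composite of the inverses in reverse order; both unit triangles come from
    associativity. *)
Lemma equiv_comp (e g : X 1) : is_equiv_edge e -> is_equiv_edge g ->
  tgt e = src g -> exists h, [/\ src h = src e, tgt h = tgt g & is_equiv_edge h].
Proof.
move=> /equiv_edgeE[e' [ee' e'e]] /equiv_edgeE[g' [gg' g'g]] eg.
have [h eh] := tri_comp eg.
have s_h : src h = src e by rewrite (tri_src eh).
have t_h : tgt h = tgt g by rewrite (tri_tgt eh).
have [k hk] : exists k, tri g' e' k.
  apply: tri_comp; rewrite (tri_tgt gg') tgt_degen -eg.
  by rewrite -(tri_mid ee').
have gke' : tri g k e'.
  apply: (tri_assoc1 gg' hk).
  by have := tri_idl e'; rewrite -(tri_mid ee') eg.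
have hkid : tri h k (degen 1 (src e)) := tri_assoc2 eh gke' ee'.
have e'hg : tri e' h g.
  apply: (tri_assoc1 e'e eh).
  by have := tri_idl g; rewrite -eg.
have khid : tri k h (degen 1 (tgt g)) := tri_assoc2 hk e'hg g'g.
by exists h; split=> //; apply/equiv_edgeE; exists k; rewrite s_h t_h.
Qed.
End Triangles.

Lemma equiv_sym (X : sset) (e : X 1) : is_equiv_edge e ->
  exists e', [/\ src e' = tgt e, tgt e' = src e & is_equiv_edge e'].
Proof.
move=> /equiv_edgeE[e' [h1 h2]]; exists e'.
have s' : src e' = tgt e by rewrite (tri_mid h1).
have t' : tgt e' = src e by rewrite (tri_tgt h1) tgt_degen.
by split=> //; apply/equiv_edgeE; exists e; rewrite s' t'.
Qed.

Lemma equiv_degen (X : sset) (x : X 0) : is_equiv_edge (degen 1 x).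
Proof.
apply/equiv_edgeE; exists (degen 1 x); rewrite src_degen tgt_degen.
by split; have := tri_idl (degen 1 x); rewrite src_degen.
Qed.

Lemma naturally_equiv_refl (X Y : sset) (f : smor X Y) : naturally_equiv f f.
Proof.
exists (degen 1 (X := Fun X Y) (fun_vertex f)); split.
- exact: src_degen.
- exact: tgt_degen.
- exact: equiv_degen.
Qed.

Lemma naturally_equiv_sym (X Y : sset) (f g : smor X Y) :
  naturally_equiv f g -> naturally_equiv g f.
Proof. by case=> e [s t /equiv_sym[e1 [s1 t1 h]]]; exists e1; rewrite s1 t1. Qed.

Lemma naturally_equiv_trans (X Y : sset) (f g h : smor X Y) : quasicategory Y ->
  naturally_equiv f g -> naturally_equiv g h -> naturally_equiv f h.
Proof.
move=> hY [e [s1 t1 h1]] [e' [s2 t2 h2]].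
have [|k [ks kt hk]] := equiv_comp (Fun_quasicategory (X := X) hY) h1 h2.
  by rewrite t1 s2.
by exists k; rewrite ks kt.
Qed.

Lemma trivial_fill1 (X S : sset) (q : smor X S) (x x' : X 0) (s : S 1) :
  trivial_fibration q -> src s = q 0 x -> tgt s = q 0 x' ->
  exists z : X 1, [/\ src z = x, tgt z = x' & q 1 z = s].
Proof.
move=> hq hs ht; pose y (j : nat) := if j == 0 then x' else x.
have [||z [hz hqz]] := @boundary_fill X S q 0 y s hq.
- move=> [|[|i]] [|[|j]] // _ _ _ _ n a b.
  move/(congr1 (fun f : dhom n 1 => val (f ord0))).
  by rewrite /= /bump !inordK // !ord1.
- by move=> [|[|j]] // _; rewrite /y /= -?src_face -?tgt_face.
by exists z; rewrite src_face tgt_face !hz.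
Qed.

Lemma trivial_fill2 (X S : sset) (q : smor X S) (f g h : X 1) :
  trivial_fibration q -> src f = src h -> tgt g = tgt h -> tgt f = src g ->
  tri (q 1 f) (q 1 g) (q 1 h) -> tri f g h.
Proof.
move=> hq fh gh fg [s [s2 s0 s1]].
pose y (j : nat) := if j == 0 then g else if j == 1 then h else f.
have [||z [hz hqz]] := @boundary_fill X S q 1 y s hq.
- apply: faces_compatS => -[|[|[|i]]] [|[|[|j]]] // _ _ _ _; rewrite /y /=;
    by rewrite -?src_face -?tgt_face.
- by move=> [|[|[|j]]] // _; rewrite /y.
by exists z; rewrite !hz.
Qed.

(** The edge, its inverse and the two witnessing triangles are all lifted, each with prescribed
    boundary. *)
Lemma trivial_equiv (X S : sset) (q : smor X S) (x x' : X 0) (e : S 1) :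
  trivial_fibration q -> src e = q 0 x -> tgt e = q 0 x' -> is_equiv_edge e ->
  exists z : X 1, [/\ src z = x, tgt z = x' & is_equiv_edge z].
Proof.
move=> hq hs ht /equiv_edgeE[e' [h1 h2]].
have [z [zs zt qz]] := trivial_fill1 hq hs ht.
have s' : src e' = q 0 x' by rewrite -(tri_mid h1).
have t' : tgt e' = q 0 x by rewrite (tri_tgt h1) tgt_degen.
have [z' [zs' zt' qz']] := trivial_fill1 hq s' t'.
exists z; split=> //; apply/equiv_edgeE; exists z'; rewrite zs zt.
split; apply: (trivial_fill2 hq); rewrite ?src_degen ?tgt_degen ?zs ?zt ?zs' ?zt' //.
- by rewrite qz qz' smor_degen -hs.
- by rewrite qz qz' smor_degen -ht.
Qed.

(** For the second half, an equivalence between restrictions is an edge of the function complex of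
    the horn; it lifts along the trivial fibration of restriction to an equivalence with the given
    end points. *)
Lemma horn_categorical_equivalence N (k : 'I_N.+1) :
  0 < k -> k < N -> categorical_equivalence (horn_incl k).
Proof.
move=> k0 kN Z hZ; split.
  move=> f; have [g hg] := hZ N k k0 kN f; exists g.
  have -> : scomp g (horn_incl k) = f by apply: smor_eq.
  exact: naturally_equiv_refl.
move=> g g' [e [es et he]].
have hv (f : smor (Delta N) Z) : fun_vertex (scomp f (horn_incl k)) =
    fun_restr Z (horn_incl k) 0 (fun_vertex f) by apply: smor_eq.
rewrite !hv in es et.
by have [z hz] := trivial_equiv (fun_horn_trivial hZ k0 kN) es et he; exists z.
Qed.

Lemma categorical_inner (X S : sset) (q : smor X S) :
  categorical_fibration q -> inner_fibration q.
Proof.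
move=> hq N k k0 kN; apply: hq; last exact: horn_categorical_equivalence.
by move=> n [a ha] [b hb] /= e; apply: eq_exist.
Qed.

(** * Nerves of categories are quasi-categories *)

Section Nerve.
Context (K : category).

(** Morphisms are packed with their end points, so that those of simplices with propositionally
    equal objects are compared without transport. *)
Definition arrow := {ab : ob K * ob K & hom ab.1 ab.2}.
Definition Arr (a b : ob K) (f : hom a b) : arrow :=
  existT (fun ab : ob K * ob K => hom ab.1 ab.2) (a, b) f.

Lemma Arr_inj (a b : ob K) : injective (@Arr a b).
Proof.
move=> f g e.
have h (x y : arrow) (exy : x = y) :
    eq_rect _ (fun ab => hom ab.1 ab.2) (projT2 x) _ (congr1 (@projT1 _ _) exy) =
    projT2 y by subst y.
by rewrite -[g](h _ _ e) (Prop_irrelevance (congr1 (@projT1 _ _) e) erefl).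
Qed.

Definition arr n (x : nerve K n) (i j : 'I_n.+1) (ij : i <= j) : arrow :=
  Arr (nhom x ij).

Lemma nerve_arr_eq n (x y : nerve K n) :
  (forall (i j : 'I_n.+1) (ij : i <= j), arr x ij = arr y ij) -> x = y.
Proof.
case: x y => o h hi hc [o' h' hi' hc'] e.
have eo : o = o'.
  by apply/funext => i; have /(congr1 (@projT1 _ _)) [] := e i i (leqnn i).
subst o'; apply: nerve_simplex_eq => i j ij.
exact: (Arr_inj (e i j ij)).
Qed.

Lemma arr_act m n (f : dhom m n) (x : nerve K n) (i j : 'I_m.+1) (ij : i <= j) :
  arr (act f x) ij = arr x (dmono f ij).
Proof. by []. Qed.

Lemma arr_irr n (x : nerve K n) (i j i' j' : 'I_n.+1) (ij : i <= j)
    (ij' : i' <= j') : i = i' -> j = j' -> arr x ij = arr x ij'.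
Proof. by move=> ei ej; subst; rewrite (Prop_irrelevance ij ij'). Qed.

Lemma nerve_edge_eq n (x y : nerve K n) :
  (forall (i j : 'I_n.+1) (ij : i <= j), act (dedge ij) x = act (dedge ij) y) ->
  x = y.
Proof.
move=> e; apply: nerve_arr_eq => i j ij.
have h : (ord0 : 'I_2) <= (ord_max : 'I_2) by [].
have := congr1 (fun z : nerve K 1 => arr z h) (e i j ij).
by rewrite !arr_act; do !rewrite (@arr_irr _ _ _ _ i j _ ij) //.
Qed.

Lemma arr_id n (x : nerve K n) (i j : 'I_n.+1) (ij : i <= j) : i = j ->
  arr x ij = Arr (idc (nob x i)).
Proof. by move=> e; subst j; rewrite /arr nhom_id. Qed.

Lemma ord2_case (i : 'I_2) : i = ord0 \/ i = ord_max.
Proof. by case: i => [[|[|i]] h] //; [left|right]; apply: val_inj. Qed.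

Lemma nerve_edge_ex (x : nerve K 1) (a b : ob K) :
  nob x ord0 = a -> nob x ord_max = b -> exists f : hom a b, x = nerve_edge f.
Proof.
move=> ea eb; subst a b.
have h : (ord0 : 'I_2) <= (ord_max : 'I_2) by [].
exists (nhom x h); apply: nerve_arr_eq => i j ij.
case: (ord2_case i) => ei; case: (ord2_case j) => ej; subst i j => //.
- by rewrite !arr_id.
- by congr Arr; congr nhom; apply: Prop_irrelevance.
- by rewrite !arr_id.
Qed.

Lemma nerve_edge_inj (a b : ob K) (f g : hom a b) :
  nerve_edge f = nerve_edge g -> f = g.
Proof.
have h : (ord0 : 'I_2) <= (ord_max : 'I_2) by [].
by move/(congr1 (fun z : nerve K 1 => arr z h))/Arr_inj.
Qed.

Lemma act_dedge n (x : nerve K n) (i j : 'I_n.+1) (ij : i <= j) :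
  act (dedge ij) x = nerve_edge (nhom x ij).
Proof.
have [f ef] := @nerve_edge_ex (act (dedge ij) x) (nob x i) (nob x j) erefl erefl.
rewrite ef; congr nerve_edge.
have h : (ord0 : 'I_2) <= (ord_max : 'I_2) by [].
have := congr1 (fun z : nerve K 1 => arr z h) ef.
rewrite arr_act -[arr (nerve_edge f) h]/(Arr f) => /Arr_inj <-.
by congr nhom; apply: Prop_irrelevance.
Qed.

Lemma nerve_comp n (x : nerve K n) (i j k : 'I_n.+1) (ij : i <= j) (jk : j <= k)
    (ik : i <= k) (a b c : ob K) (f : hom a b) (g : hom b c) (h : hom a c) :
  act (dedge ij) x = nerve_edge f -> act (dedge jk) x = nerve_edge g ->
  act (dedge ik) x = nerve_edge h -> h = compc g f.
Proof.
move=> ef eg eh.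
have ea : nob x i = a by exact: (congr1 (fun z : nerve K 1 => nob z ord0) ef).
have eb : nob x j = b by exact: (congr1 (fun z : nerve K 1 => nob z ord_max) ef).
have ec : nob x k = c by exact: (congr1 (fun z : nerve K 1 => nob z ord_max) eg).
subst a b c; rewrite !act_dedge in ef eg eh.
rewrite -(nerve_edge_inj ef) -(nerve_edge_inj eg) -(nerve_edge_inj eh).
exact: nhom_comp.
Qed.

Section Triangle.
Context (a b c : ob K) (f : hom a b) (g : hom b c).

Definition ntri_ob (i : nat) : ob K :=
  match i with 0 => a | 1 => b | _ => c end.

Definition ntri_hom (i j : nat) : i <= j -> hom (ntri_ob i) (ntri_ob j) :=
  match i, j return i <= j -> hom (ntri_ob i) (ntri_ob j) with
  | 0, 0 => fun _ => idc a
  | 0, 1 => fun _ => f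
  | 0, _.+2 => fun _ => compc g f
  | _.+1, 0 => fun h => match trueNfalse (esym h) with end
  | 1, 1 => fun _ => idc b
  | 1, _.+2 => fun _ => g
  | _.+2, 1 => fun h => match trueNfalse (esym h) with end
  | _.+2, _.+2 => fun _ => idc c
  end.

Program Definition nerve_triangle : nerve K 2 :=
  @NerveSimplex K 2 (fun i => ntri_ob i) (fun i j ij => @ntri_hom i j ij) _ _.
Next Obligation. by case=> [[|[|i]] ?] h. Qed.
Next Obligation.
by case=> [[|[|i]] ?] [[|[|j]] ?] [[|[|k]] ?] ij jk ik //=;
  rewrite /= ?comp_idl ?comp_idr.
Qed.
End Triangle.

Lemma nerve_fill2 (u : smor (horn (inord 1 : 'I_3)) (nerve K)) :
  exists w : smor (Delta 2) (nerve K),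
    forall n a, w n (horn_incl (inord 1) n a) = u n a.
Proof.
have hh (j : 'I_3) : j != inord 1 -> [exists i : 'I_3, (i != inord 1) &&
    [forall l, @dface 1 j l != i]].
  by move=> j1; apply/hornP; exists j => // l; rewrite eq_sym neq_lift.
have o2 : (inord 2 : 'I_3) != inord 1 by rewrite -val_eqE /= !inordK.
have o0 : (inord 0 : 'I_3) != inord 1 by rewrite -val_eqE /= !inordK.
pose e01 : horn (inord 1 : 'I_3) 1 := exist _ (dface (inord 2)) (hh _ o2).
pose e12 : horn (inord 1 : 'I_3) 1 := exist _ (dface (inord 0)) (hh _ o0).
have emid : nob (u 1 e01) ord_max = nob (u 1 e12) ord0.
  have e : act (dconst 0 ord_max) e01 = act (dconst 0 ord0) e12.
    apply: eq_exist; apply: dhom_eq => i; apply: val_inj.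
    by rewrite /= /bump !inordK.
  have := congr1 (u 0) e; rewrite !snat.
  exact: (congr1 (fun z : nerve K 0 => nob z ord0)).
have [f ef] := nerve_edge_ex (erefl (nob (u 1 e01) ord0)) emid.
have [g eg] := nerve_edge_ex (erefl (nob (u 1 e12) ord0))
  (erefl (nob (u 1 e12) ord_max)).
pose w : nerve K 2 := nerve_triangle f g.
have w01 : act (dface (inord 2)) w = u 1 e01.
  rewrite ef; apply: nerve_arr_eq => i j ij.
  rewrite arr_act.
  case: (ord2_case i) => ei; case: (ord2_case j) => ej; subst i j => //.
  - by rewrite !arr_id //= /bump inordK.
  - have l01 : (inord 0 : 'I_3) <= (inord 1 : 'I_3) by rewrite !inordK.
    rewrite (@arr_irr _ _ _ _ (Ordinal (isT : 0 < 3)) (Ordinal (isT : 1 < 3)) _ isT) //;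
      by apply: val_inj; rewrite /= /bump inordK.
  - by rewrite !arr_id //= /bump inordK.
have w12 : act (dface (inord 0)) w = u 1 e12.
  rewrite eg; apply: nerve_arr_eq => i j ij.
  rewrite arr_act.
  case: (ord2_case i) => ei; case: (ord2_case j) => ej; subst i j => //.
  - by rewrite !arr_id //= /bump inordK.
  - rewrite (@arr_irr _ _ _ _ (Ordinal (isT : 1 < 3)) (Ordinal (isT : 2 < 3)) _ isT) //;
      by apply: val_inj; rewrite /= /bump inordK.
  - by rewrite !arr_id //= /bump inordK.
exists (ymap w) => n [a ha]; have /hornP[j j1 aj] := ha.
have : j = inord 2 \/ j = inord 0.
  case: j j1 {aj} => [[|[|[|j]]] hj] //; rewrite -val_eqE /= inordK // => _.
    by right; apply: val_inj; rewrite /= inordK.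
  by left; apply: val_inj; rewrite /= inordK.
have [b eb] := dcomp_face aj.
have -> : ymap w n (horn_incl (inord 1) n (exist _ a ha)) = act b (act (dface j) w).
  by rewrite act_act -eb.
by case=> ej; subst j; rewrite ?w01 ?w12 -snat; congr (u _ _); apply: eq_exist.
Qed.

Lemma ord_outside N (s : seq 'I_N) : size s < N -> exists j, j \notin s.
Proof.
move=> sN; apply/existsP; apply: contraLR sN; rewrite negb_exists -leqNgt.
move=> /forallP h; rewrite -[N in N <= _]card_ord.
apply: leq_trans (card_size s); apply: subset_leq_card; apply/subsetP => j _.
by have := h j; rewrite negbK.
Qed.

Lemma dtri_mono N (i j l : 'I_N.+1) : i <= j -> j <= l -> forall x y : 'I_3,
  x <= y -> (if x == 0 :> nat then i else if x == 1 :> nat then j else l) <=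
            (if y == 0 :> nat then i else if y == 1 :> nat then j else l).
Proof.
move=> ij jl [[|[|[|x]]] hx] [[|[|[|y]]] hy] //= _; exact: leq_trans jl.
Qed.

Definition dtri N (i j l : 'I_N.+1) (ij : i <= j) (jl : j <= l) : dhom 2 N :=
  DHom (dtri_mono ij jl).

(** From dimension 3 on the horn contains every edge, so the filler is determined. Functoriality on
    [i <= j <= l] is read off a triangle of the horn, present when some vertex other than [k] lies
    outside [i], [j], [l]. *)
Lemma nerve_fill N (k : 'I_N.+4) (u : smor (horn k) (nerve K)) :
  0 < k -> k < N.+3 ->
  exists w : smor (Delta N.+3) (nerve K), forall n a, w n (horn_incl k n a) = u n a.
Proof.
move=> k0 kN.
have hE (i j : 'I_N.+4) (ij : i <= j) :
    [exists x, (x != k) && [forall y, dedge ij y != x]].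
  have [x] := @ord_outside N.+4 [:: i; j; k] isT; rewrite !inE !negb_or.
  case/and3P => xi xj xk; apply/hornP; exists x => //= y; rewrite eq_sym.
  by case: ifP.
pose E i j ij : horn k 1 := exist _ (dedge ij) (hE i j ij).
have hV (i : 'I_N.+4) : [exists x, (x != k) && [forall y, @dconst 0 _ i y != x]].
  have [x] := @ord_outside N.+4 [:: i; k] isT; rewrite !inE !negb_or.
  by case/andP => xi xk; apply/hornP; exists x => //= y; rewrite eq_sym.
pose o (i : 'I_N.+4) : ob K := nob (u 0 (exist _ (dconst 0 i) (hV i))) ord0.
have hF (i j : 'I_N.+4) (ij : i <= j) :
    exists f : hom (o i) (o j), u 1 (E i j ij) = nerve_edge f.
  apply: nerve_edge_ex.
    have := snat u (dconst 0 ord0) (E i j ij).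
    move/(congr1 (fun z : nerve K 0 => nob z ord0)) => /= <-.
    by congr (nob (u 0 _)); apply: eq_exist; apply: dhom_eq.
  have := snat u (dconst 0 ord_max) (E i j ij).
  move/(congr1 (fun z : nerve K 0 => nob z ord0)) => /= <-.
  by congr (nob (u 0 _)); apply: eq_exist; apply: dhom_eq.
pose F i j ij := sval (cid (hF i j ij)).
have eF i j ij : u 1 (E i j ij) = nerve_edge (F i j ij) := svalP (cid (hF i j ij)).
have Fid (i : 'I_N.+4) (h : i <= i) : F i i h = idc (o i).
  have := eF i i h.
  have -> : E i i h = degen 1 (X := horn k) (exist _ (dconst 0 i) (hV i)).
    by apply: eq_exist; apply: dhom_eq => j /=; case: ifP.
  rewrite smor_degen => e; apply: nerve_edge_inj; rewrite -e.
  apply: nerve_arr_eq => a b ab; rewrite arr_act arr_id //.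
  by case: (ord2_case a) => ea; case: (ord2_case b) => eb; subst a b.
have tri_in (i j l x : 'I_N.+4) (ij : i <= j) (jl : j <= l) (il : i <= l) :
    x \notin [:: i; j; l] -> x != k -> F i l il = compc (F j l jl) (F i j ij).
  rewrite !inE !negb_or => /and3P[xi xj xl] xk.
  have ht : [exists x, (x != k) && [forall y, dtri ij jl y != x]].
    apply/hornP; exists x => //= y; rewrite eq_sym.
    by case: ifP => //; case: ifP.
  pose t : horn k 2 := exist _ (dtri ij jl) ht.
  have h01 : (Ordinal (isT : 0 < 3)) <= (Ordinal (isT : 1 < 3)) by [].
  have h12 : (Ordinal (isT : 1 < 3)) <= (Ordinal (isT : 2 < 3)) by [].
  have h02 : (Ordinal (isT : 0 < 3)) <= (Ordinal (isT : 2 < 3)) by [].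
  apply: (@nerve_comp 2 (u 2 t) _ _ _ h01 h12 h02); rewrite -snat -eF;
    congr (u 1 _); apply: eq_exist; apply: dhom_eq => y;
    by case: (ord2_case y) => ->.
have Fcomp (i j l : 'I_N.+4) (ij : i <= j) (jl : j <= l) (il : i <= l) :
    F i l il = compc (F j l jl) (F i j ij).
  have [/existsP[x /andP[h1 h2]]|nx] :=
    boolP [exists x, (x \notin [:: i; j; l]) && (x != k)]; first exact: (tri_in _ _ _ x).
  have hx x : x != k -> x \in [:: i; j; l].
    by move=> xk; have := existsPn nx x; rewrite negb_and !negbK (negPf xk) orbF.
  (* The exception is dimension 3 with [i], [j], [l], [k] all the vertices. As [k] is inner, [i] and
     [l] are the extreme ones, and the face opposite [k] follows from the other three by
     associativity. *)
  have dist : uniq [:: i; j; l; k].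
    apply: contraT => nu; have : size (undup [:: i; j; l; k]) < N.+4.
      apply: (@leq_trans 4) => //; rewrite ltn_neqAle size_undup andbT.
      by apply: contra nu => /eqP e; rewrite -[uniq _]negbK -ltn_size_undup e.
    case/ord_outside => x; rewrite mem_undup => hx'.
    have xk : x != k by apply: contra hx' => /eqP->; rewrite !inE eqxx !orbT.
    case/negP: hx'; move: (hx x xk); rewrite !inE.
    by case/or3P => ->; rewrite ?orbT.
  move: dist; rewrite /= !inE !negb_or => /and4P[/and3P[nij nil nik] /andP[njl njk] nlk _].
  have i0 : i = ord0.
    have : ord0 \in [:: i; j; l] by apply: hx; rewrite -val_eqE neq_ltn k0.
    rewrite !inE => /or3P[] /eqP e; apply: val_inj; apply/eqP.
    - by rewrite -e.
    - by rewrite -leqn0 (leq_trans ij) // -e.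
    - by rewrite -leqn0 (leq_trans il) // -e.
  have ln : l = ord_max.
    have : ord_max \in [:: i; j; l] by apply: hx; rewrite -val_eqE neq_ltn kN orbT.
    have lN (x : 'I_N.+4) : x <= N.+3 by rewrite -ltnS.
    rewrite !inE => /or3P[] /eqP e; apply: val_inj; apply/eqP; rewrite eqn_leq lN /=.
    - by rewrite -[X in X <= _]/(val (ord_max : 'I_N.+4)) e.
    - by rewrite -[X in X <= _]/(val (ord_max : 'I_N.+4)) e.
    - by rewrite -[X in X <= _]/(val (ord_max : 'I_N.+4)) e.
  have ik : i <= k by rewrite i0.
  have kl : k <= l by rewrite ln; apply: ltnW.
  have eil : F i l il = compc (F k l kl) (F i k ik).
    by apply: (tri_in _ _ _ j) => //; rewrite !inE !negb_or eq_sym nij njk njl.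
  have [kj|jk] := leqP k j.
    have ekl : F k l kl = compc (F j l jl) (F k j kj).
      by apply: (tri_in _ _ _ i) => //; rewrite !inE !negb_or nij nik nil.
    have eij : F i j ij = compc (F k j kj) (F i k ik).
      apply: (tri_in _ _ _ l) => //.
      by rewrite !inE !negb_or eq_sym nil nlk eq_sym njl.
    by rewrite eil ekl eij comp_assoc.
  have jk' := ltnW jk.
  have ejl : F j l jl = compc (F k l kl) (F j k jk').
    by apply: (tri_in _ _ _ i) => //; rewrite !inE !negb_or nij nik nil.
  have eik : F i k ik = compc (F j k jk') (F i j ij).
    apply: (tri_in _ _ _ l) => //.
    by rewrite !inE !negb_or eq_sym nil nlk eq_sym njl.
  by rewrite eil ejl eik comp_assoc.
pose w : nerve K N.+3 := @NerveSimplex K N.+3 o F Fid Fcomp.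
exists (ymap w) => n [a ha] /=; apply: nerve_edge_eq => i j ij.
rewrite -snat act_act.
have -> : act (dedge ij) (exist _ a ha : horn k n) = E _ _ (dmono a ij).
  by apply: eq_exist; apply: dhom_eq => y /=; case: ifP.
rewrite eF; apply: (etrans _ (@act_dedge _ w _ _ (dmono a ij))).
by apply: act_congr => y; case: (ord2_case y) => ->.
Qed.

Lemma nerve_quasicategory : quasicategory (nerve K).
Proof.
case=> [|[|[|N]]] k k0 kN u; last exact: nerve_fill.
- by rewrite ltn0 in kN.
- by case: (k : nat) k0 kN => [|[]].
- have e : k = inord 1.
    by case: k k0 kN {u} => [[|[|[|k]]] hk] // _ _; apply: val_inj; rewrite /= inordK.
  by subst k; apply: nerve_fill2.
Qed.
End Nerve.

Lemma sprod_quasicategory (X Y : sset) :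
  quasicategory X -> quasicategory Y -> quasicategory (sprod X Y).
Proof.
move=> hX hY N k k0 kN u.
have [w hw] := hX N k k0 kN (scomp (sfst X Y) u).
have [w' hw'] := hY N k k0 kN (scomp (ssnd X Y) u).
unshelve eexists (@SMor (Delta N) (sprod X Y) (fun n a => (w n a, w' n a)) _).
  by move=> m n f a; rewrite /= !snat.
by move=> n a /=; rewrite hw hw' /=; case: (u n a).
Qed.

(** * Partial lifts over the front of a simplex *)

Lemma plift_union (B X S : sset) (q : smor X S) (v : smor B S) G1 G2 :
  plift q v G1 -> plift q v G2 ->
  (forall n b x x', G1 n b x -> G2 n b x' -> x = x') ->
  plift q v (fun n b x => G1 n b x \/ G2 n b x).
Proof.
move=> h1 h2 h; split.
- move=> n b x x' [g|g] [g'|g'].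
  + exact: (pl_fun h1 g g').
  + exact: (h _ _ _ _ g g').
  + by apply/esym; exact: (h _ _ _ _ g' g).
  + exact: (pl_fun h2 g g').
- by move=> m n f b x [g|g]; [left; apply: (pl_act h1)|right; apply: (pl_act h2)].
- by move=> n b x [g|g]; [apply: (pl_over h1)|apply: (pl_over h2)].
Qed.

(** Simplices with support in [P] take the value of [H] at their image under the collapse [f].
    Partial lifts over a simplex are built as unions of such clauses. *)
Definition clause (X : sset) L M (P : pred {set 'I_L.+1}) (f : dhom L M)
    (H : forall n, Delta M n -> X n -> Prop) n (x : PN (ordP L) n) (y : X n) :=
  P (supp x) /\ H n (dcomp f (pn_ord L n x)) y.

Lemma clause_plift (X S : sset) (q : smor X S) L M (P : pred {set 'I_L.+1})
    (f : dhom L M) H (vM : smor (Delta M) S) (v : smor (PN (ordP L)) S) :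
  downward (ordP L) P -> plift q vM H ->
  (forall n (x : PN (ordP L) n), P (supp x) -> vM n (dcomp f (pn_ord L n x)) = v n x) ->
  plift q v (clause P f H).
Proof.
move=> dP hH hv; split.
- by move=> n b x x' [_ h] [_ h']; apply: (pl_fun hH h h').
- move=> m n g b x [Pb h]; split; last by apply: (pl_act hH) h.
  by apply: dP Pb; [apply: supp_act|apply: supp_neq0].
- by move=> n b x [Pb h]; rewrite (pl_over hH h) hv.
Qed.

Definition sgraph (X : sset) M (z : X M) n (b : Delta M n) (y : X n) :=
  y = act b z.

Lemma sgraph_plift (X S : sset) (q : smor X S) M (z : X M) :
  plift q (ymap (q M z)) (sgraph z).
Proof.
split.
- by move=> n b x x' -> ->.
- by move=> m n f b x ->; rewrite /sgraph act_act.
- by move=> n b x ->; rewrite snat.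
Qed.

Definition mgraph (X : sset) M (u : smor (Delta M) X) n (b : Delta M n) (y : X n) :=
  y = u n b.

Lemma mgraph_plift (X S : sset) (q : smor X S) M (u : smor (Delta M) X) :
  plift q (scomp q u) (mgraph u).
Proof.
split.
- by move=> n b x x' -> ->.
- by move=> m n f b x ->; rewrite /mgraph snat.
- by move=> n b x ->.
Qed.

Definition hgraph (X : sset) M (k : 'I_M.+1) (u : smor (horn k) X)
    n (b : Delta M n) (y : X n) := exists a, horn_incl k n a = b /\ y = u n a.

Lemma hgraph_plift (X S : sset) (q : smor X S) M (k : 'I_M.+1)
    (u : smor (horn k) X) (v : smor (Delta M) S) :
  (forall n a, q n (u n a) = v n (horn_incl k n a)) -> plift q v (hgraph u).
Proof.
move=> huv; split.
- move=> n b x x' [[a ha] [/= e1 ->]] [[a' ha'] [/= e2 ->]].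
  by congr (u _ _); apply: eq_exist; rewrite e1.
- by move=> m n f b x [a [<- ->]]; exists (act f a); rewrite -!snat.
- by move=> n b x [a [<- ->]].
Qed.

Section Front.
Context (L : nat).
Implicit Types (T : {set 'I_L.+1}) (P Q : pred {set 'I_L.+1}).

(** The vertices below [F] form the front, treated one by one, and those from [F] on the tail.
    Domains are Boolean combinations of [has_v], [has_ge] and [miss_ge], so that closure and pairing
    conditions are settled by truth tables. *)
Definition has_v i T : bool := (inord i : 'I_L.+1) \in T.
Definition has_ge F T : bool := [exists r in T, F <= r].
Definition miss_ge F T : bool := [exists r : 'I_L.+1, (F <= r) && (r \notin T)].

Lemma has_vU i j T : i <= L -> j <= L -> has_v i (inord j |: T) = (i == j) || has_v i T.
Proof. by move=> iL jL; rewrite /has_v in_setU1 -val_eqE /= !inordK. Qed.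

Lemma has_vD i j T : i <= L -> j <= L -> has_v i (T :\ inord j) = (i != j) && has_v i T.
Proof. by move=> iL jL; rewrite /has_v in_setD1 -val_eqE /= !inordK. Qed.

Lemma has_geU F j T : j < F -> F <= L -> has_ge F (inord j |: T) = has_ge F T.
Proof.
move=> jF FL; apply/exists_inP/exists_inP => -[r rT Fr].
  move: rT; rewrite in_setU1 => /orP[/eqP e|rT]; last by exists r.
  by move: Fr; rewrite e inordK; lia.
by exists r; rewrite // in_setU1 rT orbT.
Qed.

Lemma has_geD F j T : j < F -> F <= L -> has_ge F (T :\ inord j) = has_ge F T.
Proof.
move=> jF FL; apply/exists_inP/exists_inP => -[r rT Fr].
  by exists r => //; move: rT; rewrite in_setD1 => /andP[].
exists r => //; rewrite in_setD1 rT andbT; apply/eqP => e.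
by move: Fr; rewrite e inordK; lia.
Qed.

Lemma miss_geU F j T : j < F -> F <= L -> miss_ge F (inord j |: T) = miss_ge F T.
Proof.
move=> jF FL; apply/existsP/existsP => -[r /andP[Fr rT]]; exists r; rewrite Fr /=.
  by apply: contra rT => rT; rewrite in_setU1 rT orbT.
rewrite in_setU1 negb_or rT andbT; apply/eqP => e.
by move: Fr; rewrite e inordK; lia.
Qed.

Lemma miss_geD F j T : j < F -> F <= L -> miss_ge F (T :\ inord j) = miss_ge F T.
Proof.
move=> jF FL; apply/existsP/existsP => -[r /andP[Fr rT]]; exists r; rewrite Fr /=.
  move: rT; rewrite in_setD1 negb_and negbK => /orP[/eqP e|//].
  by move: Fr; rewrite e inordK; lia.
by rewrite in_setD1 negb_and rT orbT.
Qed.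

Lemma has_v_sub i T T' : T' \subset T -> has_v i T' ==> has_v i T.
Proof. by move=> /subsetP s; apply/implyP/s. Qed.

Lemma has_ge_sub F T T' : T' \subset T -> has_ge F T' ==> has_ge F T.
Proof.
move=> /subsetP s; apply/implyP => /exists_inP[r rT Fr]; apply/exists_inP.
by exists r => //; apply: s.
Qed.

Lemma miss_ge_sub F T T' : T' \subset T -> miss_ge F T ==> miss_ge F T'.
Proof.
move=> /subsetP s; apply/implyP => /existsP[r /andP[Fr rT]]; apply/existsP.
by exists r; rewrite Fr; apply: contra rT => /s.
Qed.

Lemma has_vP n (x : PN (ordP L) n) i : i <= L ->
  reflect (exists k, x k = i :> nat) (has_v i (supp x)).
Proof.
move=> iL; apply: (iffP (suppP x _)) => -[k e]; exists k.
  by rewrite -e inordK.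
by apply: val_inj; rewrite /= e inordK.
Qed.

Lemma has_geP F n (x : PN (ordP L) n) :
  reflect (exists k, F <= x k) (has_ge F (supp x)).
Proof.
apply: (iffP exists_inP) => [[r /(suppP x)[k ->]]|[k h]]; first by exists k.
by exists (x k) => //; apply: (supp_in x).
Qed.

Lemma miss_geP F n (x : PN (ordP L) n) :
  reflect (exists r : 'I_L.+1, F <= r /\ forall k, x k != r) (miss_ge F (supp x)).
Proof.
apply: (iffP existsP) => [[r /andP[Fr rx]]|[r [Fr h]]]; exists r.
  by split=> // k; apply: contra rx => /eqP <-; apply: (supp_in x).
by rewrite Fr; apply/negP => /(suppP x)[k e]; case/eqP: (h k).
Qed.

Lemma fchain_ord T : T != set0 -> fchain (V := ordP L) T.
Proof. by move=> T0; apply/fchainP; split=> // a b _ _; apply: leq_total. Qed.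

(** One stage of a filling: [j] is toggled in all chains of [Q] outside [P]. As [j] is in the front,
    toggling leaves the tail tests unchanged. Chains inside the front are covered beforehand, so
    removing [j] never empties a chain. *)
Lemma front_stage (X S : sset) (q : smor X S) (v : smor (PN (ordP L)) S) F j P Q G :
  j < F -> F <= L -> downward (ordP L) P -> downward (ordP L) Q ->
  (forall T, P T -> Q T) -> (forall T, ~~ has_ge F T -> P T) ->
  (forall T, Q T -> ~~ P T -> Q (inord j |: T) && ~~ P (T :\ inord j)) ->
  plift q v G -> has_dom (ordP L) X G P ->
  (forall T, Q T -> ~~ P T -> has_ge F T -> has_v j T -> fillable q G T (inord j)) ->
  extends_to q v G Q.
Proof.
move=> jF FL dP dQ PQ PR hpiv hG hP hfill.
pose Q' : pred {set ordP L} := fun T => fchain (V := ordP L) T && Q T.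
have hR T : ~~ P T -> has_ge F T by move=> PT; apply: contraR PT; apply: PR.
have [||||||||G' [hG' GG' dG']] := @pairing_const (ordP L) X S q v Q' P (inord j) G.
- move=> T T' s T0 /andP[cT QT]; apply/andP; split; first exact: fchain_sub cT.
  exact: dQ QT.
- by move=> T /andP[].
- by [].
- by [].
- by [].
- by move=> T cT PT; rewrite /Q' cT PQ.
- move=> T /andP[cT QT] PT; have /andP[h1 h2] := hpiv _ QT PT; split=> //.
    rewrite /Q' h1 andbT; apply: fchain_ord.
    by apply/set0Pn; exists (inord j); rewrite setU11.
  have /exists_inP[r rT Fr] := hR _ PT; apply/set0Pn; exists r.
  rewrite in_setD1 rT andbT; apply/eqP => e; move: Fr; rewrite e inordK; lia.
- move=> T /andP[cT QT] PT jT; apply: hfill => //; exact: hR.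
exists G'; split=> // n b; rewrite dG' /Q'.
by rewrite fchain_supp.
Qed.

Lemma inner_pivot_ord F i j T : i < j -> j < F -> F <= L ->
  has_v i T -> has_ge F T -> inner_pivot (V := ordP L) T (inord j).
Proof.
move=> ij jF FL iT /exists_inP[r rT Fr].
exists (inord i), r; split=> //; rewrite -?val_eqE /= !inordK; lia.
Qed.

Lemma inner_pivot_ord2 i j l T : i < j -> j < l -> l <= L ->
  has_v i T -> has_v l T -> inner_pivot (V := ordP L) T (inord j).
Proof.
move=> ij jl lL iT lT.
exists (inord i), (inord l); split=> //; rewrite -?val_eqE /= !inordK; lia.
Qed.

Lemma cocart_pivot_ord (X S : sset) (q : smor X S) G F i j T (f : X 1)
    (e : PN (ordP L) 1) : i < j -> j < F -> F <= L ->
  e ord0 = inord i -> e ord_max = inord j ->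
  has_v i T -> has_v j T -> has_ge F T -> (forall l, l < j -> l != i -> ~~ has_v l T) ->
  G 1 e f -> is_cocartesian q f -> cocart_pivot (V := ordP L) q G T (inord i).
Proof.
move=> ij jF FL e0 e1 iT jT /exists_inP[r rT Fr] hl Gf cf.
exists e, f; rewrite e0 e1; split=> //.
- by rewrite -val_eqE /= !inordK; lia.
- have u : uniq [:: inord i; inord j; r].
    by rewrite /= !inE !negb_or -!val_eqE /= !inordK; lia.
  have /card_uniqP/= <- := u.
  apply: subset_leq_card; apply/subsetP => z.
  by rewrite !inE => /or3P[] /eqP->.
- split=> // z zT zi; rewrite /= leqNgt inordK; last by lia.
  apply/negP => zj; have := hl z zj; rewrite /has_v inord_val zT.
  by move=> /(_ _)/negP; apply=> //; apply: contra zi => /eqP <-; rewrite inord_val.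
Qed.
End Front.

Lemma dnat_proof L M (g : nat -> nat) (hm : {homo g : x y / x <= y})
    (hb : forall i, i <= L -> g i <= M) (i j : 'I_L.+1) :
  i <= j -> Ordinal (hb i (ltn_ord i : i <= L) : g i < M.+1) <=
            Ordinal (hb j (ltn_ord j : j <= L) : g j < M.+1).
Proof. exact: hm. Qed.

Definition dnat L M (g : nat -> nat) (hm : {homo g : x y / x <= y})
    (hb : forall i, i <= L -> g i <= M) : dhom L M :=
  @DHom L M (fun i => Ordinal (hb i (ltn_ord i : i <= L) : g i < M.+1))
    (@dnat_proof L M g hm hb).

(** A simplex inside the edge from 0 to 1 is the pullback of that edge along [dstep], so [e]
    determines its value. *)
Lemma plift_edge01 (X S : sset) (q : smor X S) M (v : smor (Delta M.+1) S) H
    (e : X 1) n (b : Delta M.+1 n) y :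
  plift q v H -> H 1 (@dedge M.+1 ord0 (inord 1) (leq0n _)) e ->
  (forall i, b i <= 1) -> H n b y -> y = act (dcomp (dstep M.+1 1) b) e.
Proof.
move=> hH He hb Hy; apply: (pl_fun hH Hy).
have eb : b = act (X := Delta M.+1) (dcomp (dstep M.+1 1) b)
    (@dedge M.+1 ord0 (inord 1) (leq0n _)).
  apply: dhom_eq => i; apply: val_inj => /=.
  by have := hb i; case: (b i : nat) => [|[|k]] //= _; rewrite inordK.
by rewrite [in H n b]eb; apply: (pl_act hH).
Qed.

(** * Cocartesian edges: two out of three *)

Lemma pt_eq n (x y : pt n) : x = y.
Proof. by case: x; case: y. Qed.

Definition dpred N : dhom N.+1 N :=
  dnat (L := N.+1) (M := N) (g := predn)
    ltac:(by move=> x y; lia) ltac:(by move=> x; lia).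

Definition dmin L M : dhom L M :=
  dnat (L := L) (M := M) (g := fun i => minn i M)
    ltac:(by move=> x y; lia) ltac:(by move=> x; lia).

Definition dincl M L (h : M <= L) : dhom M L :=
  dnat (L := M) (M := L) (g := id)
    ltac:(by []) ltac:(by move=> x; lia).

(** For [c <= 1] the two vertices other than [c] are separated by [dstep 2 2], which is why one
    formula serves both faces. *)
Lemma act_miss (X : sset) n (a : dhom n 2) c (z : X 2) : c <= 1 ->
  (forall i, a i != c :> nat) ->
  act a z = act (dcomp (dstep 2 2) a) (face c z).
Proof.
move=> c1 ha; have [|g eg] := @dcomp_face n 1 a (inord c).
  by move=> i; rewrite -val_eqE /= inordK ?ha //; lia.
rewrite /face eg -[LHS]act_act; apply: act_congr => i; apply: val_inj.
rewrite /= /bump inordK; last by lia.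
have : g i <= 1 by rewrite -ltnS.
case: ifP; case: (g i : nat) => [|[|]] //=; lia.
Qed.

Definition tot_edge N k : PN (ordP N.+3) 1 :=
  ord_pn N.+3 1 (dcomp (dincl (isT : 2 <= N.+3)) (dface (inord k : 'I_3))).

Lemma tot_edge_nR N k : ~~ has_ge 3 (supp (tot_edge N k)).
Proof.
by apply/has_geP => -[i /=]; have := ltn_ord (lift (inord k : 'I_3) i) => /=; lia.
Qed.

Lemma tot_edge_val (X : sset) N k (s : X 2) (G : forall n, PN (ordP N.+3) n -> X n -> Prop) :
  (forall n (x : PN (ordP N.+3) n), ~~ has_ge 3 (supp x) ->
     G n x (act (dcomp (dmin N.+3 2) (pn_ord N.+3 n x)) s)) ->
  G 1 (tot_edge N k) (face k s).
Proof.
move=> h; have := h _ _ (tot_edge_nR N k).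
suff -> : dcomp (dmin N.+3 2) (pn_ord N.+3 1 (tot_edge N k)) = dface (inord k) by [].
apply: dhom_eq => i; apply: val_inj => /=.
by have := ltn_ord (lift (inord k : 'I_3) i) => /=; lia.
Qed.

Lemma tot_edge_vert N k i : k <= 2 ->
  tot_edge N k i = inord (bump k i) :> 'I_N.+4.
Proof.
move=> k2; apply: val_inj; rewrite /= !inordK //.
by have := ltn_ord i; rewrite /bump; lia.
Qed.

(* A horn of Delta (N+2) whose first edge is the face [c] of the 2-simplex [s] is
   spread over Delta (N+3): the vertices 0, 1, 2 carry [s], and the simplices which
   avoid [c] carry the horn. *)
Section TwoOfThree.
Context (X S : sset) (q : smor X S) (N : nat) (c : nat) (c1 : c <= 1).
Context (s : X 2) (u : smor (horn (ord0 : 'I_N.+3)) X) (v : smor (Delta N.+2) S).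
Hypothesis huv : forall n a, q n (u n a) = v n (horn_incl (ord0 : 'I_N.+3) n a).
Hypothesis hu : u 1 (horn_first_edge N) = face c s.

Let L := N.+3.
Let V := ordP L.

(** [dpred] sends 2 to 1 and the tail to the vertices from 2 on; hence landing in the horn at 0
    means missing 2 or a vertex of the tail. *)
Definition tot_base : pred {set 'I_L.+1} := fun T =>
  ~~ has_ge 3 T || (~~ has_v c T && (miss_ge 3 T || ~~ has_v 2 T)).

Let FL : 3 <= L. Proof. by []. Qed.

Let nR : pred {set 'I_L.+1} := fun T => ~~ has_ge 3 T.
Let nc : pred {set 'I_L.+1} := fun T => ~~ has_v c T.

Lemma tot_min_miss n (x : PN V n) : nc (supp x) ->
  forall i, dcomp (dmin L 2) (pn_ord L n x) i != c :> nat.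
Proof.
have cL : c <= L by lia.
move=> /(has_vP _ cL) hx i /=; apply/negP => /eqP e; apply: hx; exists i.
by move: e; rewrite /=; lia.
Qed.

Lemma tot_dom_horn n (x : PN V n) :
  pdom (hgraph u) (dcomp (dpred N.+2) (pn_ord L n x)) <->
  miss_ge 3 (supp x) || ~~ has_v 2 (supp x).
Proof.
have L2 : 2 <= L by [].
split.
- case=> y [[a ha] [/= ea _]]; have /hornP[j j0 aj] := ha.
  have hj (i : 'I_n.+1) : (x i).-1 != j.
    by have := aj i; rewrite ea -val_eqE.
  have [e|ne] := eqVneq (j : nat) 1.
    apply/orP; right; apply/(has_vP _ L2) => -[i ei].
    by have := hj i; rewrite ei e.
  apply/orP; left; apply/miss_geP.
  have j0' : j != 0 :> nat by move: j0; rewrite -val_eqE.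
  have jL : j.+1 < L.+1 by have := ltn_ord j; rewrite /L; lia.
  exists (Ordinal jL); split; first by rewrite /=; lia.
  by move=> i; apply/negP => /eqP e; have := hj i; rewrite e /= eqxx.
- move=> h; have [j jL [j1 hj]] : exists2 j, j < L.+1 &
      1 < j /\ forall i, x i != j :> nat.
    case/orP: h => [/miss_geP[r [r3 hr]]|/(has_vP _ L2) h2].
      by exists r; rewrite ?ltn_ord //; split=> //; lia.
    exists 2 => //; split=> // i; apply/negP => /eqP e; apply: h2; by exists i.
  have jp : j.-1 < N.+3 by rewrite /L in jL; lia.
  have ha : [exists i : 'I_N.+3, (i != ord0) &&
      [forall l, dcomp (dpred N.+2) (pn_ord L n x) l != i]].
    apply/hornP; exists (Ordinal jp); first by rewrite -val_eqE /=; lia.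
    have hm (m : nat) : m != j -> m.-1 != j.-1 by lia.
    by move=> i; rewrite -val_eqE; apply: hm (hj i).
  pose a : horn (ord0 : 'I_N.+3) n := exist _ (dcomp (dpred N.+2) (pn_ord L n x)) ha.
  by exists (u n a), a.
Qed.

Lemma tot_agree (Y S' : sset) (q' : smor Y S') (v' : smor (Delta N.+2) S') H
    (z : Y 2) :
  plift q' v' H -> H 1 (@dedge N.+2 ord0 (inord 1) (leq0n _)) (face c z) ->
  forall n (x : PN V n) y y', clause nR (dmin L 2) (sgraph z) x y ->
    clause nc (dpred N.+2) H x y' -> y = y'.
Proof.
move=> hH He n x y y' [xR ->] [xc Hy'].
rewrite (act_miss _ c1 (tot_min_miss xc)).
have xb i : x i < 3.
  by rewrite ltnNge; apply: contra xR => h; apply/has_geP; exists i.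
have h1 (k : nat) : k < 3 -> k.-1 <= 1 by lia.
have h2 (k : nat) : k < 3 -> (minn k 2 < 2) = (k.-1 < 1) by lia.
rewrite (plift_edge01 hH He _ Hy'); last by move=> i; apply: h1 (xb i).
by apply: act_congr => i /=; congr (if _ then _ else _); apply: h2 (xb i).
Qed.

Let down_nR : downward V nR.
Proof.
move=> T T' sT _; rewrite /nR; move: (has_ge_sub 3 sT).
by case: (has_ge 3 T); case: (has_ge 3 T').
Qed.

Let down_nc : downward V nc.
Proof.
move=> T T' sT _; rewrite /nc; move: (has_v_sub c sT).
by case: (has_v c T); case: (has_v c T').
Qed.

(** The map to [S] must exist before anything is lifted: [q s] and [v] agree on their common edge
    and, [S] being a quasi-category, extend over all of [PN V] by inner horns at [c + 1]. *)
Lemma two_of_three_setup : inner_fibration q -> quasicategory S ->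
  exists (w : smor (PN V) S) G, [/\ plift q w G, has_dom V X G tot_base,
    forall n (x : PN V n), nc (supp x) ->
      w n x = v n (dcomp (dpred N.+2) (pn_ord L n x)),
    forall n (x : PN V n), nR (supp x) ->
      G n x (act (dcomp (dmin L 2) (pn_ord L n x)) s) &
    forall n (x : PN V n) a, nc (supp x) ->
      horn_incl ord0 n a = dcomp (dpred N.+2) (pn_ord L n x) -> G n x (u n a)].
Proof.
move=> hq hS.
have cL : c <= L by lia.
pose GS n (x : PN V n) y := clause nR (dmin L 2) (sgraph (q 2 s)) x y \/
  clause nc (dpred N.+2) (mgraph v) x y.
have hGS : plift (to_pt S) (to_pt (PN V)) GS.
  apply: plift_union.
  - apply: clause_plift => //; first exact: (sgraph_plift (to_pt S)).
    by move=> *; apply: pt_eq.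
  - apply: clause_plift => //; first exact: (mgraph_plift (to_pt S)).
    by move=> *; apply: pt_eq.
  - apply: tot_agree; first exact: (mgraph_plift (to_pt S)).
    rewrite -snat_face -hu huv; congr (v _ _); exact: dhom_eq.
have dGS : has_dom V S GS (fun T => nR T || nc T).
  move=> n x; split; first by case=> y [[-> _]|[-> _]]; rewrite ?orbT.
  case/orP => h; first by exists (act (dcomp (dmin L 2) (pn_ord L n x)) (q 2 s)); left.
  by exists (v n (dcomp (dpred N.+2) (pn_ord L n x))); right.
have [||||||||G1 [hG1 sG1 dG1]] :=
    front_stage (F := 3) (j := c.+1) (Q := xpredT) _ _ _ _ _ _ _ hGS dGS.
- by lia.
- by [].
- move=> T T' sT T0 /orP[] h; apply/orP; [left; exact: (down_nR sT)|right].
  exact: (down_nc sT).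
- by [].
- by [].
- by move=> T h; rewrite /nR h.
- move=> T _; rewrite /nR /nc !negb_or !negbK => /andP[h1 h2].
  rewrite has_geD ?has_vD ?h1 ?h2 //; lia.
- move=> T _; rewrite /nR /nc !negb_or !negbK => /andP[h1 h2] _ _.
  left; split; first exact: quasicategory_inner.
  by apply: (inner_pivot_ord (F := 3) (i := c)) => //; lia.
have [|w hw] := plift_smor (phi := sidm (PN V)) hG1.
  by move=> n x; apply/dG1.
have w1 n (x : PN V n) : nR (supp x) ->
    w n x = act (dcomp (dmin L 2) (pn_ord L n x)) (q 2 s).
  by move=> h; apply: (pl_fun hG1 (hw _ _)); apply: sG1; left.
have w2 n (x : PN V n) : nc (supp x) ->
    w n x = v n (dcomp (dpred N.+2) (pn_ord L n x)).
  by move=> h; apply: (pl_fun hG1 (hw _ _)); apply: sG1; right.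
pose G n (x : PN V n) y := clause nR (dmin L 2) (sgraph s) x y \/
  clause nc (dpred N.+2) (hgraph u) x y.
exists w, G; split=> //.
- apply: plift_union.
  + apply: clause_plift => //; first exact: (sgraph_plift q).
    by move=> n x h; rewrite w1.
  + apply: clause_plift => //; first exact: (hgraph_plift huv).
    by move=> n x h; rewrite w2.
  + apply: tot_agree; first exact: (hgraph_plift huv).
    by exists (horn_first_edge N); split=> //; exact: dhom_eq.
- move=> n x; rewrite /tot_base; split.
    case=> y [[h _]|[h1 h2]]; first by rewrite -/(nR (supp x)) h.
    have /tot_dom_horn h3 : pdom (hgraph u) (dcomp (dpred N.+2) (pn_ord L n x)).
      by exists y.
    by rewrite h3 -/(nc (supp x)) h1 orbT.
  case/orP => [h|/andP[h1 /tot_dom_horn[y hy]]]; last by exists y; right.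
  by exists (act (dcomp (dmin L 2) (pn_ord L n x)) s); left.
- by move=> n x h; left.
- by move=> n x a h ea; right; split=> //; exists a.
Qed.

Lemma two_of_three_finish (w : smor (PN V) S) G (Q : pred {set V}) :
  plift q w G -> has_dom V X G Q ->
  (forall T, ~~ has_v c T -> Q T) ->
  (forall n (x : PN V n), nc (supp x) ->
      w n x = v n (dcomp (dpred N.+2) (pn_ord L n x))) ->
  (forall n (x : PN V n) a, nc (supp x) ->
      horn_incl ord0 n a = dcomp (dpred N.+2) (pn_ord L n x) -> G n x (u n a)) ->
  exists w : smor (Delta N.+2) X,
    (forall n a, w n (horn_incl (ord0 : 'I_N.+3) n a) = u n a) /\
    (forall n b, q n (w n b) = v n b).
Proof.
move=> hG dG hQ hw hGu.
have cL : c <= L by lia.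
pose phi : smor (Delta N.+2) (PN V) :=
  scomp (ord_pn L) (Delta_map (dface (inord c : 'I_N.+4))).
have nphi n a : nc (supp (phi n a)).
  apply/(has_vP _ cL) => -[i /= e]; move: e; rewrite /bump inordK; lia.
have ephi n (a : Delta N.+2 n) : dcomp (dpred N.+2) (pn_ord L n (phi n a)) = a.
  apply: dhom_eq => i; apply: val_inj; rewrite /= /bump inordK; lia.
have [|z hz] := plift_smor (phi := phi) hG.
  by move=> n a; apply/dG; apply: hQ; apply: nphi.
exists z; split=> n a.
  by apply: (pl_fun hG (hz _ _)); apply: hGu; rewrite ?ephi.
by rewrite (pl_over hG (hz n a)) hw // ephi.
Qed.

End TwoOfThree.

(** The sought simplex is the face opposite 1, supplied by the inner horn at 1 of the whole simplex.
    The faces missing 2 or a tail vertex are completed by left horns at 0 over [f], the face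
    opposite 0 by a left horn at 1 over [g]. *)
Lemma cocart_comp (X S : sset) (q : smor X S) (f g h : X 1) :
  inner_fibration q -> quasicategory S ->
  is_cocartesian q f -> is_cocartesian q g -> tri f g h -> is_cocartesian q h.
Proof.
move=> hq hS cf cg [s [s2 s0 s1]] N u v huv hu; rewrite -s1 in hu.
have c1 : 1 <= 1 by [].
have [w [G [hG dG hw hGs hGu]]] := two_of_three_setup c1 huv hu hq hS.
have L3 : 3 <= N.+3 by [].
pose Q1 : pred {set 'I_N.+4} := fun T =>
  [|| ~~ has_ge 3 T, miss_ge 3 T | ~~ has_v 1 T && ~~ has_v 2 T].
pose Q2 : pred {set 'I_N.+4} := fun T => [|| ~~ has_ge 3 T, miss_ge 3 T | ~~ has_v 2 T].
pose Q3 : pred {set 'I_N.+4} := fun T =>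
  [|| ~~ has_ge 3 T, miss_ge 3 T, ~~ has_v 2 T | ~~ has_v 0 T].
have d0 : downward (ordP N.+3) (tot_base (N := N) 1).
  move=> T T' sT _; rewrite /tot_base.
  move: (has_ge_sub 3 sT) (miss_ge_sub 3 sT) (has_v_sub 1 sT) (has_v_sub 2 sT).
  by case: (has_ge 3 T); case: (miss_ge 3 T); case: (has_v 1 T); case: (has_v 2 T);
    case: (has_ge 3 T'); case: (miss_ge 3 T'); case: (has_v 1 T'); case: (has_v 2 T').
have d1 : downward (ordP N.+3) Q1.
  move=> T T' sT _; rewrite /Q1.
  move: (has_ge_sub 3 sT) (miss_ge_sub 3 sT) (has_v_sub 1 sT) (has_v_sub 2 sT).
  by case: (has_ge 3 T); case: (miss_ge 3 T); case: (has_v 1 T); case: (has_v 2 T);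
    case: (has_ge 3 T'); case: (miss_ge 3 T'); case: (has_v 1 T'); case: (has_v 2 T').
have d2 : downward (ordP N.+3) Q2.
  move=> T T' sT _; rewrite /Q2.
  move: (has_ge_sub 3 sT) (miss_ge_sub 3 sT) (has_v_sub 2 sT).
  by case: (has_ge 3 T); case: (miss_ge 3 T); case: (has_v 2 T);
    case: (has_ge 3 T'); case: (miss_ge 3 T'); case: (has_v 2 T').
have d3 : downward (ordP N.+3) Q3.
  move=> T T' sT _; rewrite /Q3.
  move: (has_ge_sub 3 sT) (miss_ge_sub 3 sT) (has_v_sub 0 sT) (has_v_sub 2 sT).
  by case: (has_ge 3 T); case: (miss_ge 3 T); case: (has_v 0 T); case: (has_v 2 T);
    case: (has_ge 3 T'); case: (miss_ge 3 T'); case: (has_v 0 T'); case: (has_v 2 T').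
have [||||||||G1 [hG1 sG1 dG1]] :=
    front_stage (F := 3) (j := 0) (Q := Q1) _ _ _ _ _ _ _ hG dG => //.
- move=> T; rewrite /tot_base /Q1.
  by case: (has_ge 3 T); case: (miss_ge 3 T); case: (has_v 1 T); case: (has_v 2 T).
- by move=> T hT; rewrite /tot_base hT.
- move=> T; rewrite /tot_base /Q1 has_geU ?miss_geU ?has_geD ?miss_geD ?has_vU ?has_vD //=.
  by case: (has_ge 3 T); case: (miss_ge 3 T); case: (has_v 1 T); case: (has_v 2 T).
- move=> T QT PT RT T0; right.
  apply: (cocart_pivot_ord (F := 3) (i := 0) (j := 1) (f := f) (e := tot_edge N 2)) => //.
  + by rewrite tot_edge_vert.
  + by rewrite tot_edge_vert.
  + move: QT PT RT; rewrite /tot_base /Q1.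
    by case: (has_ge 3 T); case: (miss_ge 3 T); case: (has_v 1 T); case: (has_v 2 T).
  + by case.
  + by rewrite -s2; apply: tot_edge_val.
have [||||||||G2 [hG2 sG2 dG2]] :=
    front_stage (F := 3) (j := 0) (Q := Q2) _ _ _ _ _ _ _ hG1 dG1 => //.
- move=> T; rewrite /Q2 /Q1.
  by case: (has_ge 3 T); case: (miss_ge 3 T); case: (has_v 1 T); case: (has_v 2 T).
- by move=> T hT; rewrite /Q1 hT.
- move=> T; rewrite /Q2 /Q1 has_geU ?miss_geU ?has_geD ?miss_geD ?has_vU ?has_vD //=.
  by case: (has_ge 3 T); case: (miss_ge 3 T); case: (has_v 1 T); case: (has_v 2 T).
- move=> T QT PT RT T0; right.
  apply: (cocart_pivot_ord (F := 3) (i := 0) (j := 1) (f := f) (e := tot_edge N 2)) => //.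
  + by rewrite tot_edge_vert.
  + by rewrite tot_edge_vert.
  + move: QT PT RT; rewrite /Q2 /Q1.
    by case: (has_ge 3 T); case: (miss_ge 3 T); case: (has_v 1 T); case: (has_v 2 T).
  + by case.
  + by apply: sG1; rewrite -s2; apply: tot_edge_val.
have [||||||||G3 [hG3 sG3 dG3]] :=
    front_stage (F := 3) (j := 1) (Q := Q3) _ _ _ _ _ _ _ hG2 dG2 => //.
- move=> T; rewrite /Q3 /Q2.
  by case: (has_ge 3 T); case: (miss_ge 3 T); case: (has_v 2 T).
- by move=> T hT; rewrite /Q2 hT.
- move=> T; rewrite /Q3 /Q2 has_geU ?miss_geU ?has_geD ?miss_geD ?has_vU ?has_vD //=.
  by case: (has_ge 3 T); case: (miss_ge 3 T); case: (has_v 0 T); case: (has_v 2 T).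
- move=> T QT PT RT T1; right.
  apply: (cocart_pivot_ord (F := 3) (i := 1) (j := 2) (f := g) (e := tot_edge N 0)) => //.
  + by rewrite tot_edge_vert.
  + by rewrite tot_edge_vert.
  + move: QT PT RT; rewrite /Q3 /Q2.
    by case: (has_ge 3 T); case: (miss_ge 3 T); case: (has_v 2 T).
  + case=> [|[|l]] // _ _; move: QT PT RT; rewrite /Q3 /Q2.
    by case: (has_ge 3 T); case: (miss_ge 3 T); case: (has_v 2 T); case: (has_v 0 T).
  + by apply/sG2/sG1; rewrite -s0; apply: tot_edge_val.
have [||||||||G4 [hG4 sG4 dG4]] :=
    front_stage (F := 3) (j := 1) (Q := xpredT) _ _ _ _ _ _ _ hG3 dG3 => //.
- by move=> T hT; rewrite /Q3 hT.
- move=> T _; rewrite /Q3 has_geD ?miss_geD ?has_vD //=.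
- move=> T QT PT RT T1; left; split=> //.
  apply: (inner_pivot_ord2 (i := 0) (l := 2)) => //.
  + by move: PT; rewrite /Q3; case: (has_v 0 T); rewrite ?orbT.
  + by move: PT; rewrite /Q3; case: (has_v 2 T); rewrite ?orbT.
apply: (two_of_three_finish c1 hG4 dG4) => //.
by move=> n x a hx e; apply/sG4/sG3/sG2/sG1; apply: hGu.
Qed.

(** The sought simplex is the face opposite 0, supplied by the left horn at 0 over [f]. The face
    opposite 1 comes from a left horn at 0 over [h], and the faces missing 2 or a tail vertex are
    completed by inner horns at 1. *)
Lemma cocart_cancel (X S : sset) (q : smor X S) (f g h : X 1) :
  inner_fibration q -> quasicategory S ->
  is_cocartesian q f -> is_cocartesian q h -> tri f g h -> is_cocartesian q g.
Proof.
move=> hq hS cf ch [s [s2 s0 s1]] N u v huv hu; rewrite -s0 in hu.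
have c0 : 0 <= 1 by [].
have [w [G [hG dG hw hGs hGu]]] := two_of_three_setup c0 huv hu hq hS.
have L3 : 3 <= N.+3 by [].
pose Q1 : pred {set 'I_N.+4} := fun T => [|| ~~ has_ge 3 T, miss_ge 3 T | ~~ has_v 2 T].
pose Q2 : pred {set 'I_N.+4} := fun T =>
  [|| ~~ has_ge 3 T, miss_ge 3 T, ~~ has_v 2 T | ~~ has_v 1 T].
have d0 : downward (ordP N.+3) (tot_base (N := N) 0).
  move=> T T' sT _; rewrite /tot_base.
  move: (has_ge_sub 3 sT) (miss_ge_sub 3 sT) (has_v_sub 0 sT) (has_v_sub 2 sT).
  by case: (has_ge 3 T); case: (miss_ge 3 T); case: (has_v 0 T); case: (has_v 2 T);
    case: (has_ge 3 T'); case: (miss_ge 3 T'); case: (has_v 0 T'); case: (has_v 2 T').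
have d1 : downward (ordP N.+3) Q1.
  move=> T T' sT _; rewrite /Q1.
  move: (has_ge_sub 3 sT) (miss_ge_sub 3 sT) (has_v_sub 2 sT).
  by case: (has_ge 3 T); case: (miss_ge 3 T); case: (has_v 2 T);
    case: (has_ge 3 T'); case: (miss_ge 3 T'); case: (has_v 2 T').
have d2 : downward (ordP N.+3) Q2.
  move=> T T' sT _; rewrite /Q2.
  move: (has_ge_sub 3 sT) (miss_ge_sub 3 sT) (has_v_sub 1 sT) (has_v_sub 2 sT).
  by case: (has_ge 3 T); case: (miss_ge 3 T); case: (has_v 1 T); case: (has_v 2 T);
    case: (has_ge 3 T'); case: (miss_ge 3 T'); case: (has_v 1 T'); case: (has_v 2 T').
have [||||||||G1 [hG1 sG1 dG1]] :=
    front_stage (F := 3) (j := 1) (Q := Q1) _ _ _ _ _ _ _ hG dG => //.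
- move=> T; rewrite /tot_base /Q1.
  by case: (has_ge 3 T); case: (miss_ge 3 T); case: (has_v 0 T); case: (has_v 2 T).
- by move=> T hT; rewrite /tot_base hT.
- move=> T; rewrite /tot_base /Q1 has_geU ?miss_geU ?has_geD ?miss_geD ?has_vU ?has_vD //=.
  by case: (has_ge 3 T); case: (miss_ge 3 T); case: (has_v 0 T); case: (has_v 2 T).
- move=> T QT PT RT T0; left; split=> //.
  apply: (inner_pivot_ord (F := 3) (i := 0)) => //.
  move: QT PT; rewrite /tot_base /Q1.
  by case: (has_ge 3 T); case: (miss_ge 3 T); case: (has_v 0 T); case: (has_v 2 T).
have [||||||||G2 [hG2 sG2 dG2]] :=
    front_stage (F := 3) (j := 0) (Q := Q2) _ _ _ _ _ _ _ hG1 dG1 => //.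
- move=> T; rewrite /Q2 /Q1.
  by case: (has_ge 3 T); case: (miss_ge 3 T); case: (has_v 2 T).
- by move=> T hT; rewrite /Q1 hT.
- move=> T; rewrite /Q2 /Q1 has_geU ?miss_geU ?has_geD ?miss_geD ?has_vU ?has_vD //=.
  by case: (has_ge 3 T); case: (miss_ge 3 T); case: (has_v 1 T); case: (has_v 2 T).
- move=> T QT PT RT T0; right.
  apply: (cocart_pivot_ord (F := 3) (i := 0) (j := 2) (f := h) (e := tot_edge N 1)) => //.
  + by rewrite tot_edge_vert.
  + by rewrite tot_edge_vert.
  + move: PT; rewrite /Q1.
    by case: (has_ge 3 T); case: (miss_ge 3 T); case: (has_v 2 T).
  + case=> [|[|l]] // _ _; move: QT PT RT; rewrite /Q2 /Q1.
    by case: (has_ge 3 T); case: (miss_ge 3 T); case: (has_v 2 T); case: (has_v 1 T).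
  + by apply/sG1; rewrite -s1; apply: tot_edge_val.
have [||||||||G3 [hG3 sG3 dG3]] :=
    front_stage (F := 3) (j := 0) (Q := xpredT) _ _ _ _ _ _ _ hG2 dG2 => //.
- by move=> T hT; rewrite /Q2 hT.
- move=> T _; rewrite /Q2 has_geD ?miss_geD ?has_vD //=.
- move=> T QT PT RT T0; right.
  apply: (cocart_pivot_ord (F := 3) (i := 0) (j := 1) (f := f) (e := tot_edge N 2)) => //.
  + by rewrite tot_edge_vert.
  + by rewrite tot_edge_vert.
  + by move: PT; rewrite /Q2; case: (has_v 1 T); rewrite ?orbT.
  + by case.
  + by apply/sG2/sG1; rewrite -s2; apply: tot_edge_val.
apply: (two_of_three_finish c0 hG3 dG3) => //.
by move=> n x a hx e; apply/sG3/sG2/sG1; apply: hGu.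
Qed.

(** * Equivalences are cocartesian *)

(** In values: [dsub2] is 0,0,0,1,2,3,...; [dsub2max] is 1,1,1,1,2,3,...; [dtail1] is 1,1,4,5,...;
    [dtail13] is 1,3,4,5,... and [dtail03] is 0,3,4,5,.... The first two read the large simplex in
    the one to be filled, the others go back. *)
Definition dsub2 N : dhom N.+4 N.+2 :=
  dnat (L := N.+4) (M := N.+2) (g := fun i => i - 2)
    ltac:(by move=> x y; lia) ltac:(by move=> x; lia).

Definition dsub2max N : dhom N.+4 N.+2 :=
  dnat (L := N.+4) (M := N.+2) (g := fun i => maxn 1 (i - 2))
    ltac:(by move=> x y; lia) ltac:(by move=> x; lia).

Definition dtail1 N : dhom N.+2 N.+4 :=
  dnat (L := N.+2) (M := N.+4) (g := fun i => i.-1 + 1 + (1 < i) * 2)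
    ltac:(by move=> x y; lia) ltac:(by move=> x; lia).

Definition dtail13 N : dhom N.+2 N.+4 :=
  dnat (L := N.+2) (M := N.+4) (g := fun i => i + 1 + (0 < i))
    ltac:(by move=> x y; lia) ltac:(by move=> x; lia).

Definition dtail03 N : dhom N.+2 N.+4 :=
  dnat (L := N.+2) (M := N.+4) (g := fun i => i + (0 < i) * 2)
    ltac:(by move=> x y; lia) ltac:(by move=> x; lia).

(* A 3-simplex x -> y -> x -> y whose edges 0 -> 2 and 1 -> 3 are identities and
   whose face 023 is degenerate on e. *)
Lemma equiv_edge_simplex (X : sset) (e : X 1) : quasicategory X ->
  is_equiv_edge e -> exists z : X 3,
    face 1 z = act (dstep 2 2) e /\ face 1 (face 0 z) = degen 1 (tgt e).
Proof.
move=> hX /equiv_edgeE[e' [[s [s2 s0 s1]] [t [t2 t0 t1]]]].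
pose y (j : nat) := if j == 0 then t else if j == 1 then act (dstep 2 2) e else s.
have [|||z hz] := @fill_tetrahedron X hX (inord 2) y; rewrite ?inordK //.
  move=> [|[|[|[|i]]]] [|[|[|[|j]]]] // _ _ _ _; rewrite /y /= ?face_dstep //=.
  - by rewrite act_dstep1 t0.
  - by rewrite s0 t2.
  - by rewrite s1 act_dstepn.
by exists z; rewrite !hz ?inordK // /y /= t1.
Qed.

(* In Delta (N+4) the vertices 0, ..., 3 carry the 3-simplex [z], and the remaining
   ones those of the horn from its vertex 2 on.  The horn is put on the simplices
   which avoid 1 (0 and 2 being identified) and on those which avoid 0 and 2 (where
   1 and 3 are identified, hence through a degeneracy); the filler is read off on the
   simplices which avoid 1 and 2. *)
Section EquivEdgeHorn.
Context (N : nat).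
Let L := N.+4.
Let V := ordP L.

Let nR : pred {set 'I_L.+1} := fun T => ~~ has_ge 4 T.
Let n1 : pred {set 'I_L.+1} := fun T => ~~ has_v 1 T.
Let n02 : pred {set 'I_L.+1} := fun T => ~~ has_v 0 T && ~~ has_v 2 T.

Lemma sp_nR n (x : PN V n) : nR (supp x) -> forall i, x i <= 3.
Proof.
by move=> /has_geP hx i; rewrite leqNgt; apply/negP => h; apply: hx; exists i.
Qed.

Lemma sp_nv k n (x : PN V n) : k <= L -> ~~ has_v k (supp x) ->
  forall i, x i != k :> nat.
Proof. by move=> kL /(has_vP _ kL) h i; apply/negP => /eqP e; apply: h; exists i. Qed.

Lemma sp_n02 n (x : PN V n) : n02 (supp x) -> forall i, x i != 0 :> nat /\ x i != 2 :> nat.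
Proof. by move=> /andP[h0 h2] i; split; apply: sp_nv. Qed.

Section Values.
Context (Y : sset) (z : Y 3) (e : Y 1).
Hypotheses (z1 : face 1 z = act (dstep 2 2) e)
  (z2 : face 1 (face 0 z) = degen 1 (tgt e)).

Lemma sp_val023 n (x : PN V n) : nR (supp x) -> n1 (supp x) ->
  act (dcomp (dmin L 3) (pn_ord L n x)) z =
  act (dcomp (dstep N.+2 1) (dcomp (dsub2 N) (pn_ord L n x))) e.
Proof.
move=> /sp_nR hR /(sp_nv (isT : 1 <= L)) h1.
have hm (m : nat) : m <= 3 -> m != 1 -> minn m 3 != 1 by lia.
have [|g eg] := @dcomp_face n 2 (dcomp (dmin L 3) (pn_ord L n x)) (inord 1).
  by move=> i; rewrite -val_eqE /= inordK //; apply: hm; [apply: hR|apply: h1].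
rewrite eg -act_act -[act (dface _) z]/(face 1 z) z1 act_act.
apply: act_congr => i /=; congr (if _ then _ else _).
have eg' : minn (x i) 3 = bump 1 (g i).
  have := congr1 (fun f : dhom n 3 => val (f i)) eg; rewrite /= => ->.
  by rewrite inordK.
have hm2 (m k : nat) : m <= 3 -> m != 1 -> minn m 3 = bump 1 k ->
    (k < 2) = (m - 2 < 1) by rewrite /bump; lia.
exact: hm2 (hR i) (h1 i) eg'.
Qed.

Lemma sp_val13 n (x : PN V n) : nR (supp x) -> n02 (supp x) ->
  act (dcomp (dmin L 3) (pn_ord L n x)) z = degen n (tgt e).
Proof.
move=> /sp_nR hR /sp_n02 h02.
have hm (m : nat) : m <= 3 -> m != 0 -> m != 2 -> minn m 3 != 0 by lia.
have [|g eg] := @dcomp_face n 2 (dcomp (dmin L 3) (pn_ord L n x)) (inord 0).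
  by move=> i; have [h0 h2] := h02 i; rewrite -val_eqE /= inordK //; apply: hm => //; apply: hR.
have eg' i : minn (x i) 3 = bump 0 (g i).
  have := congr1 (fun f : dhom n 3 => val (f i)) eg; rewrite /= => ->.
  by rewrite inordK.
have [|g' eg2] := @dcomp_face n 1 g (inord 1).
  move=> i; have [h0 h2] := h02 i; rewrite -val_eqE /= inordK //.
  have hm2 (m k : nat) : m <= 3 -> m != 0 -> m != 2 -> minn m 3 = bump 0 k -> k != 1.
    by rewrite /bump; lia.
  exact: hm2 (hR i) h0 h2 (eg' i).
rewrite eg -act_act eg2 -act_act -[act _ (act _ z)]/(face 1 (face 0 z)) z2.
exact: act_degen.
Qed.

Context (S' : sset) (q' : smor Y S') (v' : smor (Delta N.+2) S').
Context (H : forall n, Delta N.+2 n -> Y n -> Prop) (hH : plift q' v' H).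
Hypothesis He : H (@dedge N.+2 ord0 (inord 1) (leq0n _)) e.

(** The clauses are [z] on the front, the horn on chains avoiding 1, and the horn again on chains
    avoiding 0 and 2. [C] restricts the last one: by nothing for the base, where all of [v] is
    given, and to chains missing a tail vertex upstairs, where only a horn is. *)
Definition sp_rel (C : pred {set 'I_L.+1}) n (x : PN V n) (y : Y n) : Prop :=
  (clause nR (dmin L 3) (sgraph z) x y \/ clause n1 (dsub2 N) H x y) \/
  clause (fun T => n02 T && C T) (dsub2max N) H x y.

Let down_nR : downward V nR.
Proof.
move=> T T' sT _; rewrite /nR; move: (has_ge_sub 4 sT).
by case: (has_ge 4 T); case: (has_ge 4 T').
Qed.

Let down_n1 : downward V n1.
Proof.
move=> T T' sT _; rewrite /n1; move: (has_v_sub 1 sT).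
by case: (has_v 1 T); case: (has_v 1 T').
Qed.

Let down_n02 : downward V n02.
Proof.
move=> T T' sT _; rewrite /n02; move: (has_v_sub 0 sT) (has_v_sub 2 sT).
by case: (has_v 0 T); case: (has_v 0 T'); case: (has_v 2 T); case: (has_v 2 T').
Qed.

Lemma sp_plift C (w : smor (PN V) S') : downward V C ->
  (forall n (x : PN V n), nR (supp x) ->
     act (dcomp (dmin L 3) (pn_ord L n x)) (q' 3 z) = w n x) ->
  (forall n (x : PN V n), n1 (supp x) ->
     v' n (dcomp (dsub2 N) (pn_ord L n x)) = w n x) ->
  (forall n (x : PN V n), n02 (supp x) ->
     v' n (dcomp (dsub2max N) (pn_ord L n x)) = w n x) ->
  plift q' w (sp_rel C).
Proof.
move=> dC w1 w2 w3; apply: plift_union; first apply: plift_union.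
- exact: (clause_plift (vM := ymap (q' 3 z)) down_nR (sgraph_plift q' z) w1).
- exact: (clause_plift down_n1 hH w2).
- move=> n x y y' [xR ->] [x1 Hy'].
  rewrite sp_val023 // (plift_edge01 hH He _ Hy') // => i.
  have hm (m : nat) : m <= 3 -> m - 2 <= 1 by lia.
  exact: hm (sp_nR xR i).
- apply: (clause_plift _ hH).
    move=> T T' sT T0 /andP[h1 h2]; rewrite (down_n02 sT T0 h1).
    exact: dC sT T0 h2.
  by move=> n x /andP[h _]; apply: w3.
- move=> n x y y' [[xR ->]|[x1 Hy]] [/andP[x02 _] Hy'].
    have hm (m : nat) : m <= 3 -> maxn 1 (m - 2) = 1 by lia.
    have h1 i : maxn 1 (x i - 2) = 1 := hm _ (sp_nR xR i).
    rewrite sp_val13 // (plift_edge01 hH He _ Hy'); last by move=> i; rewrite /= h1.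
    by rewrite -act_dstep0; apply: act_congr => i /=; rewrite h1.
  apply: (pl_fun hH Hy).
  suff -> : dcomp (dsub2 N) (pn_ord L n x) = dcomp (dsub2max N) (pn_ord L n x) by [].
  apply: dhom_eq => i; apply: val_inj => /=.
  have hm (m : nat) : m != 0 -> m != 1 -> m != 2 -> m - 2 = maxn 1 (m - 2) by lia.
  by have [h0 h2] := sp_n02 x02 i; apply: hm => //; apply: (sp_nv _ x1).
Qed.
End Values.

Context (X S : sset) (q : smor X S) (e : X 1) (z : X 3).
Hypotheses (z1 : face 1 z = act (dstep 2 2) e)
  (z2 : face 1 (face 0 z) = degen 1 (tgt e)).
Context (u : smor (horn (ord0 : 'I_N.+3)) X) (v : smor (Delta N.+2) S).
Hypothesis huv : forall n a, q n (u n a) = v n (horn_incl (ord0 : 'I_N.+3) n a).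
Hypothesis hu : u 1 (horn_first_edge N) = e.
Hypotheses (hq : inner_fibration q) (hS : quasicategory S).

(** The three clauses agree on overlaps in [S]; every chain not covered by them contains 1 and meets
    the tail, so it is reached by inner horns at 3. *)
Lemma sp_base : exists w : smor (PN V) S,
  [/\ forall n (x : PN V n), nR (supp x) ->
        act (dcomp (dmin L 3) (pn_ord L n x)) (q 3 z) = w n x,
      forall n (x : PN V n), n1 (supp x) ->
        v n (dcomp (dsub2 N) (pn_ord L n x)) = w n x &
      forall n (x : PN V n), n02 (supp x) ->
        v n (dcomp (dsub2max N) (pn_ord L n x)) = w n x].
Proof.
have hG : plift (to_pt S) (to_pt (PN V))
    (sp_rel (q 3 z) (mgraph v) xpredT).
  apply: (@sp_plift S (q 3 z) (q 1 e) _ _ pt (to_pt S) (scomp (to_pt S) v)) => //.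
  - by rewrite -snat_face z1 snat.
  - by rewrite -!snat_face z2 smor_degen smor_tgt.
  - exact: mgraph_plift.
  - by rewrite -hu huv; congr (v _ _); exact: dhom_eq.
pose P : pred {set 'I_L.+1} := fun T => [|| nR T, n1 T | n02 T].
have dG : has_dom V S (sp_rel (q 3 z) (mgraph v) xpredT) P.
  move=> n x; rewrite /P; split.
    by case=> y [[[-> _]|[-> _]]|[/andP[-> _] _]]; rewrite ?orbT.
  case/or3P => h.
  - by exists (act (dcomp (dmin L 3) (pn_ord L n x)) (q 3 z)); left; left.
  - by exists (v n (dcomp (dsub2 N) (pn_ord L n x))); left; right.
  - exists (v n (dcomp (dsub2max N) (pn_ord L n x))); right; split=> //.
    by rewrite h.
have [||||||||G1 [hG1 sG1 dG1]] :=
    front_stage (F := 4) (j := 3) (Q := xpredT) _ _ _ _ _ _ _ hG dG => //.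
- move=> T T' sT _; rewrite /P /nR /n1 /n02.
  move: (has_ge_sub 4 sT) (has_v_sub 0 sT) (has_v_sub 1 sT) (has_v_sub 2 sT).
  by case: (has_ge 4 T); case: (has_v 0 T); case: (has_v 1 T); case: (has_v 2 T);
    case: (has_ge 4 T'); case: (has_v 0 T'); case: (has_v 1 T'); case: (has_v 2 T').
- by move=> T hT; rewrite /P /nR hT.
- move=> T _; rewrite /P /nR /n1 /n02 has_geD ?has_vD //=.
- move=> T _ PT RT _; left; split; first exact: quasicategory_inner.
  apply: (inner_pivot_ord (F := 4) (i := 1)) => //.
  by move: PT; rewrite /P /n1; case: (has_v 1 T); rewrite ?orbT.
have [|w hw] := plift_smor (phi := sidm (PN V)) hG1.
  by move=> n x; apply/dG1.
exists w; split=> n x h; apply: (pl_fun hG1 _ (hw _ _)); apply: sG1.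
- by left; left.
- by left; right.
- by right; split; rewrite ?h.
Qed.

Lemma sp_dom2 n (x : PN V n) : miss_ge 4 (supp x) || ~~ has_v 3 (supp x) <->
  pdom (hgraph u) (dcomp (dsub2 N) (pn_ord L n x)).
Proof.
have L3 : 3 <= L by [].
split; last first.
  case=> y [[a ha] [/= ea _]]; have /hornP[j j0 aj] := ha.
  have hj (i : 'I_n.+1) : x i - 2 != j.
    by have := aj i; rewrite ea -val_eqE.
  have [ej|ne] := eqVneq (j : nat) 1.
    apply/orP; right; apply/(has_vP _ L3) => -[i ei].
    by have := hj i; rewrite ei ej.
  apply/orP; left; apply/miss_geP.
  have j0' : j != 0 :> nat by move: j0; rewrite -val_eqE.
  have jL : j.+2 < L.+1 by have := ltn_ord j; rewrite /L; lia.
  exists (Ordinal jL); split; first by rewrite /=; lia.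
  by move=> i; apply/negP => /eqP ei; have := hj i; rewrite ei /= subSS subSS subn0 eqxx.
move=> h; have [j jL [j1 hj]] : exists2 j, j < L.+1 &
    2 < j /\ forall i, x i != j :> nat.
  case/orP: h => [/miss_geP[r [r3 hr]]|/(has_vP _ L3) h2].
    by exists r; rewrite ?ltn_ord //; split=> //; lia.
  exists 3 => //; split=> // i; apply/negP => /eqP ei; apply: h2; by exists i.
have jp : j - 2 < N.+3 by rewrite /L in jL; lia.
have ha : [exists i : 'I_N.+3, (i != ord0) &&
    [forall l, dcomp (dsub2 N) (pn_ord L n x) l != i]].
  apply/hornP; exists (Ordinal jp); first by rewrite -val_eqE /=; lia.
  have hm (m : nat) : m != j -> m - 2 != j - 2 by lia.
  by move=> i; rewrite -val_eqE; apply: hm (hj i).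
pose a : horn (ord0 : 'I_N.+3) n := exist _ (dcomp (dsub2 N) (pn_ord L n x)) ha.
by exists (u n a), a.
Qed.

Lemma sp_dom3 n (x : PN V n) : miss_ge 4 (supp x) ->
  pdom (hgraph u) (dcomp (dsub2max N) (pn_ord L n x)).
Proof.
move=> /miss_geP[r [r4 hr]].
have jp : r - 2 < N.+3 by have := ltn_ord r; rewrite /L; lia.
have ha : [exists i : 'I_N.+3, (i != ord0) &&
    [forall l, dcomp (dsub2max N) (pn_ord L n x) l != i]].
  apply/hornP; exists (Ordinal jp); first by rewrite -val_eqE /=; lia.
  have hm (m : nat) : m != r -> maxn 1 (m - 2) != r - 2 by lia.
  by move=> i; rewrite -val_eqE; apply: hm; have := hr i; rewrite -val_eqE.
pose a : horn (ord0 : 'I_N.+3) n := exist _ (dcomp (dsub2max N) (pn_ord L n x)) ha.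
by exists (u n a), a.
Qed.

Definition sp_dom : pred {set 'I_L.+1} := fun T =>
  [|| nR T, n1 T && (miss_ge 4 T || ~~ has_v 3 T) | n02 T && miss_ge 4 T].

Lemma sp_start (w : smor (PN V) S) :
  (forall n (x : PN V n), nR (supp x) ->
     act (dcomp (dmin L 3) (pn_ord L n x)) (q 3 z) = w n x) ->
  (forall n (x : PN V n), n1 (supp x) ->
     v n (dcomp (dsub2 N) (pn_ord L n x)) = w n x) ->
  (forall n (x : PN V n), n02 (supp x) ->
     v n (dcomp (dsub2max N) (pn_ord L n x)) = w n x) ->
  plift q w (sp_rel z (hgraph u) (miss_ge 4)) /\
  has_dom V X (sp_rel z (hgraph u) (miss_ge 4)) sp_dom.
Proof.
move=> w1 w2 w3; split.
  apply: (@sp_plift X z e z1 z2 S q v) => //.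
  - exact: hgraph_plift.
  - by exists (horn_first_edge N); split=> //; exact: dhom_eq.
  - by move=> T T' sT _; apply/implyP/miss_ge_sub.
move=> n x; rewrite /sp_dom; split.
  case=> y [[[-> _]|[h1 h2]]|[h1 h2]] //.
    have -> : miss_ge 4 (supp x) || ~~ has_v 3 (supp x) by apply/sp_dom2; exists y.
    by rewrite h1 /= orbT.
  by rewrite h1 !orbT.
case/or3P => [h|/andP[h1 /sp_dom2[y hy]]|h].
- by exists (act (dcomp (dmin L 3) (pn_ord L n x)) z); left; left.
- by exists y; left; right.
- by have /andP[_ /sp_dom3[y hy]] := h; exists y; right.
Qed.

(** No horn is filled. As the edge from 1 to 3 is degenerate, the simplex on 1, 3 and the tail may
    be taken to be the degeneration, along [psi], of the one on 1 and the tail, which is already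
    covered. Only agreement with the values assigned before has to be checked. *)
Lemma sp_attach (w : smor (PN V) S) G (Q : pred {set V}) :
  (forall n (x : PN V n), n02 (supp x) ->
     v n (dcomp (dsub2max N) (pn_ord L n x)) = w n x) ->
  (forall T, Q T = [|| ~~ has_ge 4 T, miss_ge 4 T | ~~ has_v 3 T]) ->
  plift q w G -> has_dom V X G Q ->
  (forall n x y, sp_rel z (hgraph u) (miss_ge 4) x y -> G n x y) ->
  extends_to q w G (fun T => Q T || n02 T).
Proof.
move=> hw hQ hG dG hsub.
pose phi : smor (Delta N.+2) (PN V) := scomp (ord_pn L) (Delta_map (dtail13 N)).
pose psi : smor (Delta N.+2) (PN V) := scomp (ord_pn L) (Delta_map (dtail1 N)).
have phi02 n a : n02 (supp (phi n a)).
  by apply/andP; split; apply/has_vP => // -[i /=]; lia.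
have psi02 n a : n02 (supp (psi n a)).
  by apply/andP; split; apply/has_vP => // -[i /=]; lia.
have psi3 n a : ~~ has_v 3 (supp (psi n a)).
  by apply/has_vP => // -[i /=]; lia.
have ephi n (a : Delta N.+2 n) :
    dcomp (dsub2max N) (pn_ord L n (phi n a)) = dcomp (dsub2max N) (pn_ord L n (psi n a)).
  by apply: dhom_eq => i; apply: val_inj => /=; lia.
have [|w' hw'] := plift_smor (phi := psi) hG.
  by move=> n a; apply/dG; rewrite hQ psi3 !orbT.
(* Agreement has three reasons: both values are constant on the front, both come from one simplex of
   the horn through [dsub2max], or [phi] and [psi] coincide. *)
have key n (a : Delta N.+2 n) y : G n (phi n a) y -> w' n a = y.
  move=> hy; have /dG : pdom G (phi n a) by exists y.
  rewrite hQ; case/or3P => h.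
  - have hR : nR (supp (psi n a)).
      apply/has_geP => -[i hi]; move/has_geP: h; apply; exists i; move: hi => /=; lia.
    have e1 := hsub n _ _ (or_introl (or_introl (conj h erefl))).
    have e2 := hsub n _ _ (or_introl (or_introl (conj hR erefl))).
    rewrite (pl_fun hG hy e1) (pl_fun hG (hw' n a) e2).
    by rewrite !(sp_val13 z2).
  - have hm : miss_ge 4 (supp (psi n a)).
      move/miss_geP: h => [r [r4 hr]]; apply/miss_geP; exists r; split=> // i.
      by have := hr i; rewrite -!val_eqE /=; lia.
    have [y0 hy0] := sp_dom3 hm.
    have e2 := hsub n (psi n a) y0 (or_intror (conj (introT andP (conj (psi02 _ _) hm)) hy0)).
    rewrite -ephi in hy0.
    have e1 := hsub n (phi n a) y0 (or_intror (conj (introT andP (conj (phi02 _ _) h)) hy0)).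
    by rewrite (pl_fun hG hy e1) (pl_fun hG (hw' n a) e2).
  - apply: (pl_fun hG (hw' n a)).
    suff -> : psi n a = phi n a by [].
    apply: chain_eq => i; apply: val_inj => /=.
    have h' := sp_nv (isT : 3 <= L) h i; move: h' => /=; lia.
pose A := subsset (X := Delta N.+2) (P := fun n d => pdom G (phi n d))
  (fun m n f d h => eq_ind_r (fun b => pdom G b) (pdom_act hG f h) (snat phi f d)).
have [||||G' [hG' GG' dG']] := @attach_lift A (Delta N.+2) _ X S (subsset_incl _) q w G phi hG.
- by move=> n a; apply: (svalP a).
- by move=> n d hd; exists (exist _ d hd).
- move=> n d d' ed; right; apply: dhom_eq => i; apply: val_inj.
  have := congr1 (fun x : PN V n => val (x i)) ed; rewrite /=; lia.
- move=> u' hu'; exists w'; split; first by move=> n a; apply: key (hu' n a).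
  by move=> n d; rewrite (pl_over hG (hw' n d)) -!hw // ephi.
exists G'; split=> // n b; rewrite dG'; split.
  by case=> [/dG ->//|[d ->]]; rewrite phi02 orbT.
case/orP => [/dG h|h]; [by left|right].
exists (dcomp (dsub2 N) (pn_ord L n b)); apply: chain_eq => i; apply: val_inj => /=.
have [h0 h2] := sp_n02 h i.
have hm (m : nat) : m != 0 -> m != 2 -> m = m - 2 + 1 + (0 < m - 2) by lia.
exact: hm.
Qed.

(** The sought simplex on 0, 3 and the tail is the missing face of an inner horn at 1. Its face on
    1, 3 and the tail comes from [sp_attach], the one on 0, 1 and the tail from an inner horn at 2;
    chains missing a tail vertex are given or come from inner horns at 3. *)
Lemma equiv_edge_horn : exists w : smor (Delta N.+2) X,
    (forall n a, w n (horn_incl (ord0 : 'I_N.+3) n a) = u n a) /\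
    (forall n b, q n (w n b) = v n b).
Proof.
have [w [w1 w2 w3]] := sp_base.
have [hG dG] := sp_start w1 w2 w3.
pose Q1 : pred {set 'I_L.+1} := fun T =>
  [|| ~~ has_ge 4 T, miss_ge 4 T | ~~ has_v 1 T && ~~ has_v 3 T].
pose Q2 : pred {set 'I_L.+1} := fun T => [|| ~~ has_ge 4 T, miss_ge 4 T | ~~ has_v 3 T].
pose Q4 : pred {set 'I_L.+1} := fun T =>
  [|| ~~ has_ge 4 T, miss_ge 4 T, ~~ has_v 3 T | ~~ has_v 2 T].
have d0 : downward V sp_dom.
  move=> T T' sT _; rewrite /sp_dom /nR /n1 /n02.
  move: (has_ge_sub 4 sT) (miss_ge_sub 4 sT) (has_v_sub 0 sT) (has_v_sub 1 sT)
    (has_v_sub 2 sT) (has_v_sub 3 sT).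
  case: (has_ge 4 T); case: (miss_ge 4 T); case: (has_v 0 T); case: (has_v 1 T);
    case: (has_v 2 T); case: (has_v 3 T) => //;
  by case: (has_ge 4 T'); case: (miss_ge 4 T'); case: (has_v 0 T'); case: (has_v 1 T');
    case: (has_v 2 T'); case: (has_v 3 T').
have d1 : downward V Q1.
  move=> T T' sT _; rewrite /Q1.
  move: (has_ge_sub 4 sT) (miss_ge_sub 4 sT) (has_v_sub 1 sT) (has_v_sub 3 sT).
  by case: (has_ge 4 T); case: (miss_ge 4 T); case: (has_v 1 T); case: (has_v 3 T);
    case: (has_ge 4 T'); case: (miss_ge 4 T'); case: (has_v 1 T'); case: (has_v 3 T').
have d2 : downward V Q2.
  move=> T T' sT _; rewrite /Q2.
  move: (has_ge_sub 4 sT) (miss_ge_sub 4 sT) (has_v_sub 3 sT).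
  by case: (has_ge 4 T); case: (miss_ge 4 T); case: (has_v 3 T);
    case: (has_ge 4 T'); case: (miss_ge 4 T'); case: (has_v 3 T').
have d3 : downward V (fun T => Q2 T || n02 T).
  move=> T T' sT _; rewrite /Q2 /n02.
  move: (has_ge_sub 4 sT) (miss_ge_sub 4 sT) (has_v_sub 3 sT) (has_v_sub 0 sT) (has_v_sub 2 sT).
  by case: (has_ge 4 T); case: (miss_ge 4 T); case: (has_v 3 T); case: (has_v 0 T);
    case: (has_v 2 T); case: (has_ge 4 T'); case: (miss_ge 4 T'); case: (has_v 3 T');
    case: (has_v 0 T'); case: (has_v 2 T').
have d4 : downward V Q4.
  move=> T T' sT _; rewrite /Q4.
  move: (has_ge_sub 4 sT) (miss_ge_sub 4 sT) (has_v_sub 2 sT) (has_v_sub 3 sT).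
  by case: (has_ge 4 T); case: (miss_ge 4 T); case: (has_v 2 T); case: (has_v 3 T);
    case: (has_ge 4 T'); case: (miss_ge 4 T'); case: (has_v 2 T'); case: (has_v 3 T').
have [||||||||G1 [hG1 sG1 dG1]] :=
    front_stage (F := 4) (j := 3) (Q := Q1) _ _ _ _ _ _ _ hG dG => //.
- move=> T; rewrite /sp_dom /Q1 /nR /n1 /n02.
  by case: (has_ge 4 T); case: (miss_ge 4 T); case: (has_v 1 T); case: (has_v 3 T);
    rewrite ?andbF.
- by move=> T hT; rewrite /sp_dom /nR hT.
- move=> T; rewrite /sp_dom /Q1 /nR /n1 /n02 has_geU ?miss_geU ?has_geD ?miss_geD ?has_vU ?has_vD //=.
  by case: (has_ge 4 T); case: (miss_ge 4 T); case: (has_v 1 T); case: (has_v 3 T);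
    case: (has_v 0 T); case: (has_v 2 T).
- move=> T QT PT RT T0; left; split=> //.
  apply: (inner_pivot_ord (F := 4) (i := 1)) => //.
  move: QT PT; rewrite /sp_dom /Q1 /nR /n1 /n02.
  by case: (has_ge 4 T); case: (miss_ge 4 T); case: (has_v 1 T); case: (has_v 3 T).
have [||||||||G2 [hG2 sG2 dG2]] :=
    front_stage (F := 4) (j := 2) (Q := Q2) _ _ _ _ _ _ _ hG1 dG1 => //.
- move=> T; rewrite /Q2 /Q1.
  by case: (has_ge 4 T); case: (miss_ge 4 T); case: (has_v 1 T); case: (has_v 3 T).
- by move=> T hT; rewrite /Q1 hT.
- move=> T; rewrite /Q2 /Q1 has_geU ?miss_geU ?has_geD ?miss_geD ?has_vU ?has_vD //=.
  by case: (has_ge 4 T); case: (miss_ge 4 T); case: (has_v 1 T); case: (has_v 3 T).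
- move=> T QT PT RT T0; left; split=> //.
  apply: (inner_pivot_ord (F := 4) (i := 1)) => //.
  move: QT PT; rewrite /Q2 /Q1.
  by case: (has_ge 4 T); case: (miss_ge 4 T); case: (has_v 1 T); case: (has_v 3 T).
have [|G3 [hG3 sG3 dG3]] := sp_attach w3 (fun T => erefl (Q2 T)) hG2 dG2.
  by move=> n x y h; apply/sG2/sG1.
have [||||||||G4 [hG4 sG4 dG4]] :=
    front_stage (F := 4) (j := 1) (Q := Q4) _ _ _ _ _ _ _ hG3 dG3 => //.
- move=> T; rewrite /Q4 /Q2 /n02.
  by case: (has_ge 4 T); case: (miss_ge 4 T); case: (has_v 0 T); case: (has_v 3 T);
    case: (has_v 2 T).
- by move=> T hT; rewrite /Q2 hT.
- move=> T; rewrite /Q4 /Q2 /n02 has_geU ?miss_geU ?has_geD ?miss_geD ?has_vU ?has_vD //=.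
  by case: (has_ge 4 T); case: (miss_ge 4 T); case: (has_v 0 T); case: (has_v 3 T);
    case: (has_v 2 T).
- move=> T QT PT RT T0; left; split=> //.
  apply: (inner_pivot_ord2 (i := 0) (l := 3)) => //; move: QT PT; rewrite /Q4 /Q2 /n02;
  by case: (has_ge 4 T); case: (miss_ge 4 T); case: (has_v 0 T); case: (has_v 3 T);
    case: (has_v 2 T).
pose iota : smor (Delta N.+2) (PN V) := scomp (ord_pn L) (Delta_map (dtail03 N)).
have i1 n a : n1 (supp (iota n a)) by apply/has_vP => // -[i /=]; lia.
have i2 n a : ~~ has_v 2 (supp (iota n a)) by apply/has_vP => // -[i /=]; lia.
have ei n (a : Delta N.+2 n) : dcomp (dsub2 N) (pn_ord L n (iota n a)) = a.
  by apply: dhom_eq => i; apply: val_inj => /=; lia.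
have [|w' hw'] := plift_smor (phi := iota) hG4.
  by move=> n a; apply/dG4; rewrite /Q4 i2 !orbT.
exists w'; split=> n a.
  apply: (pl_fun hG4 (hw' _ _)); apply/sG4/sG3/sG2/sG1; left; right; split=> //.
  by exists a; rewrite ei.
by rewrite (pl_over hG4 (hw' n a)) -w2 // ei.
Qed.
End EquivEdgeHorn.

Lemma equiv_cocartesian (X S : sset) (q : smor X S) (e : X 1) :
  inner_fibration q -> quasicategory S -> is_equiv_edge e -> is_cocartesian q e.
Proof.
move=> hq hS he N u v huv hu.
have [z [z1 z2]] := equiv_edge_simplex (inner_quasicategory hS hq) he.
exact: (equiv_edge_horn z1 z2).
Qed.

(** * Lifting equivalences along categorical fibrations *)

(** The nerve of the groupoid with two objects and exactly one morphism between any two: a simplex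
    is an arbitrary sequence of objects. *)
Definition J : sset :=
  @SSet (fun n => 'I_n.+1 -> bool) (fun m n f x i => x (f i))
    (fun _ _ => erefl) (fun _ _ _ _ _ _ => erefl).

Definition jedge : J 1 := fun i => i == ord_max.

Lemma jedge_equiv : is_equiv_edge jedge.
Proof.
apply/equiv_edgeE; exists ((fun i => i == ord0) : J 1).
split; [exists ((fun i => i == 1 :> nat) : J 2)|exists ((fun i => i != 1 :> nat) : J 2)];
  split; apply/funext => i; rewrite /face /degen /src /tgt /act /jedge /=;
  rewrite -?val_eqE /bump /= ?inordK //; by case: i => [[|[|]]].
Qed.

(** [jedge] is an equivalence and simplicial maps preserve equivalences, so a homotopy parametrized
    by [J] is a natural equivalence. *)
Lemma J_homotopy (A Y : sset) (H : smor (sprod A J) Y) (f g : smor A Y) :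
  (forall n a, H n (a, fun=> false) = f n a) ->
  (forall n a, H n (a, fun=> true) = g n a) -> naturally_equiv f g.
Proof.
move=> hf hg.
pose F : smor J (Fun A Y) := curry_smor (scomp H
  (@SMor (sprod J A) (sprod A J) (fun n xy => (xy.2, xy.1)) (fun _ _ _ _ => erefl))).
exists (F 1 jedge); split; last exact: equiv_edge_smor jedge_equiv.
  by rewrite -smor_src; apply: smor_eq => n [d a]; exact: hf.
by rewrite -smor_tgt; apply: smor_eq => n [d a]; exact: hg.
Qed.

Lemma naturally_equiv_precomp (A B Z : sset) (i : smor A B) (f g : smor B Z) :
  naturally_equiv f g -> naturally_equiv (scomp f i) (scomp g i).
Proof.
have hv (f' : smor B Z) : fun_vertex (scomp f' i) =
    fun_restr Z i 0 (fun_vertex f') by apply: smor_eq.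
case=> e [es et he]; exists (fun_restr Z i 1 e).
rewrite !hv -es -et -smor_src -smor_tgt; split=> //.
exact: equiv_edge_smor he.
Qed.

Definition J_pt : smor (Delta 0) J := ymap ((fun=> false) : J 0).
Definition pt_J : smor J (Delta 0) :=
  @SMor J (Delta 0) (fun n _ => dconst n ord0) (fun m n f x => dhom_eq (fun i => erefl)).

Lemma J_pt_equivalence : categorical_equivalence J_pt.
Proof.
move=> Z hZ; split.
  move=> f; exists (scomp f pt_J).
  have -> : scomp (scomp f pt_J) J_pt = f.
    by apply: smor_eq => n x /=; congr (f _ _); apply: dhom_eq => i; rewrite !ord1.
  exact: naturally_equiv_refl.
move=> g g' h.
have contr (f : smor J Z) : naturally_equiv f (scomp (scomp f J_pt) pt_J).
  (* With second coordinate [false] the map of [J] is the identity, with [true] it is constant at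
     [false]. *)
  apply: (@J_homotopy _ _ (scomp f (@SMor (sprod J J) J
    (fun n xy i => ~~ xy.2 i && xy.1 i) (fun _ _ _ _ => erefl)))) => n a //=.
apply: (naturally_equiv_trans hZ (contr g)).
apply: (naturally_equiv_trans hZ (naturally_equiv_precomp pt_J h)).
exact/naturally_equiv_sym/contr.
Qed.

Definition jcons n (b : J n) : J n.+1 :=
  fun i => if i == 0 :> nat then false else b (inord i.-1).

Lemma act_jcons n (b : J n) : act (dface ord0) (jcons b) = b.
Proof. by apply/funext => i; rewrite /act /= /jcons lift0 /= inord_val. Qed.

Lemma dcons_mono m n (d : dhom m n) (i j : 'I_m.+2) : i <= j ->
  (if i == 0 :> nat then ord0 else d (inord i.-1)) <=
  (if j == 0 :> nat then ord0 else d (inord j.-1)).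
Proof.
case: (eqVneq (i : nat) 0) => // i0 ij; case: eqP => j0; first by lia.
have hi := ltn_ord i; have hj := ltn_ord j.
have hk (k : nat) : k < m.+2 -> k.-1 < m.+1 by lia.
by apply: dmono; rewrite !inordK ?hk // -!subn1 leq_sub2r.
Qed.

Definition dcons m n (d : dhom m n) : dhom m.+1 n := DHom (dcons_mono d).

Lemma hits_step m n (d : dhom m n) : (forall j : 'I_n.+1, j != 0 :> nat -> exists i, d i = j) ->
  (d ord_max = ord_max) /\ (forall i j : 'I_m.+1, j = i.+1 :> nat -> d j <= (d i).+1).
Proof.
move=> hd; split.
  apply: val_inj; apply/eqP; rewrite eqn_leq -ltnS ltn_ord /=.
  case: n d hd => [|n] d hd //.
  have [|i ei] := hd ord_max; first by [].
  have le : d i <= d ord_max by apply: dmono; rewrite -ltnS.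
  by apply: leq_trans le; rewrite ei.
move=> i j eij; rewrite leqNgt; apply/negP => lt.
have kn : (d i).+1 < n.+1 by apply: ltn_trans (ltn_ord (d j)).
have [|l el] := hd (Ordinal kn); first by [].
have := congr1 val el => /= el'.
case: (leqP l i) => li; first by have := dmono d li; rewrite el' ltnn.
have jl : j <= l by rewrite eij.
by have := dmono d jl; rewrite el' leqNgt lt.
Qed.

(** Read downwards from the last vertex, where both maps are maximal, each step is 0 or 1 and its
    parity tells which. *)
Lemma hits_parity m n (d d' : dhom m n) :
  (forall j : 'I_n.+1, j != 0 :> nat -> exists i, d i = j) ->
  (forall j : 'I_n.+1, j != 0 :> nat -> exists i, d' i = j) ->
  (forall i, odd (d i) = odd (d' i)) -> d = d'.
Proof.
move=> /hits_step[h1 h2] /hits_step[h1' h2'] ho; apply: dhom_eq => i.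
move: {-1}(m - i) (erefl (m - i)) => k; elim: k i => [|k IH] i ik.
  have -> : i = ord_max by apply: val_inj => /=; have := ltn_ord i; lia.
  by rewrite h1 h1'.
have jm : i.+1 < m.+1 by lia.
pose j := Ordinal jm.
have ej : d j = d' j by apply: IH; rewrite /=; lia.
apply: val_inj => /=; have := ho i.
have := h2 i j erefl; have := h2' i j erefl.
have := dmono d (leqnSn i : i <= j); have := dmono d' (leqnSn i : i <= j).
rewrite ej; lia.
Qed.

(* A simplex of J starting with [true] is paired with the one obtained by putting
   [false] in front; Zorn's lemma is applied to the extensions whose domain is a union
   of such pairs. *)
Section Extend.
Context (Z : sset) (hZ : quasicategory Z) (e : Z 1) (he : is_equiv_edge e).

Let G0 n (x : J n) (y : Z n) : Prop :=
  exists a : dhom n 1, (forall i, x i = (a i == ord_max)) /\ y = act a e.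

Let R n m (b : J n) (b' : J m) : Prop :=
  [/\ m = n.+1, b ord0 & forall i : 'I_m.+1,
    b' i = if i == 0 :> nat then false else b (inord i.-1)].

Lemma ord2_eq (i j : 'I_2) : (i == ord_max) = (j == ord_max) -> i = j.
Proof. by case: (ord2_case i) => ->; case: (ord2_case j) => ->. Qed.

Lemma G0_plift : plift (to_pt Z) (to_pt J) G0.
Proof.
split=> //.
- move=> n b x x' [a [ha ->]] [a' [ha' ->]]; apply: act_congr => i.
  by apply: ord2_eq; rewrite -ha -ha'.
- move=> m n f b x [a [ha ->]]; exists (dcomp a f).
  by rewrite act_act; split=> // i; rewrite -ha.
Qed.

Lemma G0_closed : dom_closed R G0.
Proof.
move=> n m b b' [em b0 eb] [x [a [ha _]]].
exists (act (dstep m 1) e), (dstep m 1); split=> // i.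
rewrite eb; case: eqP => [i0|/eqP i0]; first by rewrite /= i0.
rewrite /= ltnS leqn0 (negPf i0) eqxx ha.
apply/eqP; apply: val_inj; apply/eqP; rewrite eqn_leq -ltnS ltn_ord /=.
move: b0; rewrite ha => /eqP b0; have := dmono a (leq0n _ : (ord0 : 'I_n.+1) <= inord i.-1).
by rewrite b0.
Qed.

(** A counterexample of least dimension has no repetition, being otherwise degenerate, so it
    alternates from [false]. Its face opposite 0 is its partner and is missing too; its other faces
    are covered and form a left horn that fills, as its first edge is the equivalence [e]. Parity
    makes the simplex injective off this horn. *)
Lemma J_dom_false G : plift (to_pt Z) (to_pt J) G -> dom_closed R G ->
  (forall n b x, G0 (n := n) b x -> G n b x) ->
  (forall G', plift (to_pt Z) (to_pt J) G' -> dom_closed R G' ->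
      (forall n b x, G n b x -> G' n b x) -> forall n b x, G' n b x -> G n b x) ->
  forall n (b : J n), b ord0 = false -> pdom G b.
Proof.
move=> hG cG G0G maxG n; elim/ltn_ind: n => n IH b b0.
have [hd|nd] := pselect (pdom G b); first by []; exfalso.
have dstart (a : dhom n 1) : (forall i, b i = (a i == ord_max)) -> False.
  by move=> ha; apply: nd; exists (act a e); apply: G0G; exists a.
case: n => [|n] in IH b b0 nd dstart *.
  by apply: (dstart (dconst 0 ord0)) => i; rewrite ord1 b0.
have hface m (f : dhom m n.+1) (j : 'I_n.+2) : j != ord0 -> (forall i, f i != j) ->
    pdom G (act f b).
  move=> j0 fj; have [g ->] := dcomp_face fj; rewrite -act_act.
  apply: (pdom_act hG); apply: IH => //; rewrite /act /=.
  rewrite -b0; congr b; apply: val_inj => /=; rewrite /bump.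
  by rewrite leqNgt lt0n -[_ == 0]/(j == ord0) j0.
have alt (i : 'I_n.+2) (j : 'I_n.+2) : j = i.+1 :> nat -> b j = ~~ b i.
  move=> eij; apply/eqP; apply: contraT => /negPf h; exfalso; apply: nd.
  have ebij : b j = b i by move: h; case: (b j); case: (b i).
  have hm : {homo (fun k => k - (k == j :> nat)) : x y / x <= y}.
    by move=> x y; lia.
  have hb k : k <= n.+1 -> k - (k == j :> nat) <= n.+1 by lia.
  have -> : b = act (dnat hm hb) b.
    apply/funext => k; rewrite /act /=; case: (eqVneq k j) => [->|kj].
      by rewrite ebij; congr b; apply: val_inj; rewrite /= eqxx eij subn1.
    by congr b; apply: val_inj; rewrite /= val_eqE (negPf kj) subn0.
  apply: (hface _ _ j); first by rewrite -val_eqE /= eij.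
  have hk (k l : nat) : l != 0 -> k - (k == l) != l by lia.
  by move=> k; rewrite -val_eqE; apply: hk; rewrite eij.
have bodd (k : nat) (i : 'I_n.+2) : i = k :> nat -> b i = odd k.
  elim: k i => [|k IHk] i ik.
    by rewrite /= -b0; congr b; apply: val_inj.
  have kn : k < n.+2 by rewrite -ik; have := ltn_ord i; lia.
  by rewrite (@alt (Ordinal kn) i) // IHk.
have bo (i : 'I_n.+2) : b i = odd i by apply: bodd.
case: n => [|n] in IH b b0 nd dstart hface alt bodd bo *.
  by apply: (dstart (did 1)) => i; rewrite bo; case: (ord2_case i) => ->.
have surj_dom m (d : dhom m n.+2) : hits_all d -> pdom G (act d b) -> False.
  move=> hd h; apply: nd; have [s hs] := boolp.choice hd.
  have -> : b = act (DHom (section_mono hs)) (act d b).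
    by rewrite act_act -[LHS]act_did; apply: act_congr => j /=; rewrite hs.
  exact: (pdom_act hG).
have nface0 : ~ pdom G (act (dface ord0) b).
  move=> h; apply: nd; apply: cG h; split=> //.
    by rewrite /act /= bo lift0.
  move=> i; rewrite !bo; case: eqP => [->//|/eqP i0].
  rewrite /act /= bo lift0 inordK ?prednK ?lt0n //.
  by rewrite -ltnS; apply: ltn_ord.
have nhorn m (d : dhom m n.+2) :
    ~~ [exists j, (j != ord0) && [forall i, d i != j]] ->
    forall j : 'I_n.+3, j != 0 :> nat -> exists i, d i = j.
  move=> nd' j j0; apply/not_existsP => h; case/negP: nd'; apply/hornP.
  by exists j => // i; apply/eqP; apply: h.
have hornD m (d : dhom m n.+2) : pdom G (act d b) ->
    [exists j, (j != ord0) && [forall i, d i != j]].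
  move=> h; apply: contraT => /nhorn hd.
  have [[i ei]|h0] := pselect (exists i, d i = ord0).
    exfalso; apply: (surj_dom _ d) h => j.
    by have [->|] := eqVneq j ord0; [exists i|rewrite -val_eqE; apply: hd].
  have [k|g eg] := @dcomp_face _ _ d ord0.
    by apply/eqP => ek; apply: h0; exists k.
  exfalso; apply: nface0; rewrite eg -act_act in h.
  have hg : hits_all g.
    move=> j; have [|i ei] := hd (lift ord0 j); first by [].
    by exists i; apply: (@lift_inj _ ord0); rewrite -ei eg.
  have [s hs] := boolp.choice hg.
  have -> : act (dface ord0) b = act (DHom (section_mono hs)) (act g (act (dface ord0) b)).
    by rewrite [RHS]act_act -[LHS]act_did; apply: act_congr => j /=; rewrite hs.
  exact: (pdom_act hG).
have [||||G' [hG' GG' dG']] := attach_lift (i := horn_incl (ord0 : 'I_n.+3))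
    (phi := ymap b) hG.
- by move=> m [a /= /hornP[j j0 aj]]; apply: (hface _ _ j).
- by move=> m d /hornD h; exists (exist _ d h).
- move=> m d d' edd.
  have [/hornP[j j0 aj]|/nhorn h] := boolP [exists j, (j != ord0) && [forall i, d i != j]].
    by left; apply: (hface _ _ j).
  have [/hornP[j j0 aj]|/nhorn h'] := boolP [exists j, (j != ord0) && [forall i, d' i != j]].
    by left; rewrite edd; apply: (hface _ _ j).
  right; apply: hits_parity => // i.
  by have := congr1 (fun x : J m => x i) edd; rewrite /= /act /= !bo.
- move=> u hu.
  (* Over the point, being cocartesian means that left horns with first edge [e] fill. *)
  have ce : is_cocartesian (to_pt Z) e.
    apply: equiv_cocartesian he; first exact: quasicategory_inner.
    move=> N k _ _ w; exists (to_pt (Delta N)) => m a; exact: pt_eq.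
  apply: (ce n u (to_pt _)) => //.
  apply: (pl_fun hG (hu _ _)); apply: G0G; exists (did 1); rewrite act_did; split=> // i.
  rewrite /= /act bo /=; case: (ord2_case i) => ->; rewrite ?eqxx //=.
  by rewrite inordK.
apply: nd; have : pdom G' b by apply/dG'; right; exists (did n.+2); apply: (esym (act_did b)).
case=> x hx; exists x; apply: (maxG _ hG' _ GG') hx.
move=> m m' c c' hR /dG'[h|[d ed]].
  by have [y hy] := cG _ _ _ _ hR h; exists y; apply: GG'.
(* The new domain is closed under [R]: as the attached simplex starts with [false], putting [false]
   in front of one of its simplices amounts to [dcons]. *)
apply/dG'; right; case: hR => em c0 ec'; subst m'; exists (dcons d).
apply/funext => i; rewrite ec' ed /= /act /= bo; case: eqP => // _.
Qed.

Lemma J_extend : exists F : smor J Z, F 1 jedge = e.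
Proof.
have [G [hG cG G0G maxG]] := plift_zorn G0_plift G0_closed.
have [|F hF] := plift_smor (phi := sidm J) hG.
  move=> n x; rewrite /=; case x0: (x ord0); last exact: J_dom_false.
  have hc : pdom G (jcons x) by apply: J_dom_false.
  by rewrite -(act_jcons x); apply: (pdom_act hG).
exists F; apply: (pl_fun hG (hF _ _)); apply: G0G; exists (did 1).
by rewrite act_did.
Qed.
End Extend.

(** The extension of [e] to [J] lifts against the inclusion of the point [false], which fixes the
    source; the image of [jedge] under the lift is again an equivalence. *)
Lemma equiv_edge_lift (X S : sset) (q : smor X S) (x : X 0) (e : S 1) :
  categorical_fibration q -> quasicategory S -> is_equiv_edge e ->
  src e = q 0 x -> exists h : X 1, [/\ src h = x, q 1 h = e & is_equiv_edge h].
Proof.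
move=> hq hS he hx; have [F hF] := J_extend hS he.
have [||w [hw hqw]] := hq _ _ J_pt _ J_pt_equivalence (ymap x) F.
- by move=> n a b _; apply: dhom_eq => i; rewrite !ord1.
- move=> n a; rewrite snat -hx -hF -smor_src -snat; congr (F _ _).
exists (w 1 jedge); split.
- rewrite -smor_src -[RHS]act_did -[RHS](hw 0 (did 0)); congr (w _ _).
- by rewrite hqw.
- exact: equiv_edge_smor jedge_equiv.
Qed.

(** * From (c-ii) to (c-i) *)

Lemma cocart_fill2 (X S : sset) (q : smor X S) (f h : X 1) (s : S 2) :
  is_cocartesian q f -> src f = src h -> q 1 f = face 2 s -> q 1 h = face 1 s ->
  exists z : X 2, [/\ face 2 z = f, face 1 z = h & q 2 z = s].
Proof.
move=> cf fh qf qh; pose y (j : nat) := if j == 1 then h else f.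
have hc : faces_compat (fun j : nat => j != (ord0 : 'I_3)) y.
  apply: faces_compatS => -[|[|[|i]]] [|[|[|j]]] // _ _ _ _.
  by rewrite /y /= -!src_face.
have hqy (j : nat) : j != (ord0 : 'I_3) -> j <= 2 -> q 1 (y j) = face j s.
  by case: j => [|[|[|j]]] // _ _; rewrite /y.
have [u huv hu|z [hz hqz]] := faces_horn_gen _ hc hqy.
  apply: (cf 0 u (ymap s) huv).
  apply: (pl_fun (faces_plift hc hqy) (hu _ _)).
  have -> : sval (horn_first_edge 0) = dface (inord 2).
    apply: dhom_eq => i; apply: val_inj; rewrite /= /bump.
    by case: (ord2_case i) => -> /=; rewrite !inordK.
  exact: (@faces_face X 1 (fun j : nat => j != (ord0 : 'I_3)) y 2).
by exists z; rewrite !hz.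
Qed.

Lemma src_eFin m n (a : pointed_map m n) : src (eFin a) = vFin m.
Proof. by apply: nerve_arr_eq => i j ij; rewrite arr_act !arr_id ?ord1. Qed.

Lemma tgt_eFin m n (a : pointed_map m n) : tgt (eFin a) = vFin n.
Proof. by apply: nerve_arr_eq => i j ij; rewrite arr_act !arr_id ?ord1. Qed.

Lemma dstep22_faces (X : sset) (e : X 1) :
  [/\ face 2 (act (dstep 2 2) e) = degen 1 (src e), face 1 (act (dstep 2 2) e) = e &
      face 0 (act (dstep 2 2) e) = e].
Proof. by rewrite !face_dstep //= !act_dstep1 act_dstepn. Qed.

Lemma dstep21_faces (X : sset) (e : X 1) :
  [/\ face 2 (act (dstep 2 1) e) = e, face 1 (act (dstep 2 1) e) = e &
      face 0 (act (dstep 2 1) e) = degen 1 (tgt e)].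
Proof. by rewrite !face_dstep //= !act_dstep1 act_dstep0. Qed.

Program Definition fun_eval (X Y : sset) (x : X 0) : smor (Fun X Y) Y :=
  @SMor (Fun X Y) Y (fun n g => @sfun (sprod (Delta n) X) Y g n (did n, degen n x)) _.
Next Obligation.
move=> X Y x m n f g; rewrite -[RHS]snat /=.
congr (@sfun (sprod _ _) _ _ _ (_, _)); rewrite ?act_degen //.
Qed.

Lemma fun_eval_vertex (X Y : sset) (x : X 0) (f : smor X Y) :
  fun_eval Y x 0 (fun_vertex f) = f 0 x.
Proof. by rewrite /= degen0. Qed.

Definition power_base (I : Type) (X C : sset) (q : smor X C) :
    smor (fiber_power I q) C :=
  @SMor (fiber_power I q) C (fun n cx => (sval cx).1) (fun _ _ _ _ => erefl).

Definition power_proj (I : Type) (X C : sset) (q : smor X C) (i : I) :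
    smor (fiber_power I q) X :=
  @SMor (fiber_power I q) X (fun n cx => (sval cx).2 i) (fun _ _ _ _ => erefl).

Definition at_level (C : sset) n : smor C (sprod C NFin) :=
  @SMor C (sprod C NFin) (fun m c => (c, degen m (vFin n)))
    (fun m k f c => congr1 (pair (act f c)) (esym (act_degen f (vFin n)))).

Section Backward.
Context (C M : sset) (hC : quasicategory C) (p : smor M (sprod C NFin)).
Hypothesis hp : categorical_fibration p.

Lemma fib_over n k (x : fib p n k) : p k (sval x) = (fib_proj p n k x, degen k (vFin n)).
Proof.
by rewrite [p k (sval x)]surjective_pairing; congr pair; apply: (svalP x).
Qed.

Lemma rho_tuple_equivalence_lift n (rho : forall i : 'I_n, rho_transport p i) :
  equivalence_of_qcats (rho_tuple rho) ->
  forall (c : C 0) (y : 'I_n -> fib1_over p c 0),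
  exists x : M 0, p 0 x = (c, vFin n) /\
    forall i : 'I_n, exists f : M 1,
      cocartesian_lift p x (id_edge c (rho_map i)) f /\
      tgt f = fib1_over_incl p c 0 (y i).
Proof.
move=> [G [_ [e [es et he]]]] c y.
have hq := categorical_inner hp.
have hS : quasicategory (sprod C NFin).
  by apply: sprod_quasicategory => //; apply: nerve_quasicategory.
have hyc i : fib_proj p 1 0 (sval (y i)) = c by rewrite (svalP (y i)) degen0.
pose yv : fiber_power 'I_n (fib_proj p 1) 0 := exist _ (c, fun i => sval (y i)) hyc.
pose ev := fun_eval (fiber_power 'I_n (fib_proj p 1)) yv.
pose eps := ev 1 e.
have heps : is_equiv_edge eps := equiv_edge_smor ev he.
pose x0 := G 0 yv.
have seps : src eps = rho_tuple rho 0 x0.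
  by rewrite /eps -smor_src es fun_eval_vertex.
have teps : tgt eps = yv by rewrite /eps -smor_tgt et fun_eval_vertex.
pose eb := power_base 'I_n (fib_proj p 1) 1 eps.
have heb : is_equiv_edge eb := equiv_edge_smor _ heps.
pose c0 := fib_proj p n 0 x0.
have seb : src eb = c0 by rewrite /eb -smor_src seps.
have teb : tgt eb = c by rewrite /eb -smor_tgt teps.
pose ei i : M 1 := sval (power_proj (fib_proj p 1) i 1 eps).
have hei i : is_equiv_edge (ei i).
  exact: (equiv_edge_smor (fiber_incl _ _) (equiv_edge_smor _ heps)).
have sei i : src (ei i) = sval (rho_shriek (rho i) 0 x0).
  rewrite -[ei i]/(fiber_incl _ _ 1 _) -smor_src -smor_src seps.
  by [].
have tei i : tgt (ei i) = fib1_over_incl p c 0 (y i).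
  rewrite -[ei i]/(fiber_incl _ _ 1 _) -smor_tgt -smor_tgt teps.
  by [].
have pei i : p 1 (ei i) = (eb, degen 1 (vFin 1)).
  by rewrite /ei fib_over; congr pair; apply: (svalP eps i).
have [|h [sh ph hh]] := equiv_edge_lift (x := sval x0) hp hS
    (equiv_edge_smor (at_level C n) heb).
  by rewrite -smor_src seb fib_over.
exists (tgt h); split.
  by rewrite smor_tgt ph -smor_tgt teb; congr pair; apply: degen0.
move=> i.
pose ki := rho_htpy (rho i) 1 (degen 1 x0, did 1).
have ski : src ki = sval x0.
  rewrite -smor_src -[RHS]degen0 -[degen 0 (sval x0)]/(sval (degen 0 x0)).
  rewrite -(rho_htpy_start (rho i)); congr (rho_htpy _ _ (_, _)).
  exact: act_degen.
have tki : tgt ki = src (ei i).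
  rewrite sei -smor_tgt -[RHS]/(rho_htpy (rho i) 0 (x0, dconst 0 ord_max)).
  congr (rho_htpy _ _ (_, _)); rewrite -[RHS]degen0; exact: act_degen.
have pki : p 1 ki = (degen 1 c0, eFin (rho_map i)).
  by rewrite rho_htpy_over act_did smor_degen.
have [b22 b21 b20] := dstep22_faces eb; have [b12 b11 b10] := dstep21_faces eb.
have [r22 r21 r20] := dstep22_faces (eFin (rho_map i)).
have [r12 r11 r10] := dstep21_faces (eFin (rho_map i)).
rewrite seb in b22; rewrite teb in b10.
rewrite src_eFin in r22; rewrite tgt_eFin in r10.
have ddE (a : C 2) (b : NFin 2) j : face (X := sprod C NFin) j (a, b) = (face j a, face j b).
  by [].
(* Over [C] the identity followed by [eb], over [NFin] the map [rho_map i] followed by the identity;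
   the long edge of a filler lies over both [eb] and [rho_map i]. *)
pose s1 : sprod C NFin 2 := (act (dstep 2 2) eb, act (dstep 2 1) (eFin (rho_map i))).
have [||z [z2 z0 pz]] := fill_triangle (s := s1) hq tki.
- by rewrite /s1 ddE b22 r12 pki.
- by rewrite /s1 ddE b20 r10 pei.
pose gi := face 1 z.
have tri_g : tri ki (ei i) gi by exists z.
have cg : is_cocartesian p gi.
  apply: (cocart_comp hq hS _ (equiv_cocartesian hq hS (hei i)) tri_g).
  exact: rho_htpy_cocart.
have pg : p 1 gi = (eb, eFin (rho_map i)).
  by rewrite snat_face pz /s1 ddE b21 r11.
(* The same long edge split the other way: along [eb] with the object of [NFin] fixed, then along
   [rho_map i] over the fixed vertex [c]. *)
pose s2 : sprod C NFin 2 := (act (dstep 2 1) eb, act (dstep 2 2) (eFin (rho_map i))).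
have ch := equiv_cocartesian hq hS hh.
have [|||z' [z2' z1' pz']] := @cocart_fill2 _ _ p h gi s2 ch.
- by rewrite sh -(tri_src tri_g).
- by rewrite /s2 ddE b12 r22 ph.
- by rewrite /s2 ddE b11 r21 pg.
have tri_f : tri h (face 0 z') gi by exists z'.
exists (face 0 z'); split; last by rewrite (tri_tgt tri_f) -(tri_tgt tri_g).
split; first by rewrite (tri_mid tri_f).
- by rewrite snat_face pz' /s2 ddE b10 r20.
- exact: cocart_cancel ch cg tri_f.
Qed.
End Backward.

(** * Filling against a relative limit *)

(** The poset whose nerve is the cone on the discrete [I]: [None] is the cone point, below all
    labels. *)
Program Definition optP (I : finType) : fposet :=
  @FPoset (option I) (fun a b => (a == None) || (a == b)) _ _ _.
Next Obligation. by move=> I a; rewrite eqxx orbT. Qed.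
Next Obligation.
move=> I a b /andP[/orP[/eqP->|/eqP//] /orP[/eqP->//|/eqP//]].
Qed.
Next Obligation. by move=> I b a c /orP[/eqP->|/eqP->]. Qed.

Definition joinP_le N (W : fposet) (a b : 'I_N.+1 + W) : bool :=
  match a, b with
  | inl i, inl j => i <= j
  | inl _, inr _ => true
  | inr _, inl _ => false
  | inr x, inr y => fle x y
  end.

Program Definition joinP N (W : fposet) : fposet :=
  @FPoset ('I_N.+1 + W)%type (@joinP_le N W) _ _ _.
Next Obligation. by move=> N W [i|w] /=; [exact: leqnn|exact: fle_refl]. Qed.
Next Obligation.
move=> N W [i|w] [j|w'] //= h; last by congr inr; apply: fle_anti.
by congr inl; apply: val_inj; apply: anti_leq.
Qed.
Next Obligation.
move=> N W [i|w] [j|w'] [l|w''] //=; [exact: leq_trans|exact: fle_trans].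
Qed.

Section JoinVertices.
Context (X Y : sset).

Definition jvl n (s : join X Y n) i (h : jcut s i = false) : X 0 :=
  @jleft _ _ _ s 0 (dconst 0 i) (fun _ => h).

Definition jvr n (s : join X Y n) i (h : jcut s i = true) : Y 0 :=
  @jright _ _ _ s 0 (dconst 0 i) (fun _ => h).

Definition jvert n (s : join X Y n) i : X 0 + Y 0 :=
  match jcut s i as b return (jcut s i = b -> (X 0 + Y 0)%type) with
  | true => fun h => inr (jvr h)
  | false => fun h => inl (jvl h)
  end erefl.

Lemma jvertT n (s : join X Y n) i (h : jcut s i = true) : jvert s i = inr (jvr h).
Proof.
rewrite /jvert; move: (erefl (jcut s i)); rewrite {2 3}h => h'.
by rewrite (Prop_irrelevance h h').
Qed.

Lemma jvertF n (s : join X Y n) i (h : jcut s i = false) : jvert s i = inl (jvl h).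
Proof.
rewrite /jvert; move: (erefl (jcut s i)); rewrite {2 3}h => h'.
by rewrite (Prop_irrelevance h h').
Qed.

Lemma jvert_act m n (f : dhom m n) (s : join X Y n) i :
  jvert (act f s : join X Y m) i = jvert s (f i).
Proof.
case h: (jcut s (f i)).
  rewrite (jvertT h) (jvertT (h : jcut (act f s : join X Y m) i = true)).
  by congr inr; apply: (@jright_irr _ _ _ s 0 (dcomp f (dconst 0 i)) (dconst 0 (f i))).
rewrite (jvertF h) (jvertF (h : jcut (act f s : join X Y m) i = false)).
by congr inl; apply: (@jleft_irr _ _ _ s 0 (dcomp f (dconst 0 i)) (dconst 0 (f i))).
Qed.

Lemma jvr_edge n (s : join X Y n) (i j : 'I_n.+1) (ij : i <= j)
    (hi : jcut s i = true) (hj : jcut s j = true) :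
  exists y : Y 1, jvr hi = src y /\ jvr hj = tgt y.
Proof.
have he l : jcut s (dedge ij l) = true by rewrite /=; case: ifP.
exists (jright he).
have h0 l : jcut s (dcomp (dedge ij) (dconst 0 ord0) l) = true by apply: he.
have h1 l : jcut s (dcomp (dedge ij) (dconst 0 ord_max) l) = true by apply: he.
rewrite /src /tgt -(jright_nat he h0) -(jright_nat he h1).
by split; apply: jright_irr.
Qed.

Lemma jvl_edge n (s : join X Y n) (i j : 'I_n.+1) (ij : i <= j)
    (hi : jcut s i = false) (hj : jcut s j = false) :
  exists y : X 1, jvl hi = src y /\ jvl hj = tgt y.
Proof.
have he l : jcut s (dedge ij l) = false by rewrite /=; case: ifP.
exists (jleft he).
have h0 l : jcut s (dcomp (dedge ij) (dconst 0 ord0) l) = false by apply: he.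
have h1 l : jcut s (dcomp (dedge ij) (dconst 0 ord_max) l) = false by apply: he.
rewrite /src /tgt -(jleft_nat he h0) -(jleft_nat he h1).
by split; apply: jleft_irr.
Qed.
End JoinVertices.

Lemma jvert_inr (X Y : sset) n (y : Y n) i :
  jvert (join_inr X Y n y) i = inr (act (dconst 0 i) y).
Proof. by rewrite (@jvertT _ _ _ (join_inr X Y n y) i erefl). Qed.

Section ConePoset.
Context (I : finType).
Let K := disc_sset I.

Definition cvertex n (y : cone K n) i : option I :=
  match jvert y i with inl _ => None | inr k => Some k end.

Lemma cvertex_act m n (f : dhom m n) (y : cone K n) i :
  cvertex (act f y) i = cvertex y (f i).
Proof. by rewrite /cvertex jvert_act. Qed.

Lemma cvertexT n (y : cone K n) i (h : jcut y ord_max = true) :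
  jcut y i -> cvertex y i = Some (cone_label h).
Proof.
move=> hi; rewrite /cvertex (jvertT hi); congr Some.
have [e [-> et]] := jvr_edge (leq_ord i : i <= (ord_max : 'I_n.+1)) hi h.
by rewrite /cone_label -[jright _]/(jvr h) et.
Qed.

Lemma cvertexF n (y : cone K n) i : jcut y i = false -> cvertex y i = None.
Proof. by move=> h; rewrite /cvertex (jvertF h). Qed.

Lemma cvertex_mono n (y : cone K n) (i j : 'I_n.+1) : i <= j ->
  fle (cvertex y i : optP I) (cvertex y j).
Proof.
move=> ij; case hi: (jcut y i); last by rewrite (cvertexF hi).
have hj : jcut y j by apply: jcut_mono ij hi.
have h : jcut y ord_max by apply: jcut_mono hj; apply: leq_ord.
by rewrite !(cvertexT h) //; apply: fle_refl.
Qed.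

Context (N : nat).
Let V := joinP N (optP I).

Definition jpn_vert m (a : dhom m N) n (s : join (Delta m) (cone K) n) i : V :=
  match jvert s i with
  | inl d => inl (a ((d : dhom 0 m) ord0))
  | inr r => inr (cvertex (r : cone K 0) ord0)
  end.

Lemma jpn_mono m (a : dhom m N) n (s : join (Delta m) (cone K) n) (i j : 'I_n.+1) :
  i <= j -> fle (jpn_vert a s i) (jpn_vert a s j).
Proof.
move=> ij; rewrite /jpn_vert.
case hi: (jcut s i); case hj: (jcut s j).
- rewrite (jvertT hi) (jvertT hj).
  have [e [-> ->]] := jvr_edge ij hi hj.
  by rewrite /src /tgt !cvertex_act; apply: cvertex_mono.
- by have := jcut_mono ij hi; rewrite hj.
- by rewrite (jvertF hi) (jvertT hj).
- rewrite (jvertF hi) (jvertF hj).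
  have [e [-> ->]] := jvl_edge ij hi hj.
  by apply: (dmono a); rewrite /src /tgt /=; apply: dmono.
Qed.

Lemma jpn_vert_act m (a : dhom m N) k n (f : dhom k n)
    (s : join (Delta m) (cone K) n) i :
  jpn_vert a (act f s) i = jpn_vert a s (f i).
Proof. by rewrite /jpn_vert jvert_act. Qed.

(** [a] is carried along because simplices of a slice vary the factor joined to the cone: [jpn a] is
    what [a] induces on joins, read in the poset nerve. *)
Definition jpn m (a : dhom m N) : smor (join (Delta m) (cone K)) (PN V) :=
  @SMor (join (Delta m) (cone K)) (PN V)
    (fun n s => @ChainSimplex V n (jpn_vert a s) (@jpn_mono m a n s))
    (fun k n f s => @chain_eq V k
      (@ChainSimplex V k (jpn_vert a (act f s)) (@jpn_mono m a k (act f s)))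
      (act f (@ChainSimplex V n (jpn_vert a s) (@jpn_mono m a n s) : PN V n))
      (jpn_vert_act a f s)).

Lemma jpn_nat l m (f : dhom l m) (a : dhom m N) n (s : join (Delta l) (cone K) n) :
  jpn (dcomp a f) n s = jpn a n (join_map (Delta_map f) (sidm (cone K)) n s).
Proof.
apply: chain_eq => i /=; rewrite /jpn_vert.
case h: (jcut s i).
  rewrite (jvertT h).
  by rewrite (@jvertT _ _ _ (join_map (Delta_map f) (sidm (cone K)) n s) i h).
rewrite (jvertF h).
by rewrite (@jvertF _ _ _ (join_map (Delta_map f) (sidm (cone K)) n s) i h).
Qed.

Definition cone_edge (i : I) : PN V 1.
Proof.
refine (@ChainSimplex V 1 (fun l => if l == ord0 then inr None else inr (Some i)) _).
by move=> [[|[|l]] hl] [[|[|l']] hl'] //= _; apply: fle_refl.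
Defined.

Definition cone_pt : PN V 0 := @ChainSimplex V 0 (fun l => inr None)
  (fun _ _ _ => @fle_refl V (inr None)).

Lemma jpn_inrT m (a : dhom m N) n (y : cone K n) (h : jcut y ord_max = true) :
  jpn a n (join_inr (Delta m) (cone K) n y) =
  act (cut_dhom y) (cone_edge (cone_label h)).
Proof.
apply: chain_eq => i /=; rewrite /jpn_vert jvert_inr cvertex_act /=.
case hi: (jcut y i); last by rewrite cvertexF.
by rewrite (cvertexT h) // hi.
Qed.

Lemma jpn_inrF m (a : dhom m N) n (y : cone K n) : jcut y ord_max = false ->
  jpn a n (join_inr (Delta m) (cone K) n y) = degen n cone_pt.
Proof.
move=> h; apply: chain_eq => i /=; rewrite /jpn_vert jvert_inr cvertex_act /=.
rewrite cvertexF //; apply/negP => hi;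
  move: (jcut_mono (leq_ord i : i <= (ord_max : 'I_n.+1)) hi).
by rewrite h.
Qed.
End ConePoset.

Section PosetToJoin.
Context (I : finType) (N : nat).
Let K := disc_sset I.
Let V := joinP N (optP I).
Implicit Types (x : V).

Definition isr x : bool := if x is inr _ then true else false.
Definition iss x : bool := if x is inr (Some _) then true else false.

Definition getl x : 'I_N.+1 := if x is inl j then j else ord0.

Definition getI x : iss x = true -> I :=
  match x return iss x = true -> I with
  | inr (Some i) => fun _ => i
  | _ => fun h => match trueNfalse (esym h) with end
  end.

Lemma getIE x (h : iss x = true) : x = inr (Some (getI h)).
Proof. by case: x h => [j|[i|]]. Qed.

Lemma isr_mono x y : fle x y -> isr x -> isr y.
Proof. by case: x; case: y. Qed.

Lemma iss_mono x y : fle x y -> iss x -> iss y.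
Proof. by case: x => [j|[i|]]; case: y => [l|[l|]]. Qed.

Lemma getl_mono x y : fle x y -> isr y = false -> getl x <= getl y.
Proof. by case: x => [j|w]; case: y => [l|w']. Qed.

Lemma getI_mono x y (hx : iss x = true) (hy : iss y = true) : fle x y ->
  getI hx = getI hy.
Proof. by case: x hx => [j|[i|]] //; case: y hy => [l|[l|]] //= _ _ /eqP[]. Qed.

Lemma getI_irr x y (hx : iss x = true) (hy : iss y = true) : x = y ->
  getI hx = getI hy.
Proof. by move=> e; subst y; rewrite (Prop_irrelevance hx hy). Qed.

Section Simplex.
Context (n : nat) (s : PN V n).

Program Definition pn_cone k (a : dhom k n) : cone K k :=
  @JoinSimplex (Delta 0) K k (fun l => iss (s (a l))) _
    (fun k' b _ => dconst k' ord0) _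
    (fun k' b hb => getI (hb ord0)) _.
Next Obligation.
by move=> k a i j ij /=; apply: iss_mono; apply: cmono; apply: dmono.
Qed.
Next Obligation. by move=> k a l k' b c ha hab; apply: dhom_eq. Qed.
Next Obligation.
move=> k a l k' b c ha hab; rewrite -[RHS]/(getI (ha ord0)).
by apply/esym/getI_mono; apply: cmono; apply: dmono; apply: dmono.
Qed.

Lemma pn_cone_act l k (a : dhom k n) (b : dhom l k) :
  pn_cone (dcomp a b) = act b (pn_cone a).
Proof. by apply: join_simplex_eq => // k' c hs ht /=; apply: getI_irr. Qed.

Lemma pn_left_mono k (a : dhom k n) (ha : forall i, isr (s (a i)) = false)
    (i j : 'I_k.+1) : i <= j -> getl (s (a i)) <= getl (s (a j)).
Proof. by move=> ij; apply: getl_mono => //; apply: cmono; apply: dmono. Qed.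

Program Definition pn_join : join (Delta N) (cone K) n :=
  @JoinSimplex (Delta N) (cone K) n (fun l => isr (s l)) _
    (fun k a ha => DHom (pn_left_mono ha)) _
    (fun k a _ => pn_cone a) _.
Next Obligation. by move=> i j ij; apply: isr_mono; apply: cmono. Qed.
Next Obligation. by move=> l k a b ha hab; apply: dhom_eq. Qed.
Next Obligation. by move=> l k a b ha hab; apply: pn_cone_act. Qed.

(* The same simplex regarded in the join with the base of the cone. *)
Program Definition pn_joinK (h : forall l, isr (s l) -> iss (s l)) :
  join (Delta N) K n :=
  @JoinSimplex (Delta N) K n (fun l => isr (s l)) _
    (fun k a ha => DHom (pn_left_mono ha)) _
    (fun k a ha => getI (h _ (ha ord0))) _.
Next Obligation. by move=> h i j ij; apply: isr_mono; apply: cmono. Qed.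
Next Obligation. by move=> h l k a b ha hab; apply: dhom_eq. Qed.
Next Obligation.
move=> h l k a b ha hab; rewrite -[RHS]/(getI (h _ (ha ord0))).
by apply/esym/getI_mono; apply: cmono; apply: dmono.
Qed.

Lemma pn_joinKE (h : forall l, isr (s l) -> iss (s l)) :
  pn_join = join_map (sidm (Delta N)) (join_inr (Delta 0) K) n (pn_joinK h).
Proof.
apply: join_simplex_eq => // k a hs ht /=.
  by apply: dhom_eq.
apply: join_simplex_eq => //=.
- by move=> i; rewrite h //; exact: ht.
- by move=> k' b hb ht'; case: (trueNfalse (ht' ord0)).
- by move=> k' b hb ht'; apply/esym/getI_mono; apply: cmono; apply: dmono.
Qed.
End Simplex.

Lemma pn_join_act m n (f : dhom m n) (s : PN V n) :
  pn_join (act f s) = act f (pn_join s).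
Proof.
apply: join_simplex_eq => //= k a hs ht; first exact: dhom_eq.
by apply: join_simplex_eq => // k' c hs' ht' /=; apply: getI_irr.
Qed.

Definition pn_join_smor : smor (PN V) (join (Delta N) (cone K)) :=
  @SMor (PN V) (join (Delta N) (cone K)) pn_join pn_join_act.
End PosetToJoin.

Lemma jpn_pn_join (I : finType) m N (a : dhom m N) n
    (s : PN (joinP m (optP I)) n) (t : PN (joinP N (optP I)) n) :
  (forall i, t i = match s i with inl j => inl (a j) | inr o => inr o end) ->
  jpn I a n (pn_join s) = t.
Proof.
move=> ht; apply: chain_eq => i; rewrite /= ht /jpn_vert.
case h: (isr (s i)).
  rewrite (@jvertT _ _ _ (pn_join s) i h) /jvr /=.
  case e: (s i) h => [j|[l|]] //= _; congr inr.
    have h' : jcut (pn_cone s (dconst 0 i)) ord0 = true by rewrite /= e.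
    rewrite /cvertex (jvertT h'); congr Some.
    have hs : iss (s i) = true by rewrite e.
    transitivity (getI hs); first exact: getI_irr.
    by have := getIE hs; rewrite {1}e => -[].
  by rewrite cvertexF //= e.
rewrite (@jvertF _ _ _ (pn_join s) i h) /jvl /=.
by case: (s i) h.
Qed.

Definition pullback_fst (X Y S : sset) (f : smor X S) (g : smor Y S) n
  (z : pullback f g n) : X n := (sval z).1.

Definition pullback_snd (X Y S : sset) (f : smor X S) (g : smor Y S) n
  (z : pullback f g n) : Y n := (sval z).2.

Definition slice_fun (X K : sset) (q : smor K X) n (z : slice q n) :
  smor (join (Delta n) K) X := sval z.

Section LimitFill.
Context (X S : sset) (p : smor X S) (I : finType) (N : nat).
Context (x : X 0) (f : I -> X 1) (hf : forall i, src (f i) = x).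
Let K := disc_sset I.
Let V := joinP N (optP I).
Hypothesis hlim : is_relative_limit p (cone_of hf).

(** The pushout product for joins: the boundary of the simplex joined with the whole cone, together
    with the simplex joined with the base of the cone. *)
Definition lim_dom n (s : PN V n) : Prop :=
  (exists j, forall i, s i != inl j) \/ (forall i, s i != inr None).

Lemma lim_dom_closed m n (a : dhom m n) (s : PN V n) :
  lim_dom s -> lim_dom (act a s).
Proof.
by case=> [[j h]|h]; [left; exists j => i; apply: h|right=> i; apply: h].
Qed.

Context (u : smor (subsset lim_dom_closed) X) (v : smor (PN V) S).
Hypothesis huv : forall n s, p n (u n s) = v n (sval s).
Hypothesis hedge : forall i h, u 1 (exist _ (cone_edge N i) h) = f i.
Hypothesis hpt : forall h, u 0 (exist _ (cone_pt I N) h) = x.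

Lemma u_irr n (s t : PN V n) (hs : lim_dom s) (ht : lim_dom t) : s = t ->
  u n (exist _ s hs) = u n (exist _ t ht).
Proof. by move=> e; congr (u n _); apply: eq_exist. Qed.

(** A simplex of the cone is pulled back from a leg or from the cone point, so [hedge] and [hpt]
    determine [u] there. *)
Lemma u_cone m (a : dhom m N) n (y : cone K n)
    (h : lim_dom (jpn I a n (join_inr (Delta m) (cone K) n y))) :
  u n (exist _ _ h) = cone_of hf n y.
Proof.
have hE i : lim_dom (cone_edge N i).
  by left; exists ord0; case=> [[|[|l]] hl].
have hP : lim_dom (cone_pt I N) by left; exists ord0.
rewrite /= /cone_of_fun; case: decP => [h1|h1].
  rewrite -(hedge (hE _)) -snat; congr (u n _); apply: eq_exist.
  exact: jpn_inrT.
rewrite -(hpt hP) /degen -snat; congr (u n _); apply: eq_exist.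
by apply: jpn_inrF; apply/negP.
Qed.

Lemma jpn_bdry m (a : dhom m N) n (s : join (Delta m) (cone K) n) :
  [exists j, [forall i, a i != j]] -> lim_dom (jpn I a n s).
Proof.
move=> /existsP[j /forallP ha]; left; exists j => i /=; rewrite /jpn_vert.
by case: (jvert s i) => [d|r] //=; apply/eqP => -[]; apply/eqP.
Qed.

Lemma jpn_base m (a : dhom m N) n (s : join (Delta m) K n) :
  lim_dom (jpn I a n (join_map (sidm _) (join_inr (Delta 0) K) n s)).
Proof.
right=> i; rewrite -[jpn _ _ _ _ i]/(jpn_vert a _ i) /jpn_vert.
set s' := join_map _ _ n s; case h: (jcut s' i); last by rewrite (jvertF h).
rewrite (jvertT h) /cvertex.
by rewrite (@jvertT _ _ _ (jvr h) ord0 erefl).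
Qed.

Program Definition lim_u0 m (a : boundary N m) : smor (join (Delta m) (cone K)) X :=
  @SMor (join (Delta m) (cone K)) X
    (fun n s => u n (exist _ (jpn I (sval a) n s) (jpn_bdry s (svalP a)))) _.
Next Obligation.
by move=> m a k n b s; rewrite -snat; apply: u_irr; rewrite snat.
Qed.

Program Definition lim_u : smor (boundary N) (slice (cone_of hf)) :=
  @SMor (boundary N) (slice (cone_of hf))
    (fun m a => exist _ (lim_u0 a) (fun k y => u_cone (jpn_bdry _ (svalP a)))) _.
Next Obligation.
move=> l m b a; apply: eq_exist; apply: smor_eq => k s /=; apply: u_irr.
exact: jpn_nat.
Qed.

Program Definition lim_v1 m (a : dhom m N) : smor (join (Delta m) K) X :=
  @SMor (join (Delta m) K) X (fun n s => u n (exist _ _ (jpn_base a s))) _.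
Next Obligation.
by move=> m a k n b s; rewrite -snat; apply: u_irr; rewrite !snat.
Qed.

Lemma lim_v1_slice m (a : dhom m N) k y :
  lim_v1 a k (join_inr (Delta m) K k y) =
  scomp (cone_of hf) (join_inr (Delta 0) K) k y.
Proof.
have e : join_map (sidm (Delta m)) (join_inr (Delta 0) K) k (join_inr (Delta m) K k y) =
    join_inr (Delta m) (cone K) k (join_inr (Delta 0) K k y).
  apply: join_simplex_eq => // l b hs ht.
    by case: (trueNfalse (hs ord0)).
  exact: (snat (join_inr (Delta 0) K) b y).
have h := jpn_base a (join_inr (Delta m) K k y).
rewrite /= (u_irr (jpn_base _ _) (eq_ind _ _ h _ (congr1 (jpn I a k) e)) (congr1 (jpn I a k) e)).
exact: u_cone.
Qed.

Lemma lim_v2_slice m (a : dhom m N) k y :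
  scomp v (jpn I a) k (join_inr (Delta m) (cone K) k y) =
  scomp p (cone_of hf) k y.
Proof.
have h : lim_dom (jpn I a k (join_inr (Delta m) (cone K) k y)).
  left; exists ord0 => i; rewrite -[jpn _ _ _ _ i]/(jpn_vert a _ i) /jpn_vert.
  by rewrite jvert_inr.
by rewrite -[RHS](congr1 (p k) (u_cone h)) huv.
Qed.

Program Definition lim_v : smor (Delta N)
    (pullback (slice_post p (scomp (cone_of hf) (join_inr (Delta 0) K)))
      (slice_pre (j := join_inr (Delta 0) K) (q := scomp p (cone_of hf))
         (q' := scomp p (scomp (cone_of hf) (join_inr (Delta 0) K)))
         (fun _ _ => erefl))) :=
  @SMor (Delta N) _ (fun m a => exist _
    (exist _ (lim_v1 a) (@lim_v1_slice m a),
     exist _ (scomp v (jpn I a)) (@lim_v2_slice m a)) _) _.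
Next Obligation.
by move=> m a; apply: eq_exist; apply: smor_eq => k s /=; rewrite huv.
Qed.
Next Obligation.
move=> l m b a; apply: eq_exist; congr pair; apply: eq_exist; apply: smor_eq => k s /=.
  apply: u_irr; apply: (etrans (jpn_nat b a _)); congr (jpn I a k _).
  by apply: join_simplex_eq => // l' c hs ht /=; rewrite (Prop_irrelevance hs ht).
exact: (congr1 (v k) (jpn_nat b a s)).
Qed.

(** By transposition [u] and [v] become a lifting problem for the boundary of the simplex against
    the slice comparison, solved by [hlim]; the value at the top simplex is the extension. Agreement
    with [u] is checked separately for simplices avoiding the cone point, lying in the cone, or
    missing a vertex of the simplex. *)
Lemma limit_fill : exists w : smor (PN V) X,
  (forall n s, w n (sval s) = u n s) /\ (forall n s, p n (w n s) = v n s).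
Proof.
have [|w' [hw hpw]] := hlim (u := lim_u) (v := lim_v).
  move=> m a; apply: eq_exist; congr pair; apply: eq_exist; apply: smor_eq => k s /=.
    exact: u_irr.
  by rewrite huv.
pose g := sval (w' N (did N)).
have gslice k y : g k (join_inr (Delta N) (cone K) k y) = cone_of hf k y :=
  svalP (w' N (did N)) k y.
have g1 k s : g k (join_map (sidm _) (join_inr (Delta 0) K) k s) = lim_v1 (did N) k s.
  exact: (congr1 (fun z => slice_fun (pullback_fst z) k s) (hpw N (did N))).
have g2 k s : p k (g k s) = v k (jpn I (did N) k s).
  exact: (congr1 (fun z => slice_fun (pullback_snd z) k s) (hpw N (did N))).
have gbd m (a : boundary N m) k s :
    g k (join_map (Delta_map (sval a)) (sidm _) k s) = lim_u0 a k s.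
  have := congr1 (fun z => slice_fun z k s) (hw m a).
  by rewrite smor_Delta.
have jid n (s : PN V n) : jpn I (did N) n (pn_join s) = s.
  by apply: jpn_pn_join => i; case: (s i).
exists (scomp g (pn_join_smor I N)); split; last by move=> n s; rewrite /= g2 jid.
move=> n [s hs] /=.
have [hr|hr] := pselect (forall l, isr (s l) -> iss (s l)).
  rewrite (pn_joinKE hr) g1 /=; apply: u_irr.
  exact: (etrans (congr1 (jpn I (did N) n) (esym (pn_joinKE hr))) (jid n s)).
have [h0|h0] := boolP (isr (s ord0)).
  have hall i : isr (s i) = true by apply: isr_mono h0; apply: cmono.
  pose y := @jright _ _ _ (pn_join s) n (did n) hall.
  have e : pn_join s = join_inr (Delta N) (cone K) n y.
    apply: join_simplex_eq => //=.
    - by move=> k a ha ht; case: (trueNfalse (ht ord0)).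
    - move=> k a ha ht; apply: (etrans _ (pn_cone_act s (did n) a)).
      by congr (pn_cone s _); apply: dhom_eq.
  have hy : lim_dom (jpn I (did N) n (join_inr (Delta N) (cone K) n y)).
    by rewrite -e jid.
  rewrite e gslice -(u_cone hy); apply: u_irr; rewrite -e; exact: jid.
case: hs => [[j hj]|hn]; last first.
  case: hr => l; case e: (s l) => [?|[?|]] //= _.
  by have := hn l; rewrite e eqxx.
(* The boundary simplex [a] needs a value at every position of [s]. At positions in the cone it
   takes the last vertex occurring on the simplex side, which keeps it monotone and off [j]. *)
pose mx := maxord (fun j => [exists i, s i == inl j]).
have [hm1 hm2] : [exists i, s i == inl mx] /\
    forall j, [exists i, s i == inl j] -> j <= mx.
  apply: (maxordP (p := fun j => [exists i, s i == inl j])).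
  case e: (s ord0) h0 => [j0|] // _; exists j0; apply/existsP; exists ord0.
  by rewrite e.
pose af (i : 'I_n.+1) : 'I_N.+1 := if s i is inl j then j else mx.
have am (i i' : 'I_n.+1) : i <= i' -> af i <= af i'.
  rewrite /af => ii; have := cmono s ii; case e: (s i) => [a|a]; case e': (s i') => [b|b] //= _.
  by apply: hm2; apply/existsP; exists i; rewrite e.
pose a := DHom am.
have ha : [exists j, [forall i, a i != j]].
  apply/existsP; exists j; apply/forallP => i /=; rewrite /af.
  case e: (s i) => [b|b].
    by apply/eqP => eb; have := hj i; rewrite e eb eqxx.
  case/existsP: hm1 => i' /eqP ei'; apply/eqP => eb; have := hj i'.
  by rewrite ei' eb eqxx.
have sm (i i' : 'I_n.+1) : i <= i' ->
    @fle (joinP n (optP I)) (if s i is inr o then inr o else inl i)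
        (if s i' is inr o then inr o else inl i').
  by move=> ii; have := cmono s ii; case: (s i) => [b|b]; case: (s i').
pose s' : PN (joinP n (optP I)) n := @ChainSimplex (joinP n (optP I)) n _ sm.
have es i : s i = match s' i with inl j => inl (a j) | inr o => inr o end.
  by rewrite /s' /= /af; case e: (s i) => [b|b]; rewrite /= ?e.
have e : pn_join s = join_map (Delta_map a) (sidm _) n (pn_join s').
  apply: join_simplex_eq => //=.
  - by move=> i; case: (s i).
  - move=> k b hb ht; apply: dhom_eq => i /=.
    by have := hb i; rewrite /s' /= /af; case ei: (s (b i)) => [c|c]; rewrite /= ?ei /= ?ei.
  - move=> k b hb ht; apply: join_simplex_eq => //=.
      by move=> i; case: (s (b i)) => [c|[c|]].
    move=> k' c hc hc'.
    move: (getI (hc ord0)) (getI (hc' ord0)) (getIE (hc ord0)) (getIE (hc' ord0)).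
    by move=> i1 i2 e1; rewrite /s' /= e1 => -[->].
pose ab : boundary N n := exist _ a ha.
rewrite e (gbd n ab) /=; apply: u_irr; exact: jpn_pn_join es.
Qed.
End LimitFill.

(** * Families of cocartesian legs *)

(** Two lifts of one map along a trivial fibration are joined by a homotopy parametrized by [J]:
    they prescribe it on the constant simplices of [J], and [trivial_ext] supplies the rest. *)
Lemma trivial_homotopy (A X S Y : sset) (q : smor X S) (f g : smor A X)
    (r : smor X Y) : trivial_fibration q ->
  (forall n a, q n (f n a) = q n (g n a)) ->
  naturally_equiv (scomp r f) (scomp r g).
Proof.
move=> hq hfg.
pose v : smor (sprod A J) S := scomp q (scomp f (sfst A J)).
pose G0 n (b : sprod A J n) (x : X n) := exists c : bool,
  b.2 = (fun=> c) /\ x = if c then g n b.1 else f n b.1.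
have hG : plift q v G0.
  split.
  - move=> n [a b] x x' [c [/= e1 ->]] [c' [e2 ->]].
    by have := congr1 (fun t => t ord0) e2; rewrite /= e1 => ->.
  - move=> m n d [a b] x [c [/= e1 ->]]; exists c; rewrite /= e1; split=> //.
    by case: c {e1}; rewrite snat.
  - by move=> n [a b] x [c [_ ->]]; case: c; rewrite /= ?hfg.
have [H [hH _]] := trivial_ext hq hG.
apply: (@J_homotopy _ _ (scomp r H)) => n a /=; congr (r n _); apply: hH.
  by exists false.
by exists true.
Qed.

Section Star.
Context (I : finType).
Let W := PN (optP I).

Definition wconst n (o : option I) : W n :=
  @ChainSimplex (optP I) n (fun _ => o) (fun _ _ _ => @fle_refl (optP I) o).

Definition wedge (i : I) : W 1.
Proof.
refine (@ChainSimplex (optP I) 1 (fun l => if l == ord0 then None else Some i) _).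
by move=> [[|[|l]] hl] [[|[|l']] hl'] //= _; apply: fle_refl.
Defined.

Lemma act_wconst m n (f : dhom m n) o : act f (wconst n o) = wconst m o.
Proof. exact: chain_eq. Qed.

Lemma ocut_mono n (o : W n) (i j : 'I_n.+1) : i <= j ->
  (if isSome (o i) then ord_max else ord0 : 'I_2) <=
  (if isSome (o j) then ord_max else ord0 : 'I_2).
Proof. by move=> /(cmono o); case: (o i) => [a|] //; case: (o j). Qed.

Definition ocut n (o : W n) : dhom n 1 := DHom (ocut_mono o).

Lemma wlast n (o : W n) i a : o i = Some a -> o ord_max = Some a.
Proof.
move=> e; have := cmono o (leq_ord i : i <= (ord_max : 'I_n.+1)).
by rewrite e /= => /eqP <-.
Qed.

Lemma wlastN n (o : W n) : o ord_max = None -> o = wconst n None.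
Proof.
move=> h; apply: chain_eq => i /=; case e: (o i) => [a|//].
by rewrite (wlast e) in h.
Qed.

Context (A X : sset) (h : smor A X) (H : I -> smor (sprod A (Delta 1)) X).
Hypothesis hH : forall i n a, H i n (a, dconst n ord0) = h n a.

(** All labelled vertices of a simplex of the cone carry one label, shown by the last vertex, and
    [ocut] records where they begin. Gluing is possible since every [H i] starts at [h]. *)
Definition star_fun n (ao : sprod A W n) : X n :=
  match ao.2 ord_max with
  | Some i => H i n (ao.1, ocut ao.2)
  | None => h n ao.1
  end.

Lemma star_nat m n (f : dhom m n) (ao : sprod A W n) :
  star_fun (act f ao) = act f (star_fun ao).
Proof.
case: ao => a o; rewrite /star_fun /=.
case e: (o (f ord_max)) => [i|].
  by rewrite (wlast e) -snat; congr (H i _ (_, _)); apply: dhom_eq.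
case e': (o ord_max) => [i|]; rewrite -snat //.
rewrite -(hH i); congr (H i _ (_, _)); apply: dhom_eq => l /=.
have hl : (act f o : W m) ord_max = None by [].
by rewrite -[o (f l)]/((act f o : W m) l) (wlastN hl).
Qed.

Definition star : smor (sprod A W) X := @SMor (sprod A W) X star_fun star_nat.

Lemma starN n a : star n (a, wconst n None) = h n a. Proof. by []. Qed.

Lemma starS n a i : star n (a, wconst n (Some i)) = H i n (a, dconst n ord_max).
Proof. by rewrite /= /star_fun /=; congr (H i _ (_, _)); apply: dhom_eq. Qed.

Lemma star_wedge a i : star 1 (a, wedge i) = H i 1 (a, did 1).
Proof.
rewrite /= /star_fun /=; congr (H i _ (_, _)); apply: dhom_eq => l.
by case: (ord2_case l) => ->.
Qed.
End Star.

Definition pt_map (X : sset) (x : X 0) : smor (Delta 0) X := ymap x.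

Definition edge_map (X : sset) (e : X 1) : smor (sprod (Delta 0) (Delta 1)) X :=
  scomp (ymap e) (ssnd (Delta 0) (Delta 1)).

Lemma edge_map_src (X : sset) (x : X 0) (e : X 1) n a : src e = x ->
  edge_map e n (a, dconst n ord0) = pt_map x n a.
Proof.
move=> <-; rewrite /= /src act_act; exact: act_congr.
Qed.

Section Z.
Context (C M : sset) (p : smor M (sprod C NFin)) (n : nat).
Let W := PN (optP 'I_n).

(** The diagram formed by all the [rho_map i] under the common source; [star] expects a parameter
    space, whence the factor [Delta 0] that [rhoW] removes. *)
Definition rhoW0 : smor (sprod (Delta 0) W) NFin :=
  star (h := pt_map (vFin n)) (H := fun i => edge_map (eFin (rho_map i)))
    (fun i k a => edge_map_src a (src_eFin (rho_map i))).

Definition rhoW k (o : W k) : NFin k := rhoW0 k (dconst k ord0, o).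

Lemma rhoW_act k l (f : dhom l k) (o : W k) : rhoW (act f o) = act f (rhoW o).
Proof. by rewrite /rhoW -snat; congr (rhoW0 _ (_, _)); apply: dhom_eq. Qed.

(** The component in [C] does not vary along the cone and is recorded separately. Legs are required
    to be cocartesian over vertices only. *)
Definition rho_family k (cz : sprod C (Fun W M) k) : Prop :=
  (forall l (a : Delta k l) (o : W l),
     p l (@sfun (sprod (Delta k) W) M cz.2 l (a, o)) = (act a cz.1, rhoW o)) /\
  (forall (a : Delta k 0) i,
     is_cocartesian p (@sfun (sprod (Delta k) W) M cz.2 1 (degen 1 a, wedge i))).

Lemma rho_family_closed l k (f : dhom l k) (cz : sprod C (Fun W M) k) :
  rho_family cz -> rho_family (act f cz).
Proof.
case: cz => c z [h1 h2]; split=> /=.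
  by move=> j a o; rewrite h1 /= act_act.
move=> a i; have := h2 (dcomp f a) i.
by congr (is_cocartesian p (@sfun (sprod _ _) _ _ _ (_, _))); apply: dhom_eq.
Qed.

(* PN (optP 'I_n) is the cone on n points; a vertex of Z is a choice of cocartesian
   legs [M -> M_i] over the rho^i, together with the cone they form. *)
Definition Z : sset := subsset rho_family_closed.

Definition Zfun k (z : Z k) : smor (sprod (Delta k) W) M := (sval z).2.
Definition Zbase k (z : Z k) : C k := (sval z).1.

Lemma Zfun_act k l (f : dhom l k) (z : Z k) j (a : Delta l j) o :
  Zfun (act f z) j (a, o) = Zfun z j (dcomp f a, o).
Proof. by []. Qed.

Lemma Zover k (z : Z k) l (a : Delta k l) (o : W l) :
  p l (Zfun z l (a, o)) = (act a (Zbase z), rhoW o).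
Proof. exact: (svalP z).1. Qed.

Lemma Zcocart k (z : Z k) (a : Delta k 0) i :
  is_cocartesian p (Zfun z 1 (degen 1 a, wedge i)).
Proof. exact: (svalP z).2. Qed.

Lemma rhoWN k : rhoW (wconst k None) = degen k (vFin n).
Proof. by rewrite /rhoW /rhoW0 starN. Qed.

Lemma rhoWS k i : rhoW (wconst k (Some i)) = degen k (vFin 1).
Proof. by rewrite /rhoW /rhoW0 starS; apply: (eFin_target (rho_map i) k). Qed.

Lemma rhoW_edge i : rhoW (wedge i) = eFin (rho_map i).
Proof. by rewrite /rhoW /rhoW0 star_wedge; apply: (act_did (eFin (rho_map i))). Qed.

Program Definition Zpt : smor Z (fib p n) :=
  @SMor Z (fib p n) (fun k z => exist _ (Zfun z k (did k, wconst k None)) _) _.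
Next Obligation. by move=> k z; apply: (etrans _ (rhoWN k)); rewrite /= Zover. Qed.
Next Obligation.
move=> k l f z; apply: eq_exist; rewrite Zfun_act -snat.
by congr (Zfun z _ (_, _)); apply: dhom_eq.
Qed.

Lemma Zleg_fib k (z : Z k) (i : 'I_n) :
  scomp (ssnd C NFin) p k (Zfun z k (did k, wconst k (Some i))) = degen k (vFin 1).
Proof. by apply: (etrans _ (rhoWS k i)); rewrite /= Zover. Qed.

Definition Zleg k (z : Z k) (i : 'I_n) : fib p 1 k :=
  exist _ (Zfun z k (did k, wconst k (Some i))) (Zleg_fib z i).

Lemma Zleg_over k (z : Z k) (i : 'I_n) : fib_proj p 1 k (Zleg z i) = Zbase z.
Proof. by rewrite /= Zover /= act_did. Qed.

Program Definition Zlegs : smor Z (fiber_power 'I_n (fib_proj p 1)) :=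
  @SMor Z (fiber_power 'I_n (fib_proj p 1))
    (fun k z => exist _ (Zbase z, Zleg z) (Zleg_over z)) _.
Next Obligation.
move=> k l f z; apply: eq_exist; congr pair; apply/funext => i; apply: eq_exist.
rewrite Zfun_act -snat; by congr (Zfun z _ (_, _)); apply: dhom_eq.
Qed.

Section Transport.
Context (rho : forall i : 'I_n, rho_transport p i).

Definition Zsec0 : smor (sprod (fib p n) W) M :=
  star (h := fiber_incl (scomp (ssnd C NFin) p) (vFin n))
    (H := fun i => rho_htpy (rho i)) (fun i k x => rho_htpy_start (rho i) x).

Lemma Zsec_family k (x : fib p n k) :
  rho_family (fib_proj p n k x, curry_smor Zsec0 k x).
Proof.
split=> /=.
  move=> l a o; rewrite /star_fun /rhoW /= /star_fun /=.
  case e: (o ord_max) => [i|].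
    by rewrite rho_htpy_over snat.
  by apply: (etrans (fib_over (act a x))); congr pair; apply: snat.
move=> a i; rewrite -[star_fun _ _ _]/(Zsec0 1 (act (degen (X := Delta k) 1 a) x, wedge i)).
rewrite star_wedge.
have := @rho_htpy_cocart _ _ _ _ _ (rho i) (act a x).
congr (is_cocartesian p (rho_htpy _ _ (_, _))).
by rewrite /degen act_act.
Qed.

Program Definition Zsec : smor (fib p n) Z :=
  @SMor (fib p n) Z (fun k x => exist _ _ (Zsec_family x)) _.
Next Obligation.
move=> k l f x; apply: eq_exist; congr pair; first exact: snat.
exact: (snat (curry_smor Zsec0)).
Qed.

Lemma Zpt_sec k (x : fib p n k) : Zpt k (Zsec k x) = x.
Proof.
case: x => x hx; apply: eq_exist.
by rewrite /= /star_fun /= act_did.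
Qed.

Lemma Zlegs_sec k (x : fib p n k) : Zlegs k (Zsec k x) = rho_tuple rho k x.
Proof.
apply: eq_exist; congr pair; apply/funext => i; apply: eq_exist.
rewrite -[Zfun _ _ _]/(Zsec0 k (act (did k) x, wconst k (Some i))) starS.
by rewrite act_did.
Qed.
End Transport.
End Z.

(** * Filling prisms over the cone *)

Definition minord n (p : pred 'I_n.+1) : 'I_n.+1 :=
  odflt ord0 [pick a | p a && [forall b, p b ==> (a <= b)]].

Lemma minordP n (p : pred 'I_n.+1) : (exists a, p a) ->
  p (minord p) /\ forall b, p b -> minord p <= b.
Proof.
case=> a0 p0; case: (arg_minnP (fun a : 'I_n.+1 => a : nat) p0) => a pa ha.
rewrite /minord; case: pickP => [b|/(_ a)].
  by case/andP=> pb /forallP hb; split=> // c; apply/implyP/hb.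
rewrite pa /= => /negbT/negP[]; apply/forallP => b; apply/implyP; exact: ha.
Qed.

Lemma eq_minord n (p p' : pred 'I_n.+1) : p =1 p' -> minord p = minord p'.
Proof.
move=> e; rewrite /minord; congr odflt; apply: eq_pick => a; rewrite e.
by congr andb; apply: eq_forallb => b; rewrite e.
Qed.

Section Prism.
Context (N : nat) (I : finType).
Let V := prodP (ordP N) (optP I).
Implicit Types (T : {set V}) (z : V).

(** Fails exactly for the sets lying over the boundary of the simplex, one level being missed. *)
Definition proj_full T : bool := [forall i, exists z in T, z.1 == i].

Lemma proj_fullP T : reflect (forall i, exists2 z, z \in T & z.1 = i) (proj_full T).
Proof.
apply: (iffP forallP) => h i.
  by have /exists_inP[z zT /eqP e] := h i; exists z.
by have [z zT e] := h i; apply/exists_inP; exists z => //; apply/eqP.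
Qed.

Lemma proj_full_sub T T' : T' \subset T -> proj_full T' -> proj_full T.
Proof.
move=> /subsetP s /proj_fullP h; apply/proj_fullP => i.
by have [z zT e] := h i; exists z => //; apply: s.
Qed.

Lemma prism_label T x y i j : fchain T -> (x, Some i) \in T -> (y, Some j) \in T ->
  i = j.
Proof.
move=> /fchainP[_ cT] h1 h2; have := cT _ _ h1 h2.
by rewrite /=; case/orP => /andP[_ /eqP[]].
Qed.

Lemma prism_le T x y i : fchain T -> (x, None) \in T -> (y, Some i) \in T -> x <= y.
Proof.
move=> /fchainP[_ cT] h1 h2; have := cT _ _ h1 h2.
by rewrite /=; case/orP => /andP[].
Qed.

(* The pivot of a chain is [(b, None)], [b] being the first level of its part in the
   base of the cone. *)
Section FromCone.
Context (N0 : 0 < N).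

Let P : pred {set V} := fun T => ~~ proj_full T || [forall z in T, z.2 == None].
Let bm T : 'I_N.+1 := minord (fun x => [exists i, (x, Some i) \in T]).
Let t T : V := (bm T, None).

Lemma bmP T : ~~ P T ->
  (exists i, (bm T, Some i) \in T) /\ forall x i, (x, Some i) \in T -> bm T <= x.
Proof.
rewrite negb_or => /andP[_]; rewrite negb_forall_in => /exists_inP[[x [i|]] zT //= _].
have [|h1 h2] := @minordP N (fun x => [exists i, (x, Some i) \in T]).
  by exists x; apply/existsP; exists i.
split; first by apply/existsP.
by move=> y j h; apply: h2; apply/existsP; exists j.
Qed.

(** The pivot is an inner vertex unless it is the least one; then [b = 0] and the first edge is a
    leg over the vertex 0, cocartesian by hypothesis. When deleting a vertex changes the pivot of a
    remaining chain, [b] rises and the rank [N - b] drops. *)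
Lemma prism_from_cone (X S : sset) (q : smor X S) (v : smor (PN V) S) G :
  inner_fibration q -> plift q v G -> has_dom V X G P ->
  (forall i, exists f, G 1 (pn_pair N (optP I) 1 (dconst 1 ord0, wedge i)) f /\
     is_cocartesian q f) ->
  extends_to q v G (@fchain V).
Proof.
move=> hq hG hP hco.
have tU T : bm (t T |: T) = bm T.
  apply: eq_minord => x; apply: eq_existsb => i.
  by rewrite in_setU1 xpair_eqE andbF.
have tD T : bm (T :\ t T) = bm T.
  apply: eq_minord => x; apply: eq_existsb => i.
  by rewrite in_setD1 xpair_eqE andbF.
apply: (pairing (t := t) (rk := fun T => N - bm T) _ _ hG hP) => //.
- by move=> T T' s n0; apply: fchain_sub.
- move=> T T' s n0 /orP[h|/forall_inP h]; apply/orP; [left|right].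
    by apply: contra h; apply: proj_full_sub.
  by apply/forall_inP => z /(subsetP s); apply: h.
- move=> T cT PT; have [[i bT] bmin] := bmP PT.
  have bT' : (bm T, Some i) \in T :\ t T by rewrite in_setD1 bT xpair_eqE andbF.
  split.
  + apply/fchainP; split; first by apply/set0Pn; exists (t T); rewrite setU11.
    have hz z : z \in T -> fle z (t T) || fle (t T) z.
      case: z => x [j|] zT; apply/orP; [right|left]; rewrite /= ?andbT.
        by rewrite (bmin _ _ zT).
      by rewrite (prism_le cT zT bT).
    move=> a b /setU1P[->|aT] /setU1P[->|bT2]; first by rewrite fle_refl.
    * by rewrite orbC hz.
    * by rewrite hz.
    * by case/fchainP: cT => _ -> .
  + have := PT; rewrite !negb_or negbK => /andP[/proj_fullP g1 _].
    rewrite negbK; apply/andP; split.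
      apply/proj_fullP => j; have [z zT e] := g1 j.
      have [ez|nz] := eqVneq z (t T); last by exists z => //; rewrite in_setD1 nz.
      by exists (bm T, Some i) => //; rewrite -e ez.
    by rewrite negb_forall_in; apply/exists_inP; exists (bm T, Some i).
  + by apply/set0Pn; exists (bm T, Some i).
  + by rewrite /t tU.
  + by rewrite /t tD.
- move=> T cT PT tT j jT jt; have [[i bT] bmin] := bmP PT.
  have [//|PTj] := boolP (P (T :\ j)); rewrite /=.
  have [[i' bT'] bmin'] := bmP PTj.
  have le : bm T <= bm (T :\ j).
    by apply: (bmin _ i'); move: bT'; rewrite in_setD1 => /andP[].
  have [e|ne] := eqVneq j (bm T, Some i).
    apply/orP; right; have lt : bm T < bm (T :\ j).
      rewrite ltn_neqAle le andbT; apply/eqP => /val_inj e'.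
      move: bT'; rewrite -e' in_setD1 e => /andP[ne bT'].
      by case/eqP: ne; congr pair; congr Some; apply: prism_label cT bT' bT.
    have hm (a b : nat) : a < b -> b <= N -> N - b < N - a by lia.
    exact: hm lt (leq_ord _).
  have ebm : bm (T :\ j) = bm T.
    apply: val_inj; apply/eqP; rewrite eqn_leq le andbT.
    by apply: (bmin' _ i); rewrite in_setD1 bT eq_sym ne.
  have -> : t (T :\ j) = t T by rewrite /t ebm.
  by rewrite in_setD1 eq_sym jt tT.
- by move=> T cT PT; rewrite /t tU.
- move=> T cT PT tT; have [[i bT] bmin] := bmP PT.
  have bt : (bm T, Some i) != t T by rewrite xpair_eqE andbF.
  have tb : fle (t T) ((bm T, Some i) : V) by rewrite /= leqnn.
  have [/exists_inP[z zT /andP[zt zle]]|hno] :=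
      boolP [exists z in T, (z != t T) && fle z (t T)].
    left; split=> //; exists z, (bm T, Some i); split=> //.
    by rewrite zle tb.
  right.
  have hmin z : z \in T -> z != t T -> ~~ fle z (t T).
    move=> zT zt; apply/negP => zle; case/negP: hno; apply/exists_inP.
    by exists z => //; rewrite zt.
  have := PT; rewrite !negb_or negbK => /andP[/proj_fullP g1 _].
  have b0 : bm T = ord0.
    have [[x [j|]] zT /= e] := g1 ord0; subst x.
      by apply: val_inj; apply/eqP; rewrite -leqn0; apply: bmin zT.
    have [|nz] := eqVneq ((ord0, None) : V) (t T); first by case.
    by have := hmin _ zT nz; rewrite /=.
  have [f [Gf cf]] := hco i.
  set e := pn_pair N (optP I) 1 (dconst 1 ord0, wedge i) in Gf *.
  have e0 : e ord0 = t T by rewrite /t b0.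
  have e1 : e ord_max = (bm T, Some i) by rewrite b0.
  exists e, f; rewrite e1; split=> //.
  (* [0 < N] provides a third member, at the last level. *)
  + have [z zT ez] := g1 ord_max.
    have u : uniq [:: t T; (bm T, Some i); z].
      have zb : z.1 != bm T by rewrite ez b0 -val_eqE /= -lt0n.
      have nz w : w.1 = bm T -> w != z by move=> ew; apply: contra zb => /eqP <-; apply/eqP.
      by rewrite /= !inE !negb_or [t T == _]eq_sym bt !nz.
    have /card_uniqP/= <- := u.
    apply: subset_leq_card; apply/subsetP => w.
    by rewrite !inE => /or3P[] /eqP->.
  + split=> // -[x [j|]] zT zt /=.
      by rewrite (prism_label cT bT zT) (bmin _ _ zT) /= eqxx ?orbT.
    have := hmin _ zT zt; rewrite /= andbT.
    by rewrite (prism_le cT zT bT).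
Qed.
End FromCone.

(* The pivot of a chain is [(b, Some i)], [b] being the last level of its part over
   the cone point; only the simplices through [(ord_max, None)] are left over, and
   these are supplied by the limit property. *)
Section FromBase.
Let P : pred {set V} := fun T => ~~ proj_full T || [forall z in T, z.2 != None].

Definition base_stage : pred {set V} := fun T =>
  fchain T && (P T || ((ord_max, None) \notin T)).

Let bM T : 'I_N.+1 := maxord (fun x => (x, None) \in T).
Let lb T : option I := odflt None [pick o | (o != None) && [exists x, (x, o) \in T]].
Let t T : V := (bM T, lb T).

Lemma bMP T : ~~ P T ->
  (bM T, None) \in T /\ forall x, (x, None) \in T -> x <= bM T.
Proof.
rewrite negb_or => /andP[_]; rewrite negb_forall_in => /exists_inP[[x o] zT].
rewrite negbK /= => /eqP e; subst o.
by apply: (maxordP (p := fun x => (x, None) \in T)); exists x.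
Qed.

Lemma lb_eq T x i : fchain T -> (x, Some i) \in T -> lb T = Some i.
Proof.
move=> cT xT; rewrite /lb; case: pickP => [[j|] //= /existsP[y yT]|/(_ (Some i))].
  by congr Some; apply: prism_label cT yT xT.
by move/negbT/negP => -[]; apply/existsP; exists x.
Qed.

Lemma downward_base : downward V base_stage.
Proof.
move=> T T' s n0 /andP[cT h]; apply/andP; split; first exact: fchain_sub cT.
case/orP: h => [/orP[h|/forall_inP h]|h]; apply/orP; [left|left|right].
- by apply/orP; left; apply: contra h; apply: proj_full_sub.
- by apply/orP; right; apply/forall_inP => z /(subsetP s); apply: h.
- by apply: contra h; apply: (subsetP s).
Qed.

(** Lacking [(ord_max, None)], a remaining chain contains some [(ord_max, Some i)], and its part
    over the cone point ends before the last level. The pivot therefore lies strictly between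
    [(b, None)] and [(ord_max, Some i)], and inner horns suffice. *)
Lemma prism_from_base (X S : sset) (q : smor X S) (v : smor (PN V) S) G :
  inner_fibration q -> plift q v G -> has_dom V X G P ->
  extends_to q v G base_stage.
Proof.
move=> hq hG hP.
have facts T : base_stage T -> ~~ P T -> exists i, [/\ fchain T,
    (ord_max, Some i) \in T, (bM T, None) \in T, bM T < N & lb T = Some i].
  move=> /andP[cT QT] PT; rewrite (negPf PT) /= in QT.
  have [h1 h2] := bMP PT.
  have := PT; rewrite !negb_or negbK => /andP[/proj_fullP g1 _].
  have [[x [i|]] zT /= e] := g1 ord_max; subst x; last by rewrite zT in QT.
  exists i; split=> //; last exact: lb_eq zT.
  rewrite ltn_neqAle -ltnS ltn_ord andbT; apply: contra QT => /eqP e.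
  by rewrite -(_ : bM T = ord_max) //; apply: val_inj.
have tU T i : lb T = Some i -> bM (t T |: T) = bM T.
  by move=> e; apply: eq_maxord => x; rewrite in_setU1 xpair_eqE e andbF.
have tD T i : lb T = Some i -> bM (T :\ t T) = bM T.
  by move=> e; apply: eq_maxord => x; rewrite in_setD1 xpair_eqE e andbF.
have chU T : base_stage T -> ~~ P T -> fchain (t T |: T).
  move=> QT PT; have [i [cT mT bT bN el]] := facts T QT PT.
  have [h1 h2] := bMP PT.
  apply/fchainP; split; first by apply/set0Pn; exists (t T); rewrite setU11.
  have hz z : z \in T -> fle z (t T) || fle (t T) z.
    case: z => x [j|] zT; apply/orP; [right|left]; rewrite /= ?andbT.
      by rewrite (prism_le cT bT zT) el (prism_label cT mT zT) eqxx orbT.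
    by rewrite h2.
  move=> a b /setU1P[->|aT] /setU1P[->|bT2]; first by rewrite fle_refl.
  * by rewrite orbC hz.
  * by rewrite hz.
  * by case/fchainP: cT => _ -> .
apply: (pairing (t := t) (rk := fun T => bM T) _ _ hG hP) => //.
- exact: downward_base.
- by move=> T /andP[].
- move=> T T' s n0 /orP[h|/forall_inP h]; apply/orP; [left|right].
    by apply: contra h; apply: proj_full_sub.
  by apply/forall_inP => z /(subsetP s); apply: h.
- by move=> T cT PT; rewrite /base_stage cT PT.
- move=> T QT PT; have [i [cT mT bT bN el]] := facts T QT PT.
  have mT' : (ord_max, Some i) \in T :\ t T.
    rewrite in_setD1 mT andbT xpair_eqE negb_and -val_eqE /= neq_ltn bN.
    by rewrite orbT.
  have bT' : (bM T, None) \in T :\ t T.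
    by rewrite in_setD1 bT andbT xpair_eqE negb_and el orbT.
  have cU := chU T QT PT.
  have cD : fchain (T :\ t T).
    by apply: fchain_sub cT; [apply: subsetDl|apply/set0Pn; exists (bM T, None)].
  split.
  + apply/andP; split=> //; apply/orP; right.
    move: QT => /andP[_]; rewrite (negPf PT) /=; apply: contra.
    by rewrite in_setU1 xpair_eqE el andbF.
  + have := PT; rewrite !negb_or negbK => /andP[/proj_fullP g1 _].
    rewrite negbK; apply/andP; split.
      apply/proj_fullP => j; have [z zT e] := g1 j.
      have [ez|nz] := eqVneq z (t T); last by exists z => //; rewrite in_setD1 nz.
      by exists (bM T, None) => //; rewrite -e ez.
    by rewrite negb_forall_in; apply/exists_inP; exists (bM T, None).
  + by apply/set0Pn; exists (bM T, None).
  + have el' : lb (t T |: T) = Some i.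
      by apply: (lb_eq cU (x := ord_max)); rewrite in_setU1 mT orbT.
    by rewrite -[LHS]/(bM _, lb _) (tU _ _ el) el' -el.
  + have el' : lb (T :\ t T) = Some i by apply: (lb_eq cD (x := ord_max)).
    by rewrite -[LHS]/(bM _, lb _) (tD _ _ el) el' -el.
- move=> T QT PT tT j jT jt; have [i [cT mT bT bN el]] := facts T QT PT.
  have [h1 h2] := bMP PT.
  have [//|PTj] := boolP (P (T :\ j)); rewrite /=.
  have [g1 g2] := bMP PTj.
  have le : bM (T :\ j) <= bM T.
    by apply: h2; move: g1; rewrite in_setD1 => /andP[].
  have [e|ne] := eqVneq j (bM T, None).
    apply/orP; right; rewrite ltn_neqAle le andbT; apply/eqP => /val_inj e'.
    by move: g1; rewrite e' e in_setD1 eqxx.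
  have ebM : bM (T :\ j) = bM T.
    apply: val_inj; apply/eqP; rewrite eqn_leq le /=; apply: g2.
    by rewrite in_setD1 bT eq_sym ne.
  have tT' : t T \in T :\ j by rewrite in_setD1 eq_sym jt tT.
  have -> : t (T :\ j) = t T.
    rewrite -[LHS]/(bM _, lb _) ebM /t el; congr pair; apply: (lb_eq (x := bM T)).
      apply: fchain_sub cT; first exact: subsetDl.
      by apply/set0Pn; exists (t T).
    by rewrite -el.
  by rewrite tT'.
- by move=> T QT PT; have [i [cT mT bT bN el]] := facts T QT PT; rewrite (tU _ _ el).
- move=> T QT PT tT; have [i [cT mT bT bN el]] := facts T QT PT.
  left; split=> //; exists (bM T, None), (ord_max, Some i); split=> //.
  + by rewrite xpair_eqE el andbF.
  + by rewrite xpair_eqE negb_and -val_eqE /= neq_ltn bN orbT.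
  + by rewrite /= leqnn el eqxx orbT (ltnW bN).
Qed.
End FromBase.
End Prism.

(** * From (c-i) to (c-ii) *)

Lemma sval_inj (A : Type) (P : A -> Prop) (x y : {a | P a}) : sval x = sval y -> x = y.
Proof. by case: x y => x hx [y hy] /= e; apply: eq_exist. Qed.

Section PrismLimit.
Context (N : nat) (I : finType).
Let V := prodP (ordP N.+1) (optP I).
Let V' := joinP N (optP I).

(** A chain through [(ord_max, None)] stays over the cone point before the last level. Such chains
    live in the join of the first [N.+1] levels with the cone at the last one, where the limit
    property applies. *)
Definition slab (z : V') : V :=
  match z with
  | inl j => (widen_ord (leqnSn N.+1) j, None)
  | inr o => (ord_max, o)
  end.

Definition unslab (z : V) : V' :=
  if z.1 == ord_max then inr z.2 else inl (inord z.1).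

Lemma slab_mono z z' : fle z z' -> fle (slab z) (slab z').
Proof.
case: z => [j|o]; case: z' => [j'|o'] //=; first by rewrite andbT.
  by move=> _; rewrite andbT ltnW // ltn_ord.
by rewrite leqnn.
Qed.

Lemma slabK : cancel slab unslab.
Proof.
case=> [j|o]; rewrite /unslab /= ?eqxx //.
have -> : (widen_ord (leqnSn N.+1) j == ord_max) = false.
  by apply/negbTE; rewrite -val_eqE neq_ltn /= ltn_ord.
by rewrite inord_val.
Qed.

Lemma unslabK z : (z.1 == ord_max) || (z.2 == None) -> slab (unslab z) = z.
Proof.
case: z => x o; rewrite /unslab /=; case: eqP => [->//|/eqP xm /= /eqP->].
congr pair; apply: val_inj => /=; rewrite inordK //.
by rewrite ltn_neqAle -ltnS ltn_ord andbT; move: xm; rewrite -val_eqE.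
Qed.

Lemma unslab_mono z z' : fle z z' -> fle (unslab z) (unslab z').
Proof.
case: z z' => [x o] [x' o'] /= /andP[le1 le2]; rewrite /unslab /=.
have [ex|nx] := eqVneq x ord_max; have [ex'|nx'] := eqVneq x' ord_max => //=.
  subst x; case/eqP: nx'; apply: val_inj; apply/eqP.
  by rewrite eqn_leq le1 /= -ltnS ltn_ord.
have hx (y : 'I_N.+2) : y != ord_max -> y < N.+1.
  by rewrite ltn_neqAle -[y <= N.+1]ltnS ltn_ord andbT -val_eqE.
by rewrite !inordK ?hx.
Qed.

Definition slab_map : smor (PN V') (PN V) :=
  @SMor (PN V') (PN V)
    (fun n s => @ChainSimplex V n (fun i => slab (s i))
       (fun i j ij => slab_mono (cmono s ij)))
    (fun m n f s => @chain_eq V m _ _ (fun i => erefl)).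

(** What [base_stage] leaves out lies in the image of [slab_map], and the part already covered pulls
    back to exactly [lim_dom]; a single attachment by [limit_fill] finishes. *)
Lemma prism_limit (X S : sset) (q : smor X S) (v : smor (PN V) S) G
    (x : X 0) (f : I -> X 1) (hf : forall i, src (f i) = x) :
  is_relative_limit q (cone_of hf) -> plift q v G ->
  has_dom V X G (@base_stage N.+1 I) ->
  G 0 (pn_pair N.+1 (optP I) 0 (dconst 0 ord_max, wconst 0 None)) x ->
  (forall i, G 1 (pn_pair N.+1 (optP I) 1 (dconst 1 ord_max, wedge i)) (f i)) ->
  extends_to q v G (@fchain V).
Proof.
move=> hlim hG dG Gx Gf.
have stageE n (b : PN V n) : pdom G b <->
    (~~ proj_full (supp b) \/ (forall k, (b k).2 != None)) \/
    (forall k, b k != (ord_max, None)).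
  rewrite dG /base_stage fchain_supp /=; split.
    case/orP=> [/orP[h|/forall_inP h]|h]; [left; left|left; right|right] => //.
      by move=> k; apply: h; apply: (supp_in b).
    by move=> k; apply: contra h => /eqP <-; apply: (supp_in b).
  case=> [[h|h]|h]; apply/orP; [left|left|right].
  - by rewrite h.
  - by apply/orP; right; apply/forall_inP => z /(suppP b)[k ->].
  - by apply/negP => /(suppP b)[k e]; case/eqP: (h k).
have [||||G' [hG' GG' dG']] := @attach_lift _ _ _ _ _
    (subsset_incl (@lim_dom_closed I N)) q v G slab_map hG.
- move=> n [s [[j hj]|hs]] /=; apply/stageE; [left; left|right].
    apply/proj_fullP => /(_ (widen_ord (leqnSn N.+1) j))[z /(suppP (slab_map n s))[k ->]].
    move=> /= e; have := hj k; case: (s k) e => [j'|o] /= /(congr1 val) /= e.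
      by rewrite (_ : j' = j) ?eqxx //; apply: val_inj.
    by have := ltn_ord j; rewrite -e ltnn.
  move=> k /=; have := hs k; case: (s k) => [j|o] /=.
    by rewrite xpair_eqE -val_eqE /= eqn_leq [N.+1 <= j]leqNgt ltn_ord andbF.
  by move=> ho; rewrite xpair_eqE eqxx /=; apply: contra ho => /eqP->.
- move=> n s hs; suff h : lim_dom s by exists (exist _ s h).
  have key : (forall k, s k != inr None) -> lim_dom s by right.
  case/stageE: hs => [[/proj_fullP h|h]|h].
  + have [j hj] : exists j : 'I_N.+2, forall k, (slab (s k)).1 != j.
      apply/not_existsP => h'; apply: h => j; have := h' j.
      move=> /existsNP[k /negP]; rewrite negbK => /eqP e.
      by exists (slab (s k)) => //; apply: (supp_in (slab_map n s)).
    have [ej|nj] := eqVneq j ord_max.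
      by apply: key => k; have := hj k; rewrite ej; case: (s k) => [j'|o] //=; rewrite eqxx.
    have jN : j < N.+1.
      by rewrite ltn_neqAle -[j <= N.+1]ltnS ltn_ord andbT; move: nj; rewrite -val_eqE.
    left; exists (Ordinal jN) => k; have := hj k; case: (s k) => [j'|o] //.
  + by apply: key => k; have := h k; rewrite /=; case: (s k) => [j'|[o|]].
  + apply: key => k; have := h k; rewrite /=; apply: contra => /eqP->.
    by rewrite /= eqxx.
- move=> n s s' e; right; apply: chain_eq => k; apply: (can_inj slabK).
  exact: (congr1 (fun b : PN V n => b k) e).
- move=> u hu.
  have huv n s : q n (u n s) = scomp v slab_map n (sval s).
    exact: (pl_over hG (hu n s)).
  apply: (limit_fill hlim huv).
    move=> i h; apply: (pl_fun hG (hu _ _)).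
    suff -> : slab_map 1 (sval (exist _ (cone_edge N i) h)) =
      pn_pair N.+1 (optP I) 1 (dconst 1 ord_max, wedge i) by exact: Gf.
    by apply: chain_eq => k; case: (ord2_case k) => ->.
  move=> h; apply: (pl_fun hG (hu _ _)).
  suff -> : slab_map 0 (sval (exist _ (cone_pt I N) h)) =
    pn_pair N.+1 (optP I) 0 (dconst 0 ord_max, wconst 0 None) by exact: Gx.
  exact: chain_eq.
exists G'; split=> // n b; rewrite dG' fchain_supp; split=> // _.
have [h|nb] := pselect (pdom G b); [by left|right].
have [k0 ek0] : exists k, b k = (ord_max, None).
  apply/not_existsP => h; apply: nb; apply/stageE; right => k.
  by apply/eqP; apply: h.
have hb k : ((b k).1 == ord_max) || ((b k).2 == None).
  case: (leqP k k0) => kk0.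
    by have := cmono b kk0; rewrite ek0 /= orbb => /andP[_ ->]; rewrite orbT.
  have := cmono b (ltnW kk0); rewrite ek0 /= => /andP[le _].
  by apply/orP; left; rewrite -val_eqE /= eqn_leq le -ltnS ltn_ord.
exists (@ChainSimplex V' n (fun k => unslab (b k))
  (fun k l kl => unslab_mono (cmono b kl))).
by apply: chain_eq => k /=; rewrite unslabK.
Qed.
End PrismLimit.

Section Families.
Context (C M : sset) (p : smor M (sprod C NFin)) (n : nat).
Let W := PN (optP 'I_n).

Lemma Z_eq k (z z' : Z p n k) : Zbase z = Zbase z' ->
  (forall l (d : Delta k l) o, Zfun z l (d, o) = Zfun z' l (d, o)) -> z = z'.
Proof.
move=> e h; apply: sval_inj; move: e h; rewrite /Zbase /Zfun.
case: (sval z) (sval z') => [c f] [c' f'] /= -> h; congr pair.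
by apply: smor_eq => l [d o]; apply: h.
Qed.

Lemma Zcocart0 (z : Z p n 0) i :
  is_cocartesian p (Zfun z 1 (dconst 1 ord0 : Delta 0 1, wedge i)).
Proof.
have -> : dconst 1 ord0 = degen (X := Delta 0) 1 (did 0) by apply: dhom_eq.
exact: Zcocart.
Qed.

Lemma Zpt_over k (z : Z p n k) : fib_proj p n k (Zpt p n k z) = Zbase z.
Proof. by rewrite /= Zover /= act_did. Qed.

Definition Ztranspose (A : sset) (u : smor A (Z p n)) : smor A (Fun W M) :=
  @SMor A (Fun W M) (fun k a => Zfun (u k a))
    (fun k l f a => congr1 (fun z : Z p n k => Zfun z : Fun W M k) (snat u f a)).

(** The image that [p] must have on a family: [c] in the direction of the simplex, the fixed diagram
    [rhoW] in that of the cone. *)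
Definition Zshape N (c : smor (Delta N) C) : smor (sprod (Delta N) W) (sprod C NFin) :=
  @SMor (sprod (Delta N) W) (sprod C NFin) (fun k ao => (c k ao.1, rhoW ao.2))
    (fun k l f ao => congr2 pair (snat c f ao.1) (rhoW_act f ao.2)).

Lemma Ztranspose_over N (u : smor (boundary N) (Z p n)) (c : smor (Delta N) C) :
  (forall k a, Zbase (u k a) = c k (sval a)) ->
  forall k a o, p k (uncurry_smor (Ztranspose u) k (a, o)) = Zshape c k (sval a, o).
Proof.
move=> hc k a o; rewrite -[uncurry_smor _ _ _]/(Zfun (u k a) k (did k, o)).
by rewrite Zover act_did hc.
Qed.

Lemma Ztranspose_vertex N (u : smor (boundary N) (Z p n)) (A : boundary N 0) k
    (d : Delta 0 k) (o : W k) :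
  uncurry_smor (Ztranspose u) k (act d A, o) = Zfun (u 0 A) k (d, o).
Proof. by rewrite -uncurry_act. Qed.

(** Cocartesian legs are demanded over vertices only, and from dimension 1 on all vertices lie in
    the boundary; a solution of the lifting problem is thus automatically a simplex of [Z]. *)
Lemma Z_of_solution (L : sset) (i : smor L W) N (u : smor (boundary N.+1) (Z p n))
    (v : smor (sprod (Delta N.+1) L) M) (c : smor (Delta N.+1) C) w :
  (forall k a, Zbase (u k a) = c k (sval a)) ->
  pp_solution i p (Ztranspose u) v (Zshape c) w ->
  exists w' : smor (Delta N.+1) (Z p n),
    [/\ forall k a, w' k (boundary_incl N.+1 k a) = u k a,
        forall k b, Zbase (w' k b) = c k b &
        forall k b o, Zfun (w' k b) k (did k, o) = w k (b, o)].
Proof.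
move=> hc [wu wv wh].
have fam : rho_family p (c N.+1 (did N.+1), (w : Fun W M N.+1)).
  split=> /= [l a o|a i0]; first by rewrite wh /= smor_Delta.
  have ha : [exists j, [forall l, a l != j]].
    have [j hj] := @ord_outside N.+2 [:: a ord0] isT.
    apply/existsP; exists j; apply/forallP => l; rewrite (ord1 l) eq_sym.
    by move: hj; rewrite inE.
  pose A : boundary N.+1 0 := exist _ a ha.
  rewrite (wu 1 (degen 1 A)) Ztranspose_vertex; exact: Zcocart0.
pose z : Z p n N.+1 := exist _ _ fam.
exists (ymap z); split.
- move=> k a; apply: Z_eq; first by rewrite hc [RHS]smor_Delta.
  move=> l d o; rewrite -[LHS]/(w l (sval (act d a), o)) wu.
  by rewrite -uncurry_act.
- by move=> k b; rewrite [RHS]smor_Delta.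
- move=> k b o; rewrite -[LHS]/(w k (dcomp b (did k), o)).
  by congr (w k (_, _)); apply: dhom_eq.
Qed.

Lemma not_proj_full N I m (b : PN (prodP (ordP N) (optP I)) m) :
  ~~ proj_full (supp b) <-> [exists j, [forall k, pn_fst b k != j]].
Proof.
split=> [h|/existsP[j /forallP h]].
  apply: contraNT h => h; apply/proj_fullP => j.
  have := existsPn h j; rewrite negb_forall => /existsP[k].
  by rewrite negbK => /eqP e; exists (b k) => //; apply: (supp_in b).
apply/negP => /proj_fullP /(_ j)[z /(suppP b)[k ->] e].
by have := h k; rewrite -e eqxx.
Qed.

(** Dimension 0 is settled by the section [Zsec]. Above it, the cocartesian edges asked for by
    [prism_from_cone] are the legs of the family at the vertex 0 of the boundary. *)
Lemma Zpt_trivial (rho : forall i : 'I_n, rho_transport p i) :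
  inner_fibration p -> trivial_fibration (Zpt p n).
Proof.
move=> hq [|N] u v huv.
  exists (ymap (Zsec rho 0 (v 0 (did 0)))); split=> k a; last first.
    by rewrite snat Zpt_sec -smor_Delta.
  by have /boundaryP[j ha] := svalP a; case/eqP: (ha ord0); rewrite !ord1.
pose vM : smor (sprod (Delta N.+1) (Delta 0)) M :=
  scomp (fiber_incl (scomp (ssnd C NFin) p) (vFin n)) (scomp v (sfst _ _)).
pose c : smor (Delta N.+1) C := scomp (fib_proj p n) v.
pose i : smor (Delta 0) W := ymap (wconst 0 None : W 0).
have iE k (l : Delta 0 k) : i k l = wconst k None by apply: act_wconst.
have hc k a : Zbase (u k a) = c k (sval a).
  by rewrite -Zpt_over huv.
have hpp : plift p (Zshape c) (pp_rel i (Ztranspose u) vM).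
  apply: pp_plift.
  - by move=> k a b _; apply: dhom_eq => l; rewrite !ord1.
  - exact: Ztranspose_over.
  - move=> k a l; rewrite iE -[RHS]/(c k a, rhoW (wconst k None)) rhoWN.
    exact: fib_over.
  - move=> k a l; rewrite iE -[LHS]/(sval (Zpt p n k (u k a))) huv.
    by [].
have hpl := plift_pull (pn_split N.+1 (optP 'I_n)) hpp.
have [|i0|G [hG sG dG]] := prism_from_cone (isT : 0 < N.+1) hq hpl.
- move=> k b; rewrite -[pdom _ _]/(pdom (pp_rel i (Ztranspose u) vM) (pn_split N.+1 (optP 'I_n) k b)).
  rewrite pp_dom; split.
    case=> [h|[l e]]; apply/orP; [left|right]; first exact/not_proj_full.
    rewrite iE in e; apply/forall_inP => z /(suppP b)[j ->].
    have := congr1 (fun o : W k => o j) e; rewrite /= => ->.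
    by rewrite eqxx.
  case/orP => [/not_proj_full h|/forall_inP h]; [by left|right].
  exists (dconst k ord0); rewrite iE; apply: chain_eq => j; apply/eqP; apply: h.
  exact: (supp_in b).
- have ha0 : [exists j, [forall l, @dconst 0 N.+1 ord0 l != j]].
    by apply/existsP; exists ord_max; apply/forallP.
  pose A : boundary N.+1 0 := exist _ (dconst 0 ord0) ha0.
  exists (Zfun (u 0 A) 1 (dconst 1 ord0 : Delta 0 1, wedge i0)); split; last exact: Zcocart0.
  rewrite pn_pairK; left; exists (degen 1 A); rewrite Ztranspose_vertex; split=> //.
have [w hw] := pp_from_poset (@pn_pairK N.+1 (optP 'I_n)) hG dG sG.
have [w' [w1 w2 w3]] := Z_of_solution hc hw.
exists w'; split=> // k b; apply: sval_inj; rewrite /= w3.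
have [_ wv _] := hw; rewrite -(iE k (dconst k ord0)) wv.
by [].
Qed.

(** Dimension 0 is the existence hypothesis, its legs assembled by [star]. Above it, the family at
    the last vertex of the boundary has legs forming a relative limit cone, which is what
    [prism_limit] asks for. *)
Lemma Zlegs_trivial :
  inner_fibration p ->
  (forall (x : M 0) (c : C 0) (f : 'I_n -> M 1),
     p 0 x = (c, vFin n) ->
     forall hf : (forall i, cocartesian_lift p x (id_edge c (rho_map i)) (f i)),
     is_relative_limit p (cone_of (fun i => cocartesian_lift_src (hf i)))) ->
  (forall (c : C 0) (y : 'I_n -> fib1_over p c 0),
     exists x : M 0, p 0 x = (c, vFin n) /\
        forall i : 'I_n, exists f : M 1,
          cocartesian_lift p x (id_edge c (rho_map i)) f /\
          tgt f = fib1_over_incl p c 0 (y i)) ->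
  trivial_fibration (Zlegs p n).
Proof.
move=> hq hb hc0 [|N] u v huv.
  pose y := v 0 (did 0); pose c := (sval y).1.
  have hy i : fib_proj p 1 0 ((sval y).2 i) = degen 0 c by rewrite degen0 (svalP y i).
  have [x [px hx]] := hc0 c (fun i => exist _ ((sval y).2 i) (hy i)).
  have [f hf] := boolp.choice hx.
  have sf i : src (f i) = x by have [[]] := hf i.
  pose z := star (h := pt_map x) (H := fun i => edge_map (f i))
    (fun i k a => edge_map_src a (sf i)).
  have fam : rho_family p (c, (z : Fun W M 0)).
    split=> /= [l a o|a i].
      rewrite /star_fun /rhoW /= /star_fun /=.
      case: (o ord_max) => [i|] /=; rewrite snat.
        by have [[_ -> _] _] := hf i; congr pair; rewrite act_degen act_to0.
      by rewrite px; congr pair; rewrite ?act_to0 //; apply: act_congr.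
    rewrite -[star_fun _ _ _]/(z 1 (degen 1 (X := Delta 0) a, wedge i)) star_wedge /=.
    by rewrite act_did; have [[]] := hf i.
  pose zz : Z p n 0 := exist _ _ fam.
  exists (ymap zz); split=> k a.
    by have /boundaryP[j ha] := svalP a; case/eqP: (ha ord0); rewrite !ord1.
  rewrite snat [RHS]smor_Delta; congr act; apply: sval_inj.
  rewrite -/y [sval y]surjective_pairing; congr pair; apply/funext => i.
  apply: sval_inj; have [_ e] := hf i.
  rewrite -[RHS]e -[LHS]/(z 0 (did 0, wconst 0 (Some i))) starS.
  exact: act_congr.
pose cC : smor (Delta N.+1) C := scomp (power_base 'I_n (fib_proj p 1)) v.
pose vM : smor (sprod (Delta N.+1) (disc_sset 'I_n)) M :=
  @SMor (sprod (Delta N.+1) (disc_sset 'I_n)) M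
    (fun k ai => sval (power_proj (fib_proj p 1) ai.2 k (v k ai.1)))
    (fun k l f ai => congr1 (fun y =>
      sval (power_proj (fib_proj p 1) ai.2 k y)) (snat v f ai.1)).
pose i : smor (disc_sset 'I_n) W :=
  @SMor (disc_sset 'I_n) W (fun k j => wconst k (Some j))
    (fun k l f j => esym (act_wconst f (Some j))).
have hc k a : Zbase (u k a) = cC k (sval a).
  by have := huv k a => /(congr1 (power_base 'I_n (fib_proj p 1) k)).
have hpp : plift p (Zshape cC) (pp_rel i (Ztranspose u) vM).
  apply: pp_plift.
  - by move=> k a b /(congr1 (fun o : W k => o ord0)) [].
  - exact: Ztranspose_over.
  - move=> k a l; rewrite -[RHS]/(cC k a, rhoW (wconst k (Some l))) rhoWS.
    rewrite -[p _ _]/(p k (sval (power_proj (fib_proj p 1) l k (v k a)))) fib_over.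
    by congr pair; apply: (svalP (v k a) l).
  - move=> k a l.
    exact: (congr1 (fun y => sval (power_proj (fib_proj p 1) l k y)) (huv k a)).
have hpl := plift_pull (pn_split N.+1 (optP 'I_n)) hpp.
have [|G1 [hG1 sG1 dG1]] := prism_from_base hq hpl.
  move=> k b; rewrite -[pdom _ _]/(pdom (pp_rel i (Ztranspose u) vM) (pn_split N.+1 (optP 'I_n) k b)).
  rewrite pp_dom; split.
    case=> [h|[l e]]; apply/orP; [left|right]; first exact/not_proj_full.
    apply/forall_inP => z /(suppP b)[j ->].
    by have := congr1 (fun o : W k => o j) e; rewrite /= => ->.
  case/orP => [/not_proj_full h|/forall_inP h]; [by left|right].
  have hj j : (b j).2 != None by apply: h; apply: (supp_in b).
  case e0: ((b ord0).2) (hj ord0) => [l|] // _; exists l; apply: chain_eq => j /=.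
  have := cmono b (leq0n _ : (ord0 : 'I_k.+1) <= j).
  by rewrite /= => /andP[_]; rewrite e0 /= => /eqP.
have ha1 : [exists j, [forall l, @dconst 0 N.+1 ord_max l != j]].
  by apply/existsP; exists ord0; apply/forallP.
pose A : boundary N.+1 0 := exist _ (dconst 0 ord_max) ha1.
pose x := Zfun (u 0 A) 0 (did 0, wconst 0 None).
pose f i0 := Zfun (u 0 A) 1 (dconst 1 ord0 : Delta 0 1, wedge i0).
pose c := Zbase (u 0 A).
have px : p 0 x = (c, vFin n) by rewrite Zover act_did rhoWN; congr pair; apply: degen0.
have hf i0 : cocartesian_lift p x (id_edge c (rho_map i0)) (f i0).
  split; last exact: Zcocart0.
  - rewrite /src -snat; congr (Zfun _ _ (_, _)); last exact: chain_eq.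
    by apply: dhom_eq => l; rewrite !ord1.
  - by rewrite Zover rhoW_edge.
have [||G2 [hG2 sG2 dG2]] := prism_limit (hb x c f px hf) hG1 dG1.
- apply: sG1; rewrite pn_pairK; left; exists (act (did 0) A); rewrite Ztranspose_vertex.
  by split=> //; apply: dhom_eq.
- move=> i0; apply: sG1; rewrite pn_pairK; left; exists (degen 1 A); rewrite Ztranspose_vertex.
  by split=> //; apply: dhom_eq.
have [w hw] := pp_from_poset (@pn_pairK N.+1 (optP 'I_n)) hG2 dG2
  (fun k b y h => sG2 _ _ _ (sG1 _ _ _ h)).
have [w' [w1 w2 w3]] := Z_of_solution hc hw.
exists w'; split=> // k b; apply: sval_inj.
rewrite [RHS]surjective_pairing; congr pair; first exact: w2.
apply/funext => i0; apply: sval_inj; rewrite /= w3.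
by have [_ wv _] := hw; rewrite -[wconst k (Some i0)]/(i k i0) wv.
Qed.

(** With [s'] a section of [Zlegs], the inverse is [Zpt] after [s']. Each composite and the
    corresponding identity are images of two lifts of one map along a trivial fibration: [Zlegs] for
    the first, [Zpt] for the second. *)
Lemma rho_tuple_equivalence (rho : forall i : 'I_n, rho_transport p i) :
  trivial_fibration (Zpt p n) -> trivial_fibration (Zlegs p n) ->
  equivalence_of_qcats (rho_tuple rho).
Proof.
move=> hpt hlegs.
have [s' hs'] := trivial_lift (sidm _) hlegs.
exists (scomp (Zpt p n) s'); split.
  have -> : sidm (fib p n) = scomp (Zpt p n) (Zsec rho).
    by apply: smor_eq => k x; rewrite [RHS]Zpt_sec.
  have -> : scomp (scomp (Zpt p n) s') (rho_tuple rho) =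
      scomp (Zpt p n) (scomp s' (rho_tuple rho)) by apply: smor_eq.
  apply: (trivial_homotopy _ hlegs) => k x.
  by rewrite Zlegs_sec; apply: hs'.
have -> : sidm _ = scomp (Zlegs p n) s' by apply: smor_eq => k x; rewrite [RHS]hs'.
have -> : scomp (rho_tuple rho) (scomp (Zpt p n) s') =
    scomp (Zlegs p n) (scomp (Zsec rho) (scomp (Zpt p n) s')).
  by apply: smor_eq => k x; rewrite [RHS]Zlegs_sec.
by apply: (trivial_homotopy _ hpt) => k x; apply: Zpt_sec.
Qed.
End Families.

(** * The fibre over <0> *)

Lemma lt_ord_max n (j : 'I_n.+1) : j <> ord_max -> j < n.
Proof.
by move/eqP; rewrite -val_eqE /= ltn_neqAle -ltnS ltn_ord andbT.
Qed.

Section OrdinalAsJoin.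
Context (N : nat).
Let V := joinP N (optP void).

(** Over the void the cone is a point, so its join with an N-simplex is a simplex of dimension
    [N.+1] whose last vertex is the cone point. *)
Definition vtop (z : V) : 'I_N.+2 := if z is inl j then widen_ord (leqnSn N.+1) j else ord_max.
Definition vjoin (j : 'I_N.+2) : V := if j == ord_max then inr None else inl (inord j).

Lemma vtop_mono z z' : fle z z' -> vtop z <= vtop z'.
Proof. by case: z => [j|o]; case: z' => [j'|o'] //= _; rewrite ltnW. Qed.

Lemma vjoin_mono (j j' : 'I_N.+2) : j <= j' -> fle (vjoin j) (vjoin j').
Proof.
rewrite /vjoin; case: eqP => [->|nj]; case: eqP => [->|nj'] //=.
  by move=> h; case: nj'; apply: val_inj; apply/eqP; rewrite eqn_leq h -ltnS ltn_ord.
by move=> h; rewrite !inordK // lt_ord_max.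
Qed.

Lemma vjoinK : cancel vjoin vtop.
Proof.
move=> j; rewrite /vjoin; case: eqP => [->//|nj] /=.
by apply: val_inj; rewrite /= inordK // lt_ord_max.
Qed.

Definition vtop_smor : smor (PN V) (Delta N.+1) :=
  @SMor (PN V) (Delta N.+1)
    (fun n s => @DHom n N.+1 (fun i => vtop (s i)) (fun i j ij => vtop_mono (cmono s ij)))
    (fun m n f s => @dhom_eq m N.+1 _ _ (fun i => erefl)).

Definition vjoin_smor : smor (Delta N.+1) (PN V) :=
  @SMor (Delta N.+1) (PN V)
    (fun n a => @ChainSimplex V n (fun i => vjoin (a i)) (fun i j ij =>
      vjoin_mono (dmono a ij)))
    (fun m n f a => @chain_eq V m _ _ (fun i => erefl)).

Lemma vjoin_smorK n a : vtop_smor n (vjoin_smor n a) = a.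
Proof. by apply: dhom_eq => i; apply: vjoinK. Qed.

Lemma vtop_boundary n (s : PN V n) : lim_dom s ->
  [exists j, [forall i, vtop_smor n s i != j]].
Proof.
case=> [[j h]|h]; apply/boundaryP.
  exists (widen_ord (leqnSn N.+1) j) => i /=; have := h i.
  case: (s i) => [j'|o] /= hj; apply/eqP => /(congr1 val) /= e.
    by case/eqP: hj; congr inl; apply: val_inj.
  by have := ltn_ord j; rewrite -e ltnn.
exists ord_max => i /=; have := h i; case: (s i) => [j'|[[]|]] //= _.
by rewrite -val_eqE /= neq_ltn ltn_ord.
Qed.

Lemma vjoin_boundary n (a : Delta N.+1 n) : [exists j, [forall i, a i != j]] ->
  lim_dom (vjoin_smor n a).
Proof.
move/boundaryP => [j h]; have [ej|nj] := eqVneq j ord_max.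
  by right=> i /=; rewrite /vjoin -ej (negbTE (h i)).
left; exists (inord j) => i /=; rewrite /vjoin; have [//|ni] := eqVneq (a i) ord_max.
apply/eqP => -[] /(congr1 val) /=; rewrite !inordK ?lt_ord_max //; try exact/eqP.
by move=> e; case/eqP: (h i); apply: val_inj.
Qed.
End OrdinalAsJoin.

(** Under the identification of the join with a simplex, [lim_dom] becomes the boundary and the cone
    point its last vertex, which is relatively terminal; [limit_fill] then fills. In dimension 0 an
    object of the fibre is needed. *)
Lemma fib0_trivial (C M : sset) (p : smor M (sprod C NFin)) :
  (forall x : fib p 0 0, is_relative_terminal p (sval x)) ->
  (forall c : C 0, inhabited (fiber p (c, vFin 0) 0)) ->
  trivial_fibration (fib_proj p 0).
Proof.
move=> ht hne [|N] u v huv.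
  have [m] := hne (v 0 (did 0)).
  have hm : scomp (ssnd C NFin) p 0 (sval m) = degen 0 (vFin 0) by rewrite /= (svalP m).
  exists (ymap (exist _ (sval m) hm : fib p 0 0)); split=> k a.
    by have /boundaryP[j ha] := svalP a; case/eqP: (ha ord0); rewrite !ord1.
  rewrite snat [RHS]smor_Delta; congr act.
  by rewrite -[LHS]/((p 0 (sval m)).1) (svalP m) degen0.
have ha0 : [exists j, [forall l, @dconst 0 N.+1 ord_max l != j]].
  by apply/existsP; exists ord0; apply/forallP.
pose x := u 0 (exist _ (dconst 0 ord_max) ha0).
pose w2 n (s : subsset (@lim_dom_closed void N) n) : boundary N.+1 n :=
  exist _ (vtop_smor N n (sval s)) (vtop_boundary (svalP s)).
have u2n m n (f : dhom m n) s : sval (u m (w2 m (act f s))) = act f (sval (u n (w2 n s))).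
  rewrite -[RHS]/(sval (act f (u n (w2 n s)) : fib p 0 m)) -snat; congr (sval (u _ _)).
  by apply: eq_exist; apply: dhom_eq.
pose u2 : smor (subsset (@lim_dom_closed void N)) M :=
  @SMor (subsset (@lim_dom_closed void N)) M (fun n s => sval (u n (w2 n s))) u2n.
pose v2 : smor (PN (joinP N (optP void))) (sprod C NFin) :=
  @SMor (PN (joinP N (optP void))) (sprod C NFin)
    (fun n s => (v n (vtop_smor N n s), degen n (vFin 0)))
    (fun m n f s => congr2 pair (snat (scomp v (vtop_smor N)) f s) (esym (act_degen f (vFin 0)))).
have [|||w [w1 w2']] := limit_fill (ht x) (u := u2) (v := v2).
- by move=> n s; rewrite /= fib_over huv.
- by case.
- move=> h; rewrite /= /x; congr (sval (u 0 _)); apply: eq_exist.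
  exact: dhom_eq.
have hw n (b : Delta N.+1 n) : scomp (ssnd C NFin) p n (w n (vjoin_smor N n b)) = degen n (vFin 0).
  by rewrite /= w2'.
have hwn m n (f : dhom m n) (b : Delta N.+1 n) :
    (exist _ _ (hw m (act f b)) : fib p 0 m) = act f (exist _ _ (hw n b) : fib p 0 n).
  by apply: eq_exist; rewrite -snat -snat.
exists (@SMor (Delta N.+1) (fib p 0) (fun n b => exist _ _ (hw n b)) hwn); split=> k a.
  apply: sval_inj; rewrite /= (w1 k (exist _ _ (vjoin_boundary (svalP a)))) /=.
  congr (sval (u k _)); apply: sval_inj => /=; exact: vjoin_smorK.
rewrite -[LHS]/((p k (w k (vjoin_smor N k a))).1) w2'.
by rewrite -[LHS]/(v k (vtop_smor N k (vjoin_smor N k a))) vjoin_smorK.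
Qed.

(** [rho] is an arbitrary choice of transports, so the equivalence holds for whichever functors
    represent the induced ones. *)
Theorem proposition2p1 (C M : sset) (hC : quasicategory C)
  (p : smor M (sprod C NFin)) (hp : categorical_fibration p)
  (ha : forall (x : M 0) (c : C 0) (m n : nat) (alpha : pointed_map m n),
     p 0 x = (c, vFin m) -> inert alpha ->
     exists f : M 1, cocartesian_lift p x (id_edge c alpha) f)
  (hb : forall (x : M 0) (c : C 0) (m : nat) (f : 'I_m -> M 1),
     p 0 x = (c, vFin m) -> 0 < m ->
     forall hf : (forall i, cocartesian_lift p x (id_edge c (rho_map i)) (f i)),
     is_relative_limit p
       (cone_of (fun i => cocartesian_lift_src (hf i))))
  (hb0 : forall x : fib p 0 0, is_relative_terminal p (sval x))
  (rho : forall (n : nat) (i : 'I_n), rho_transport p i) :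
  ((forall (n : nat) (c : C 0) (y : 'I_n -> fib1_over p c 0), 0 < n ->
      exists x : M 0, p 0 x = (c, vFin n) /\
        forall i : 'I_n, exists f : M 1,
          cocartesian_lift p x (id_edge c (rho_map i)) f /\
          tgt f = fib1_over_incl p c 0 (y i)) /\
   (forall c : C 0, inhabited (fiber p (c, vFin 0) 0)))
  <->
  ((forall n : nat, 0 < n -> equivalence_of_qcats (rho_tuple (rho n))) /\
   trivial_fibration (fib_proj p 0)).
Proof.
have hq := categorical_inner hp.
split=> [[hy h0]|[he ht]]; split.
- move=> n n0; apply: rho_tuple_equivalence; first exact: (Zpt_trivial (rho n)).
  apply: Zlegs_trivial => // [x c f px hf|c y]; first exact: hb.
  exact: hy.
- exact: fib0_trivial.
- move=> n c y n0; exact: (rho_tuple_equivalence_lift hC hp (he n n0)).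
- move=> c.
  have [w hw] := trivial_lift (ymap c) ht.
  have hx : fib_proj p 0 0 (w 0 (did 0)) = c by rewrite hw /= -[LHS]/(act (did 0) c) act_did.
  have hm : p 0 (sval (w 0 (did 0))) = degen 0 ((c, vFin 0) : sprod C NFin 0).
    by rewrite fib_over hx !degen0.
  by constructor; exists (sval (w 0 (did 0))).
Qed.
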